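(* Let $\alpha\in[0,1)$ be a constant, let $T>0$ be fixed and let $0<\Delta x\le1$. Suppose $(\bar u,\bar\mu,\bar\nu)\in\mathcal{D}_0^\alpha$ with $\bar u_x\in B_2^\beta$ for some $\beta\in(0,1]$. Let $(u,\mu,\nu)(t)=T_t((\bar u,\bar\mu,\bar\nu))$ be the $\alpha$-dissipative solution and let $(u_{\Delta x},\mu_{\Delta x},\nu_{\Delta x})(t)=T_t\circ P_{\Delta x}((\bar u,\bar\mu,\bar\nu))$ be the numerical solution. Then there is a constant $\bar D$, dependent on $T$, $\bar G_\infty=\bar\nu(\mathbb{R})$, $\|\bar u\|_\infty$, $\beta$ and $|\bar u_x|_{2,\beta}$ (in particular, independent of $\Delta x$), such that $$\sup_{t\in[0,T]}\|u(t)-u_{\Delta x}(t)\|_\infty\le\bar D\,\Delta x^{\beta/4}.$$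
   Context: Norms: $\|\cdot\|_p$ is the norm of $L^p(\mathbb{R})$. **Initial data.** Let $\theta^{\pm}\in C^\infty(\mathbb{R})$ satisfy $\theta^++\theta^-=1$, $0\le\theta^\pm\le1$, $\mathrm{supp}(\theta^+)\subset(-1,\infty)$, $\mathrm{supp}(\theta^-)\subset(-\infty,1)$. $E_2$ is the set of functions $f+a\theta^++b\theta^-$ with $f\in H^1(\mathbb{R})$, $a,b\in\mathbb{R}$; $E_1^0$ is the set of functions $f+a\theta^+$ with $f\in L^2(\mathbb{R})$, $a\in\mathbb{R}$. $\mathcal{D}_0^\alpha$ is the set of triplets $(u,\mu,\nu)$ with $u\in E_2$, $\mu=\nu$ a finite positive Radon measure on $\mathbb{R}$, $d\mu_{\mathrm{ac}}=u_x^2dx$ and $\mu((-\infty,\cdot))\in E_1^0$. Write $F(x)=\mu((-\infty,x))$, $G(x)=\nu((-\infty,x))$, $F_{\mathrm{ac}}(x)=\mu_{\mathrm{ac}}((-\infty,x))$, $F_{\mathrm{sing}}=F-F_{\mathrm{ac}}$, $F_\infty=\mu(\mathbb{R})$, $G_\infty=\nu(\mathbb{R})$; triplets are identified with $(u,F,G)$. Bars denote the initial data. **Regularity class.** With $\delta_hf(x)=f(x+h)-f(x)$, $B_2^\beta=\{f\in L^2(\mathbb{R}): \exists C>0,\ \|\delta_hf\|_2\le Ch^\beta\ \forall h\in(0,2]\}$ and $|f|_{2,\beta}=\sup_{h\in(0,2]}h^{-\beta}\|\delta_hf\|_2$. **Projection $P_{\Delta x}:\mathcal{D}_0^\alpha\to\mathcal{D}_0^\alpha$.**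 Let $x_j=j\Delta x$, $f_j=f(x_j)$, $Df_{2j}=\frac{f_{2j+2}-f_{2j}}{2\Delta x}$, $q_{2j}=\sqrt{DF_{\mathrm{ac},2j}-(Du_{2j})^2}$. For each $j\in\mathbb{Z}$ pick a sign $s_j\in\{1,-1\}$ (any choice is allowed). Then $P_{\Delta x}((u,F,G))=(u_{\Delta x},F_{\Delta x},G_{\Delta x})$ with $u_{\Delta x}(x)=u_{2j}+(Du_{2j}-s_jq_{2j})(x-x_{2j})$ on $(x_{2j},x_{2j+1}]$, $u_{\Delta x}(x)=u_{2j+2}+(Du_{2j}+s_jq_{2j})(x-x_{2j+2})$ on $(x_{2j+1},x_{2j+2}]$; $G_{\Delta x}=F_{\Delta x}=F_{\Delta x,\mathrm{ac}}+F_{\Delta x,\mathrm{sing}}$, where $F_{\Delta x,\mathrm{ac}}(x)=F_{\mathrm{ac},2j}+(Du_{2j}-s_jq_{2j})^2(x-x_{2j})$ on $(x_{2j},x_{2j+1}]$, $F_{\Delta x,\mathrm{ac}}(x)=\frac12(F_{\mathrm{ac},2j+2}+F_{\mathrm{ac},2j})-2s_jDu_{2j}q_{2j}\Delta x+(Du_{2j}+s_jq_{2j})^2(x-x_{2j+1})$ on $(x_{2j+1},x_{2j+2}]$, and $F_{\Delta x,\mathrm{sing}}(x)=F_{\mathrm{sing},2j+2}$ on $(x_{2j},x_{2j+2}]$. **Map $L$.** For $(u,\mu,\nu)\in\mathcal{D}_0^\alpha$, $L((u,\mu,\nu))=(y,U,V,H)$ with $y(\xi)=\sup\{x: x+\nu((-\infty,x))<\xi\}$,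 $U(\xi)=u(y(\xi))$, $H(\xi)=\xi-y(\xi)$, $V=H$. **Lagrangian evolution $S_t$.** $S_t(\bar X)=X(t)=(y,U,V,H)(t)$ is the unique global solution with $X(0)=\bar X=(\bar y,\bar U,\bar V,\bar H)$ of $y_t=U$, $U_t=\frac12V-\frac14V_\infty(t)$, $V(t,\xi)=\int_{-\infty}^\xi\big(1-\alpha\chi_{\{\omega: t\ge\tau(\omega)>0\}}(\eta)\big)\bar V_\xi(\eta)\,d\eta$, $H_t=0$, where $V_\infty(t)=\lim_{\xi\to\infty}V(t,\xi)$ and $\tau(\xi)=0$ if $\bar y_\xi(\xi)=\bar U_\xi(\xi)=0$, $\tau(\xi)=-2\bar y_\xi(\xi)/\bar U_\xi(\xi)$ if $\bar U_\xi(\xi)<0$, and $\tau(\xi)=\infty$ otherwise. **Map $M$.** $M((y,U,V,H))=(u,\mu,\nu)$ with $u(x)=U(\xi)$ for any $\xi$ with $x=y(\xi)$, $\mu=y_\#(V_\xi d\xi)$, $\nu=y_\#(H_\xi d\xi)$ (push-forwards). The $\alpha$-dissipative solution is given by $T_t=M\circ S_t\circ L$. For constant $\alpha$ the numerical Lagrangian evolution coincides with the exact evolution $S_t$ of the projected data, so the numerical solution is $T_t\circ P_{\Delta x}((\bar u,\bar\mu,\bar\nu))$. *)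

(* Defs.v *)
From HB Require Import structures.
From mathcomp Require Import all_boot all_order all_algebra.
From mathcomp Require Import all_classical all_reals all_analysis.

Set Implicit Arguments.
Unset Strict Implicit.
Unset Printing Implicit Defensive.
Import Order.TTheory GRing.Theory Num.Theory.
Import numFieldNormedType.Exports.

Local Open Scope classical_set_scope.
Local Open Scope ring_scope.

Notation leb := (@lebesgue_measure _).
Notation fin_measure R :=
  {finite_measure set (measurableTypeR R) -> \bar R}.

Section FunctionSpaces.
Variable R : realType.
Implicit Types (f g u : R -> R) (p : \bar R).

(* The norm of L^p(R), with value +oo outside L^p. *)
Definition normL p f : \bar R := Lnorm (@lebesgue_measure R) p (EFin \o f).

Definition inL p f : Prop := f \in Lfun (@lebesgue_measure R) p.

Definition supp f : set R := closure [set x | f x != 0].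

Definition smooth f : Prop := forall n x, derivable (derive1n n f) x 1.

Definition test_function f : Prop := smooth f /\ compact (supp f).

Definition weak_derivative f g : Prop :=
  [/\ locally_integrable setT f, locally_integrable setT g &
      forall phi, test_function phi ->
        \int[leb]_x (f x * derive1 phi x) = - \int[leb]_x (g x * phi x)].

(* An element of H^1(R) is represented by its continuous representative, since
   the elements of E_2 are evaluated at points. *)
Definition H1 f : Prop :=
  [/\ continuous f, inL 2 f & exists2 g, inL 2 g & weak_derivative f g].

Definition partition_pair (thp thm : R -> R) : Prop :=
  [/\ smooth thp /\ smooth thm,
      forall x, thp x + thm x = 1,
      forall x, 0 <= thp x <= 1 /\ 0 <= thm x <= 1,
      supp thp `<=` `]-1, +oo[ &
      supp thm `<=` `]-oo, 1[].

Definition E2 (thp thm : R -> R) u : Prop :=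
  exists f a b, H1 f /\ forall x, u x = f x + a * thp x + b * thm x.

Definition E10 (thp : R -> R) F : Prop :=
  exists f a, inL 2 f /\ forall x : R, F x = f x + a * thp x.

Definition delta (h : R) f : R -> R := fun x => f (x + h) - f x.

Definition B2 (beta : R) f : Prop :=
  inL 2 f /\ exists2 C : R, 0 < C &
    forall h : R, 0 < h <= 2 -> (normL 2 (delta h f) <= (C * h `^ beta)%:E)%E.

Definition B2_seminorm (beta : R) f : \bar R :=
  ereal_sup [set ((h `^ (- beta))%:E * normL 2 (delta h f))%E
            | h in `]0, 2]%classic].

End FunctionSpaces.

Section EulerianData.
Variable R : realType.
Implicit Types (u F : R -> R) (mu nu mu_ac mu_sing : fin_measure R).

Definition lebesgue_decomposition mu mu_ac mu_sing : Prop :=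
  [/\ forall A : set (measurableTypeR R), measurable A ->
        mu A = (mu_ac A + mu_sing A)%E,
      forall A : set (measurableTypeR R), measurable A ->
        lebesgue_measure A = 0%E -> mu_ac A = 0%E &
      exists N : set (measurableTypeR R),
        [/\ measurable N, lebesgue_measure N = 0%E & mu_sing (~` N) = 0%E]].

Definition Fdist mu : R -> R := fun x => fine (mu `]-oo, x[%classic).

(* Membership of (u, mu, nu) in the set of admissible initial data, where ux
   is the weak derivative of u and mu_ac the absolutely continuous part of mu.
   Every finite positive Borel measure on R is a Radon measure. *)
Definition D0 (thp thm : R -> R) u (ux : R -> R) mu nu mu_ac : Prop :=
  [/\ E2 thp thm u,
      forall A : set (measurableTypeR R), measurable A -> mu A = nu A,
      forall A : set (measurableTypeR R), measurable A ->
        mu_ac A = (\int[leb]_(x in A) (ux x ^+ 2)%:E)%E &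
      E10 thp (Fdist mu)].

(* A triplet (u, mu, nu) identified with (u, F, G), where F and G are the
   distribution functions x |-> mu (-oo, x) and x |-> nu (-oo, x). *)
Record eulerian := Eulerian { Eu : R -> R; EF : R -> R; EG : R -> R }.

Definition eulerian_of u mu nu : eulerian := Eulerian u (Fdist mu) (Fdist nu).

End EulerianData.

Section Projection.
Variables (R : realType) (dx : R) (s : int -> bool).
Implicit Types (f u F Fac : R -> R) (j k : int).

Definition grid k : R := k%:~R * dx.

Definition Dgrid f j : R :=
  (f (grid (2 * j + 2)) - f (grid (2 * j))) / (2 * dx).

Definition qgrid u Fac j : R := Num.sqrt (Dgrid Fac j - Dgrid u j ^+ 2).

(* The j such that grid (2 * j) < x <= grid (2 * j + 2). *)
Definition cell (x : R) : int := Num.ceil (x / (2 * dx)) - 1.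

(* The free sign of the j-th cell is (-1) ^+ s j. *)
Definition proj_u u Fac (x : R) : R :=
  let j := cell x in
  let d := Dgrid u j in
  let sq := (-1) ^+ s j * qgrid u Fac j in
  if x <= grid (2 * j + 1)
  then u (grid (2 * j)) + (d - sq) * (x - grid (2 * j))
  else u (grid (2 * j + 2)) + (d + sq) * (x - grid (2 * j + 2)).

Definition proj_Fac u Fac (x : R) : R :=
  let j := cell x in
  let d := Dgrid u j in
  let sq := (-1) ^+ s j * qgrid u Fac j in
  if x <= grid (2 * j + 1)
  then Fac (grid (2 * j)) + (d - sq) ^+ 2 * (x - grid (2 * j))
  else 2^-1 * (Fac (grid (2 * j + 2)) + Fac (grid (2 * j)))
       - 2 * d * sq * dx + (d + sq) ^+ 2 * (x - grid (2 * j + 1)).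

Definition proj_Fsing F Fac (x : R) : R :=
  let xr := grid (2 * cell x + 2) in F xr - Fac xr.

Definition projection Fac (X : eulerian R) : eulerian R :=
  let F x := proj_Fac (Eu X) Fac x + proj_Fsing (EF X) Fac x in
  Eulerian (proj_u (Eu X) Fac) F F.

End Projection.

Section Evolution.
Variable R : realType.

Record lagrangian :=
  Lagrangian { Ly : R -> R; LU : R -> R; LV : R -> R; LH : R -> R }.

Implicit Types (X : lagrangian) (t xi : R).

Definition mapL (X : eulerian R) : lagrangian :=
  let y xi := sup [set x | x + EG X x < xi] in
  let H xi := xi - y xi in
  Lagrangian y (fun xi => Eu X (y xi)) H H.

Definition tau X xi : \bar R :=
  if (derive1 (Ly X) xi == 0) && (derive1 (LU X) xi == 0) then 0%E
  else if derive1 (LU X) xi < 0 then (- 2 * derive1 (Ly X) xi / derive1 (LU X) xi)%:E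
  else +oo%E.

Definition evolV (alpha : R) X t xi : R :=
  \int[leb]_(eta in `]-oo, xi])
    ((1 - alpha * \1_[set w | (0 < tau X w <= t%:E)%E] eta)
     * derive1 (LV X) eta).

Definition evolVinf (alpha : R) X t : R :=
  lim (evolV alpha X t xi @[xi --> +oo]).

(* The Lagrangian system, integrated in time: V may jump in t (where
   {tau = t} has positive measure), so U_t = V / 2 - V_infty / 4 only makes
   sense in integrated form.  V depends on the initial data alone, hence the
   integrated equations determine U, and then y. *)
Definition evolU (alpha : R) X t xi : R :=
  LU X xi + \int[leb]_(r in `[0, t])
    (2^-1 * evolV alpha X r xi - 4^-1 * evolVinf alpha X r).

Definition evoly (alpha : R) X t xi : R :=
  Ly X xi + \int[leb]_(r in `[0, t]) evolU alpha X r xi.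

Definition mapS (alpha : R) t X : lagrangian :=
  Lagrangian (evoly alpha X t) (evolU alpha X t) (evolV alpha X t) (LH X).

Record solution := Solution
  { sol_u : R -> R; sol_mu : set R -> \bar R; sol_nu : set R -> \bar R }.

(* U is constant on the level sets of y, so any preimage of x may be used. *)
Definition mapM X : solution :=
  Solution
    (fun x => LU X (xget 0 [set xi | Ly X xi = x]))
    (fun A => \int[leb]_(xi in Ly X @^-1` A) (derive1 (LV X) xi)%:E)%E
    (fun A => \int[leb]_(xi in Ly X @^-1` A) (derive1 (LH X) xi)%:E)%E.

Definition mapT (alpha : R) t (X : eulerian R) : solution :=
  mapM (mapS alpha t (mapL X)).

End Evolution.

(* Main.v *)
(* For constant alpha the whole evolution is explicit in terms of the initial
   data.  Write p = u_x: energy is lost at time -2 / p, so up to time t the loss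
   is alpha times p^2 1_{t p <= -2} dx, and the first and second primitives of
   this density in t are p min(t p + 2, 0) and min(t p + 2, 0)^2 / 2, which are
   locally Lipschitz in p.  Hence U(t, xi) and y(t, xi) involve only u(y(xi)),
   y(xi) and integrals of these two functions of p over half-lines ending at
   y(xi).  For the data and its projection, y(xi) lies in the same cell
   (x_2j, x_2j+2); with e = dx^(beta/2), Besov regularity bounds both the energy
   of p on such a cell by O(e) and the squared L^2 distance between p and the
   projected derivative by O(e^2), so U and y differ by O(e), uniformly in xi.

   Going back to Eulerian coordinates costs a square root: with y_1 and U_1 the
   projected counterparts, y_1(xi) is within O(e) of x = y(xi), hence of
   y_1(xi_1) = x, and the characteristics satisfy
   |U(xi) - U(xi')| <= (l |H(xi) - H(xi')| + |y(xi) - y(xi')| / l) / 2 for all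
   l > 0, where H is bounded by the total energy: a Hoelder estimate of exponent
   1/2 in y.

   The cell energy is estimated on the scale l = 2 dx^(1/2): averaging over
   translations, the energy of p on an interval of length 2 dx is at most
   O(l^(2 beta)) + O(dx / l). *)

From HB Require Import structures.
Require Import Defs.
From mathcomp Require Import all_boot all_order all_algebra.
From mathcomp Require Import all_classical all_reals all_analysis.
From mathcomp Require Import measurable_realfun ess_sup_inf ring lra.
Import Order.TTheory GRing.Theory Num.Theory.
Import numFieldNormedType.Exports.
Set Implicit Arguments.
Unset Strict Implicit.
Unset Printing Implicit Defensive.
Local Open Scope classical_set_scope.
Local Open Scope ring_scope.

(** The energy [V] is not stable under perturbation: the set that has broken by time [t] changes
    abruptly as [u_x] crosses [-2 / t]. Only integration in time makes the loss Lipschitz in [u_x],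
    so space and time integrals are exchanged before anything is compared. The closed formulas rest
    on the image of the Lebesgue measure under [y], which is [dx + mu]: it gives the derivatives of
    [y] and [u \o y] almost everywhere and turns integrals in [xi] into integrals in [x]. Data and
    projected data are two instances of the record [profile], so each estimate is proved once. The
    projection keeps [u] and the energy at the nodes and the total energy, which removes [G] from
    the differences; its free signs are harmless because only the square of [s_j q_j], the variance
    of [u_x] on a cell, enters the estimates. The Hoelder estimate is an integrated sum of squares;
    the choice [l = e^(1/2)] makes both of its terms of order [e]. Increments of [u] are recovered
    from the weak derivative by testing with differences of rescaled copies of [theta^+], the smooth
    step that [partition_pair] provides. *)

(** * Integration off null sets, translations, differentiation of primitives *)

Section NullSets.
Context d (T : measurableType d) (R : realType).
Variable mu : {measure set T -> \bar R}.
Import HBNNSimple.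

(** Measurability of [f] and [g] is avoided because the integrand of [evolV] contains a derivative
    and the indicator of a set defined by [tau], both identified only almost everywhere. The
    integral is a supremum over simple functions: one that lies below [f], once set to 0 on [E],
    lies below [g] and keeps its integral. *)
Lemma ge0_integral_eq_off_null (E : set T) (f g : T -> \bar R) :
  measurable E -> mu E = 0%E ->
  (forall x, 0 <= f x)%E -> (forall x, 0 <= g x)%E ->
  (forall x, ~ E x -> f x = g x) ->
  (\int[mu]_x f x = \int[mu]_x g x)%E.
Proof.
move=> mE E0; wlog suff le : f g / (forall x, 0 <= f x)%E ->
  (forall x, 0 <= g x)%E -> (forall x, ~ E x -> f x = g x) ->
  (\int[mu]_x f x <= \int[mu]_x g x)%E.
  move=> f0 g0 fg; apply/eqP; rewrite eq_le !le// => x Ex.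
  by rewrite fg.
move=> f0 g0 fg; rewrite !ge0_integralTE//.
apply: ge_ereal_sup => /= _ [h /= hf <-].
have mEc : measurable (~` E) by exact: measurableC.
have pE x : proj_nnsfun h mEc x = if x \in ~` E then h x else 0.
  by rewrite -mrestrict patchE.
apply: ereal_sup_ubound; exists (proj_nnsfun h mEc).
  by move=> x; rewrite pE; case: ifPn; rewrite ?inE// => Ex; rewrite -fg.
rewrite -!integralT_nnsfun; apply: ge0_ae_eq_integral => //.
- by apply/measurable_EFinP.
- by apply/measurable_EFinP.
- by move=> x _; rewrite lee_fin.
- by move=> x _; rewrite lee_fin.
exists E; split => // x /= /not_implyP[_] ne; apply: contrapT => Ex; apply: ne.
by have /= -> := pE x; rewrite mem_set.
Qed.

Lemma integral_eq_off_null (D E : set T) (f g : T -> \bar R) :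
  measurable E -> mu E = 0%E -> (forall x, ~ E x -> f x = g x) ->
  (\int[mu]_(x in D) f x = \int[mu]_(x in D) g x)%E.
Proof.
move=> mE E0 fg; rewrite integral_mkcond [RHS]integral_mkcond.
rewrite integralE [in RHS]integralE.
have e x : ~ E x -> (f \_ D) x = (g \_ D) x.
  by move=> Ex; rewrite !patchE; case: ifP => // _; rewrite fg.
by congr (_ - _)%E; apply: (@ge0_integral_eq_off_null E) => // x Ex;
  rewrite ?funeposE ?funenegE e.
Qed.

Lemma Rintegral_eq_off_null (D E : set T) (f g : T -> R) :
  measurable E -> mu E = 0%E -> (forall x, ~ E x -> f x = g x) ->
  \int[mu]_(x in D) f x = \int[mu]_(x in D) g x.
Proof.
move=> mE E0 fg; congr fine; apply: (integral_eq_off_null _ mE E0) => x Ex.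
by rewrite fg.
Qed.

End NullSets.

Section Transport.
Variable R : realType.
Implicit Types m : {measure set (measurableTypeR R) -> \bar R}.

(** Intervals closed on the left are the convenient generators: for a left-continuous [F], the
    preimage of [[a, b[] under [ginv F] is exactly [[a + F a, b + F b[]. *)
Lemma measure_eq_itvco m1 m2 :
  (forall a b : R, a < b -> m1 `[a, b[%classic = m2 `[a, b[%classic) ->
  (forall a b : R, a < b -> (m1 `[a, b[%classic < +oo)%E) ->
  forall A, measurable A -> m1 A = m2 A.
Proof.
move=> m12 m1oo A mA.
pose G := [set A : set (measurableTypeR R) | exists a b : R, A = `[a, b[%classic].
apply: (measure_unique G (fun n => `[- (n.+1%:R : R), n.+1%:R[%classic)) => //.
- rewrite [LHS]RGenInftyO.measurableE eqEsubset; split => B.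
    apply: smallest_sub; first exact: smallest_sigma_algebra.
    move=> _ [x ->].
    have -> : `]-oo, x[%classic = \bigcup_k (`[x - k.+1%:R, x[%classic : set R).
      apply/seteqP; split => y /=; rewrite !in_itv/=.
        move=> yx; exists (Num.truncn (x - y)) => //=.
        rewrite in_itv/= yx andbT lerBlDr -lerBlDl ltW//.
        by have /andP[] : (Num.truncn (x - y))%:R <= x - y < (Num.truncn (x - y)).+1%:R
          by apply: truncn_itv; rewrite subr_ge0 ltW.
      by case=> k _ /=; rewrite in_itv/= => /andP[].
    apply: (@bigcupT_measurable _ (g_sigma_algebraType G)) => k.
    by apply: sub_sigma_algebra; eexists; eexists.
  apply: smallest_sub; first exact: smallest_sigma_algebra.
  by move=> _ [a [b ->]]; apply: RGenInftyO.measurable_itv_bounded.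
- move=> _ _ [a [b ->]] [c [e ->]]; exists (Num.max a c), (Num.min b e).
  apply/seteqP; split => y /=; rewrite !in_itv/= ge_max lt_min.
    by move=> [/andP[-> ->] /andP[-> ->]].
  by move=> /andP[/andP[-> ->] /andP[-> ->]].
- by move=> i; eexists; eexists.
- apply/seteqP; split => // y _; exists (Num.truncn `|y|) => //=.
  have /andP[_ h] := truncn_itv (normr_ge0 y).
  rewrite in_itv/=; move: h; rewrite ltr_norml => /andP[h1 ->].
  by rewrite ltW.
- move=> _ [a [b ->]]; have [ab|ba] := ltP a b; first exact: m12.
  by rewrite set_itv_ge ?bnd_simp -?leNgt// !measure0.
- by move=> k; apply: m1oo; apply: (@lt_trans _ _ 0); rewrite ?oppr_lt0 ltr0n.
Qed.

Lemma lebesgue_measure_translate (c : R) (A : set (measurableTypeR R)) :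
  measurable A ->
  lebesgue_measure ((fun x : R => x + c) @^-1` A) = lebesgue_measure A.
Proof.
move=> mA.
have mt : measurable_fun setT ((fun x => x + c) : measurableTypeR R -> measurableTypeR R).
  by apply: measurable_funD.
apply/esym.
apply: (@lebesgue_measure_unique _ (pushforward lebesgue_measure ((fun x : R => x + c) : _ -> measurableTypeR R))) => // _ [[a b]] _ <-.
rewrite [RHS](_ : _ = lebesgue_measure `]a - c, b - c]%classic); last first.
  congr lebesgue_measure.
  by apply/seteqP; split => x /=; rewrite !in_itv/= ltrBlDr lerBrDr.
rewrite !lebesgue_measure_itv /= !lte_fin ltrD2r -!EFinB.
by congr (if _ then _%:E else _); ring.
Qed.

Lemma ge0_integral_translate (c : R) (f : R -> \bar R) :
  measurable_fun setT f -> (forall x, 0 <= f x)%E ->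
  (\int[@lebesgue_measure R]_x f (x + c)%R = \int[@lebesgue_measure R]_x f x)%E.
Proof.
move=> mf f0.
have mt : measurable_fun setT ((fun x => x + c) : measurableTypeR R -> measurableTypeR R).
  by apply: measurable_funD.
rewrite -[LHS](@ge0_integral_pushforward _ _ _ _ _ _ mt lebesgue_measure setT f)//.
by apply: eq_measure_integral => A mA _; exact: lebesgue_measure_translate.
Qed.

End Transport.

Section Integrability.
Context d (T : measurableType d) (R : realType).
Variable mu : {measure set T -> \bar R}.

Lemma integrable_dom (A : set T) (f g : T -> R) : measurable A ->
  measurable_fun A f -> (forall x, A x -> `|f x| <= g x) ->
  mu.-integrable A (EFin \o g) -> mu.-integrable A (EFin \o f).
Proof.
move=> mA mf fg; apply: le_integrable => //; first exact/measurable_EFinP.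
by move=> x Ax /=; rewrite lee_fin (le_trans (fg x Ax))// ler_norm.
Qed.

Lemma integrable_bounded (A : set T) (f : T -> R) (M : R) : measurable A ->
  (mu A < +oo)%E -> measurable_fun A f -> (forall x, A x -> `|f x| <= M) ->
  mu.-integrable A (EFin \o f).
Proof.
move=> mA Afin mf fM; apply: measurable_bounded_integrable => //.
exists M; split; first exact: num_real.
by move=> N MN x Ax; apply: (le_trans (fM x Ax)); exact: ltW.
Qed.

End Integrability.

Section Differentiation.
Variable R : realType.
Notation mu := (@lebesgue_measure R).

Lemma lebesgue_measure_itv_lty (a b : R) (p q : bool) :
  (mu [set` Interval (BSide p a) (BSide q b)] < +oo)%E.
Proof. by rewrite lebesgue_measure_itv /=; case: ifP; rewrite -?EFinB ltry. Qed.

Lemma lebesgue_measure_itvoc (a b : R) : a <= b ->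
  mu `]a, b]%classic = (b - a)%:E.
Proof.
rewrite lebesgue_measure_itv/= lte_fin; case: ltgtP => //= -> _.
by rewrite subrr.
Qed.

Lemma integrable_itvoc_cst (a b c : R) :
  mu.-integrable `]a, b] (EFin \o (fun=> c)).
Proof.
apply: (@integrable_bounded _ _ _ _ _ _ `|c|) => //.
exact: lebesgue_measure_itv_lty.
Qed.

Lemma Rintegral_cst_itvoc (a b r : R) : a <= b ->
  \int[mu]_(x in `]a, b]) r = r * (b - a).
Proof.
move=> ab; rewrite Rintegral_cst//.
transitivity (r * fine (mu `]a, b]%classic)); first by [].
by rewrite lebesgue_measure_itvoc.
Qed.

Lemma ae_derive1_of_increments (W g : R -> R) (M : R) :
  measurable_fun setT g -> (forall x, `|g x| <= M) ->
  (forall a b, a <= b -> W b - W a = \int[mu]_(x in `]a, b]) g x) ->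
  {ae mu, forall x : R, derivable W x 1 /\ derive1 W x = g x}.
Proof.
move=> mg gM Wg.
have locg : locally_integrable setT g.
  split=> //; first exact: openT.
  move=> K _ cK; have mK := compact_measurable cK.
  have /integrableP[_] // : mu.-integrable K (EFin \o g).
  apply: (@integrable_bounded _ _ _ _ _ _ M) => //.
    exact: compact_finite_measure.
  exact: measurable_funTS.
(* A bounded [g] need not be integrable on a half-line, so the primitives start at [-n]; the
   exceptional sets of all [n] still form a null set. *)
pose F (n : nat) (y : R) : R := \int[mu]_(t in `]- n%:R, y]) g t.
have H n : {ae mu, forall x : R, (BRight (- n%:R : R) < BRight x)%O ->
    derivable (F n) x 1 /\ derive1 (F n) x = g x}.
  apply: (@FTC1 R g (BRight (- n%:R)) _ locg) => y.
  apply: (@integrable_bounded _ _ _ _ _ _ M) => //.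
    exact: lebesgue_measure_itv_lty.
  exact: measurable_funTS.
have := ae_foralln H.
apply: filterS => x Hx.
have [n nx] : exists n : nat, - n%:R < x.
  exists (Num.truncn `|x|).+1.
  have /andP[_ h] := truncn_itv (normr_ge0 x).
  by rewrite ltrNl (le_lt_trans _ h)// -normrN ler_norm.
have [dF F'] := Hx n nx.
have nW : \forall y \near x, F n y + W (- n%:R) = W y.
  near=> y; rewrite /F -Wg ?subrK//; apply: ltW.
  by near: y; exact: lt_nbhsr.
have dF' : derivable (fun y => F n y + W (- n%:R)) x 1.
  exact: derivableD.
split; first exact: near_eq_derivable dF'.
rewrite derive1E -(near_eq_derive _ nW) deriveD// derive_cst addr0.
by rewrite -derive1E.
Unshelve. all: end_near. Qed.

End Differentiation.

Lemma lipschitz_continuous (R : realType) (K : R) (f : R -> R) : 0 <= K ->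
  (forall a b, a <= b -> `|f b - f a| <= K * (b - a)) -> continuous f.
Proof.
move=> K0 fK x; apply/cvgrPdist_le => /= e e0.
have d0 : 0 < e / (K + 1) by rewrite divr_gt0//; lra.
have fKs z : `|f x - f z| <= K * `|x - z|.
  have [xz|zx] := leP x z.
    by rewrite distrC (distrC x) (ger0_norm (_ : 0 <= z - x)) ?subr_ge0// fK.
  by rewrite (ger0_norm (_ : 0 <= x - z)) ?subr_ge0 ?(ltW zx)// fK// ltW.
apply/nbhs_ballP; exists (e / (K + 1)) => //= z /= xz.
apply: le_trans (fKs z) _; apply: (@le_trans _ _ ((K + 1) * (e / (K + 1)))).
  by apply: ler_pM => //; [lra|exact: ltW].
by rewrite mulrCA divff ?mulr1//; lra.
Qed.

(** * The generalized inverse of [x + F x] *)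

Section GeneralizedInverse.
Variable R : realType.

(** For a nondecreasing [F], the field [cumF_left] is left continuity, stated without limits. *)
Record cumulative_function (F : R -> R) (G : R) : Prop := CumulativeFunction {
  cumF_homo : {homo F : x y / x <= y};
  cumF_left : forall x c, c < F x -> exists2 x', x' < x & c < F x';
  cumF_ge0 : forall x, 0 <= F x;
  cumF_le : forall x, F x <= G
}.

Definition ginv (F : R -> R) (xi : R) : R := sup [set x | x + F x < xi].

Variables (F : R -> R) (G : R).
Hypothesis cF : cumulative_function F G.
Notation y := (ginv F).

Let G0 : 0 <= G. Proof. exact: le_trans (cumF_ge0 cF 0) (cumF_le cF 0). Qed.

Let has_supF xi : has_sup [set x | x + F x < xi].
Proof.
split.
  exists (xi - G - 1) => /=; have := cumF_le cF (xi - G - 1); lra.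
exists xi => x /= h; have := cumF_ge0 cF x; lra.
Qed.

(** A Galois connection: monotonicity of [ginv F], its Lipschitz bound and the preimages of
    intervals all reduce to it. Left continuity of [F] is what makes the inequality on the left
    strict. *)
Lemma ginv_lt xi x : (y xi < x) = (xi < x + F x).
Proof.
apply/idP/idP => [yx|h].
  rewrite ltNge; apply/negP => h.
  have [z [z0 zx]] : exists z, y xi < z /\ z < x.
    by exists ((y xi + x) / 2); lra.
  have : z <= y xi.
    apply: (ub_le_sup (has_supF xi).2) => /=.
    have := cumF_homo cF (ltW zx); lra.
  lra.
(* The margin [x + F x - xi] is halved: [x1] gives up one half in the value of [F], and [x'] at most
   the other half in the argument, so [z + F z] exceeds [xi] for every [z > x']. *)
have [x1 x1x hx1] := cumF_left cF (ltac:(lra) : (xi - x + F x) / 2 < F x).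
pose x' := Num.max x1 ((x + (xi - F x)) / 2).
have x'x : x' < x by rewrite gt_max x1x; lra.
apply: le_lt_trans x'x; apply: ge_sup; first exact: (has_supF xi).1.
move=> z /= hz; rewrite leNgt; apply/negP => x'z.
have := cumF_homo cF (ltW (le_lt_trans (ltac:(by rewrite le_max lexx) : x1 <= x') x'z)).
have : (x + (xi - F x)) / 2 < z by apply: le_lt_trans x'z; rewrite le_max lexx orbT.
lra.
Qed.

Lemma ginv_ge xi x : (x <= y xi) = (x + F x <= xi).
Proof. by rewrite leNgt ginv_lt -leNgt. Qed.

Lemma ginv_homo : {homo y : a b / a <= b}.
Proof. by move=> a b ab; rewrite ginv_ge (le_trans _ ab)// -ginv_ge. Qed.

Lemma ginv_le_id xi : y xi <= xi.
Proof.
have : y xi <= y xi by []; rewrite ginv_ge; have := cumF_ge0 cF (y xi); lra.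
Qed.

Lemma ginv_ge_id xi : xi - G <= y xi.
Proof. by rewrite ginv_ge; have := cumF_le cF (xi - G); lra. Qed.

Lemma ginv_lipschitz a b : a <= b -> y b - y a <= b - a.
Proof.
move=> ab; apply/ler_addgt0Pr => e e0.
suff : y b < y a + e + (b - a) by lra.
have : y a < y a + e by lra.
rewrite !ginv_lt.
have := cumF_homo cF (ltac:(lra) : y a + e <= y a + e + (b - a)); lra.
Qed.

(** Together with the next lemma this places [xi - y xi] between [F (y xi)] and the right limit of
    [F] at [y xi]; the limits of the gap at both infinities follow from those of [F]. *)
Lemma cumF_ginv_le xi : F (y xi) <= xi - y xi.
Proof. by have : y xi <= y xi by []; rewrite ginv_ge; lra. Qed.

Lemma cumF_ginv_ge xi x : y xi < x -> xi - y xi <= x - y xi + F x.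
Proof. by rewrite ginv_lt; lra. Qed.

Lemma ginv_gap_bounds xi : 0 <= xi - y xi <= G.
Proof. by have := ginv_le_id xi; have := ginv_ge_id xi; lra. Qed.

Lemma measurable_ginv : measurable_fun setT (y : R -> R).
Proof. by apply: nondecreasing_measurable => // a b ab; exact: ginv_homo. Qed.

End GeneralizedInverse.

(** * Measures with a density *)

Section Density.
Context d (T : measurableType d) (R : realType).
Variable mu : {measure set T -> \bar R}.
Import HBNNSimple.

(** Measurability and positivity are arguments of the term, so that the structure of measure can be
    inferred from it. *)
Definition density (g : T -> R) of measurable_fun setT g & (forall x, 0 <= g x) :=
  fun A : set T => (\int[mu]_(x in A) (g x)%:E)%E.

Section Measure.
Variables (g : T -> R) (mg : measurable_fun setT g) (g0 : forall x, 0 <= g x).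

Let density0 : density mg g0 set0 = 0%E.
Proof. exact: integral_set0. Qed.

Let density_ge0 A : (0 <= density mg g0 A)%E.
Proof. by apply: integral_ge0 => x _; rewrite lee_fin. Qed.

Let density_sigma_additive : semi_sigma_additive (density mg g0).
Proof.
move=> F mF tF mUF; rewrite /density ge0_integral_bigcup//.
- by apply: is_cvg_ereal_nneg_natsum_cond => n _ _; exact: density_ge0.
- by apply/measurable_EFinP; exact: measurable_funTS.
- by move=> x _; rewrite lee_fin.
Qed.

HB.instance Definition _ := isMeasure.Build _ _ _ (density mg g0)
  density0 density_ge0 density_sigma_additive.

End Measure.

Lemma ge0_integral_density (g : T -> R) (mg : measurable_fun setT g)
    (g0 : forall x, 0 <= g x) (f : T -> \bar R) :
  measurable_fun setT f -> (forall x, 0 <= f x)%E ->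
  (\int[density mg g0]_x f x = \int[mu]_x (f x * (g x)%:E))%E.
Proof.
move=> mf f0; pose nu : {measure set T -> \bar R} := density mg g0.
have mgE : measurable_fun setT (EFin \o g) by apply/measurable_EFinP.
pose h := nnsfun_approx measurableT mf.
have fE x : f x = limn (fun n => (h n x)%:E).
  by apply/esym/cvg_lim => //; exact: cvg_nnsfun_approx.
have -> : (\int[nu]_x f x = limn (fun n => \int[nu]_x (h n x)%:E))%E.
  under eq_integral do rewrite fE.
  apply: monotone_convergence => //.
  - by move=> n; apply/measurable_EFinP.
  - by move=> n x _; rewrite lee_fin.
  - by move=> x _ a b ab; rewrite lee_fin; exact/lefP/nd_nnsfun_approx.
have -> : (\int[mu]_x (f x * (g x)%:E) =
    limn (fun n => \int[mu]_x ((h n x)%:E * (g x)%:E)))%E.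
  have fgE x : (f x * (g x)%:E)%E = limn (fun n => ((h n x)%:E * (g x)%:E)%E).
    apply/esym/cvg_lim => //; apply: cvgeZr => //; exact: cvg_nnsfun_approx.
  under eq_integral do rewrite fgE.
  apply: monotone_convergence => //.
  - by move=> n; apply: emeasurable_funM => //; apply/measurable_EFinP.
  - by move=> n x _; rewrite mule_ge0 ?lee_fin.
  - move=> x _ a b ab; rewrite lee_wpmul2r ?lee_fin//.
    exact/lefP/nd_nnsfun_approx.
congr (limn _); apply/funext => n.
have mhr r : measurable (h n @^-1` [set r]) by [].
have indE (r : R) : (fun x => (r * \1_(h n @^-1` [set r]) x)%:E) =
    (fun x => r%:E * (\1_(h n @^-1` [set r]) x)%:E)%E by [].
transitivity (\int[nu]_x (\sum_(y \in range (h n))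
    (y * \1_(h n @^-1` [set y]) x)%:E))%E.
  by apply: eq_integral => x _; rewrite fsumEFin// -fimfunE.
transitivity (\int[mu]_x (\sum_(y \in range (h n))
    ((y * \1_(h n @^-1` [set y]) x)%:E * (g x)%:E)))%E; last first.
  apply: eq_integral => x _; rewrite -ge0_mule_fsuml ?fsumEFin -?fimfunE// => y.
  exact: nnfun_muleindic_ge0.
have mi r : measurable_fun setT (fun x => (r * \1_(h n @^-1` [set r]) x)%:E).
  by apply/measurable_EFinP; apply: measurable_funM.
rewrite ge0_integral_fsum//; last by move=> y x _; exact: nnfun_muleindic_ge0.
rewrite ge0_integral_fsum//; last 2 first.
- by move=> y; apply: emeasurable_funM.
- by move=> y x _; rewrite mule_ge0 ?lee_fin//; exact: nnfun_muleindic_ge0.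
apply: eq_fsbigr => r /set_mem [z _ hz].
have r0 : 0 <= r by rewrite -hz.
under eq_integral do rewrite EFinM.
rewrite ge0_integralZl ?lee_fin//; last exact/measurable_EFinP.
under [RHS]eq_integral do rewrite EFinM -muleA.
rewrite ge0_integralZl ?lee_fin//; last 2 first.
- by apply: emeasurable_funM => //; apply/measurable_EFinP.
- by move=> x _; rewrite mule_ge0 ?lee_fin.
congr (_ * _)%E; rewrite integral_indic// setIT /= /density.
rewrite integral_mkcond; apply: eq_integral => x _.
by rewrite patchE indicE; case: ifP => _; rewrite ?mul1e ?mul0e.
Qed.

End Density.

(** * Initial data and its Lagrangian coordinates *)

Section Profile.
Variable R : realType.
Notation leb := (@lebesgue_measure R).

(* The data seen by the map L: u has derivative p, and F is the distribution
   function of the measure p^2 dx + ms, where ms lives on the null set N. *)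
Record profile (u p F : R -> R) (ms : {measure set (measurableTypeR R) -> \bar R})
    (N : set (measurableTypeR R)) (G : R) : Prop := Profile {
  profile_p : measurable_fun setT p;
  profile_u : forall a b, a <= b -> u b - u a = \int[leb]_(x in `]a, b]) p x;
  profile_F : forall x, (F x)%:E =
    (\int[leb]_(x in `]-oo, x[) (p x ^+ 2)%:E + ms `]-oo, x[%classic)%E;
  profile_G : G%:E = (\int[leb]_x (p x ^+ 2)%:E + ms setT)%E;
  profile_mN : measurable N;
  profile_N0 : leb N = 0%E;
  profile_ms : ms (~` N) = 0%E
}.

Variables (u p F : R -> R) (ms : {measure set (measurableTypeR R) -> \bar R}).
Variables (N : set (measurableTypeR R)) (G : R).
Hypothesis P : profile u p F ms N G.
Let mp := profile_p P.
Let mN := profile_mN P.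
Let N0 := profile_N0 P.

Lemma measurable_sqr_profile : measurable_fun setT (fun x => p x ^+ 2).
Proof. exact: measurable_funX. Qed.

Let p20 x : 0 <= p x ^+ 2. Proof. exact: sqr_ge0. Qed.

Let mu : {measure set (measurableTypeR R) -> \bar R} :=
  measure_add (density leb measurable_sqr_profile p20) ms.

Let muE A : mu A = (\int[leb]_(x in A) (p x ^+ 2)%:E + ms A)%E.
Proof. exact: measure_addE. Qed.

Let muF x : mu `]-oo, x[%classic = (F x)%:E.
Proof. by rewrite muE (profile_F P). Qed.

Let muT : mu setT = G%:E.
Proof. by rewrite muE (profile_G P). Qed.

Let mu_le A : measurable A -> (mu A <= G%:E)%E.
Proof. by move=> mA; rewrite -muT le_measure// inE. Qed.

Lemma profile_integrable_sqr : leb.-integrable setT (EFin \o (fun x => p x ^+ 2)).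
Proof.
apply/integrableP; split; first by apply/measurable_EFinP; exact: measurable_sqr_profile.
under eq_integral do rewrite /= ger0_norm//.
apply: (@le_lt_trans _ _ G%:E); last exact: ltry.
by rewrite (profile_G P) leeDl.
Qed.

Lemma profile_sqr_le : \int[leb]_x (p x ^+ 2) <= G.
Proof.
rewrite -lee_fin /Rintegral fineK ?(profile_G P) ?leeDl//.
exact: integrable_fin_num profile_integrable_sqr.
Qed.

Lemma profile_itv_measure a b : a <= b ->
  (\int[leb]_(x in `[a, b[) (p x ^+ 2)%:E + ms `[a, b[%classic = (F b - F a)%:E)%E.
Proof.
move=> ab; rewrite -muE.
have -> : `[a, b[%classic = `]-oo, b[%classic `\` `]-oo, a[%classic :> set R.
  apply/seteqP; split => x /=; rewrite !in_itv/=.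
    by move=> /andP[ax xb]; split => //; apply/negP; rewrite -leNgt.
  by move=> [xb /negP]; rewrite -leNgt => ->.
rewrite EFinB -!muF; rewrite measureD//=.
  congr (_ - mu _)%E; apply/seteqP; split => x /=; rewrite !in_itv/=; first by case.
  by move=> xa; split => //; exact: lt_le_trans xa ab.
by rewrite muF ltry.
Qed.

Lemma profile_cumulative : cumulative_function F G.
Proof.
have F0 x : 0 <= F x by rewrite -lee_fin -muF.
split=> //.
- move=> a b ab; rewrite -subr_ge0 -lee_fin -profile_itv_measure//.
  by rewrite adde_ge0// integral_ge0// => x _; rewrite lee_fin.
- move=> x c cF.
  (* Left continuity of [F] is continuity of the measure along increasing half-lines that exhaust
     []-oo, x[]. *)
  have := @nondecreasing_cvg_mu _ _ _ mu (fun n => `]-oo, x - n.+1%:R^-1[%classic).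
  have <- : `]-oo, x[%classic = \bigcup_n (`]-oo, x - n.+1%:R^-1[%classic : set R).
    apply/seteqP; split => z /=; rewrite in_itv/=; last first.
      move=> [n _] /=; rewrite in_itv/= => /lt_le_trans; apply.
      by rewrite gerBl invr_ge0 ler0n.
    move=> zx; have zx0 : 0 < x - z by rewrite subr_gt0.
    exists (Num.truncn (x - z)^-1) => //=; rewrite in_itv/= ltrBrDr -ltrBrDl.
    rewrite invf_plt ?posrE ?ltr0n//.
    by have /andP[] := truncn_itv (ltW (ltac:(by rewrite invr_gt0) : 0 < (x - z)^-1)).
  have nd : nondecreasing_seq (fun n => `]-oo, x - n.+1%:R^-1[%classic : set R).
    apply/nondecreasing_seqP => n; apply/subsetPset => z /=; rewrite !in_itv/=.
    move=> /lt_le_trans; apply; rewrite lerD2l lerN2 lef_pV2 ?posrE ?ltr0n//.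
    by rewrite ler_nat.
  move=> /(_ (fun n => measurable_itv _) (measurable_itv _) nd).
  rewrite muF => /fine_cvgP[_] /cvgrPdist_lt /(_ (F x - c)).
  rewrite subr_gt0 => /(_ cF) [n _ /(_ n (leqnn n))] /=.
  rewrite muF /= => h; exists (x - n.+1%:R^-1).
    by rewrite gtrBl invr_gt0 ltr0n.
  by have := ler_norm (F x - F (x - n.+1%:R^-1)); lra.
- by move=> x; rewrite -lee_fin -muF mu_le.
Qed.

Lemma profile_F_Ny e : 0 < e -> exists x0, forall x, x <= x0 -> F x < e.
Proof.
move=> e0.
have bc : set0 = \bigcap_n (`]-oo, - n%:R[%classic : set (measurableTypeR R)).
  apply/seteqP; split => // z /= H.
  have /= := H (Num.truncn `|z|).+1 I; rewrite in_itv/=.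
  have /andP[_ h] := truncn_itv (normr_ge0 z).
  have := ler_norm (- z); rewrite normrN; lra.
have := @nonincreasing_cvg_mu _ _ _ mu (fun n => `]-oo, - n%:R[%classic).
rewrite -bc muF ltry.
have nd : nonincreasing_seq (fun n => `]-oo, - n%:R[%classic : set (measurableTypeR R)).
  apply/nonincreasing_seqP => n; apply/subsetPset => z /=; rewrite !in_itv/=.
  by move=> /lt_le_trans; apply; rewrite lerN2 ler_nat.
move=> /(_ isT (fun n => measurable_itv _) measurable0 nd).
rewrite measure0 => /fine_cvgP[_] /cvgrPdist_lt /(_ e e0) [n _ /(_ n (leqnn n))].
rewrite /= muF /= sub0r normrN ger0_norm ?(cumF_ge0 profile_cumulative)// => h.
by exists (- n%:R) => x xn; apply: le_lt_trans h; exact: (cumF_homo profile_cumulative).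
Qed.

Lemma profile_F_y e : 0 < e -> exists x0, forall x, x0 <= x -> G - e < F x.
Proof.
move=> e0.
have bc : setT = \bigcup_n (`]-oo, n%:R[%classic : set (measurableTypeR R)).
  apply/seteqP; split => // z _; exists (Num.truncn `|z|).+1 => //=.
  have /andP[_ h] := truncn_itv (normr_ge0 z).
  by rewrite in_itv/= (le_lt_trans _ h)// ler_norm.
have := @nondecreasing_cvg_mu _ _ _ mu (fun n => `]-oo, n%:R[%classic).
rewrite -bc muT.
have nd : nondecreasing_seq (fun n => `]-oo, n%:R[%classic : set (measurableTypeR R)).
  apply/nondecreasing_seqP => n; apply/subsetPset => z /=; rewrite !in_itv/=.
  by move=> /lt_le_trans; apply; rewrite ler_nat.
move=> /(_ (fun n => measurable_itv _) measurableT nd).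
move=> /fine_cvgP[_] /cvgrPdist_lt /(_ e e0) [n _ /(_ n (leqnn n))].
rewrite /= muF /= => h.
exists n%:R => x nx; have := cumF_homo profile_cumulative nx.
by have := ler_norm (G - F n%:R); lra.
Qed.

Notation y := (ginv F).
Let cF := profile_cumulative.
Let my : measurable_fun setT (y : measurableTypeR R -> measurableTypeR R).
Proof. exact: measurable_ginv cF. Qed.

(** By the Galois connection [[a, b[] pulls back to [[a + F a, b + F b[], whose length is [b - a]
    plus the energy of [[a, b[]; these intervals determine the measure. *)
Lemma pushforward_ginv A : measurable A ->
  pushforward leb (y : measurableTypeR R -> measurableTypeR R) A =
  measure_add leb mu A.
Proof.
have preE a b : y @^-1` `[a, b[%classic = `[a + F a, b + F b[%classic.
  by apply/seteqP; split => x /=; rewrite !in_itv/= (ginv_ge cF) (ginv_lt cF).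
apply: (@measure_eq_itvco _ (pushforward leb (y : measurableTypeR R -> measurableTypeR R))
   (measure_add leb mu)) => a b ab; rewrite /= /pushforward preE; last first.
  exact: lebesgue_measure_itv_lty.
have Fab := cumF_homo cF (ltW ab).
rewrite [RHS]measure_addE muE profile_itv_measure 1?ltW// !lebesgue_measure_itv/=.
have -> : leb `[a, b[%classic = (b - a)%:E.
  by rewrite lebesgue_measure_itv/= lte_fin ab.
rewrite lte_fin ifT; last lra.
by rewrite -!EFinB -EFinD; congr _%:E; ring.
Qed.

(* The density of ginv F: it vanishes where F jumps or is singular. *)
Definition gdens (x : R) : R := \1_(~` N) x / (1 + p x ^+ 2).

Let p21 x : 0 < 1 + p x ^+ 2. Proof. by have := p20 x; lra. Qed.

Lemma gdens_ge0 x : 0 <= gdens x.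
Proof. by rewrite /gdens divr_ge0// ?indicE// ltW. Qed.

Lemma gdens_le1 x : gdens x <= 1.
Proof.
rewrite /gdens ler_pdivrMr// mul1r indicE.
by have := p20 x; case: (x \in _) => /=; lra.
Qed.

Lemma gdensE x : ~ N x -> gdens x = (1 + p x ^+ 2)^-1.
Proof. by move=> Nx; rewrite /gdens indicE mem_set// mul1r. Qed.

Lemma gdens0 x : N x -> gdens x = 0.
Proof. by move=> Nx; rewrite /gdens indicE memNset ?mul0r//=; apply. Qed.

(** This is the density of [u \o ginv F]: that function is Lipschitz even where [u] is not. *)
Lemma normM_gdens_le1 x : `|p x * gdens x| <= 1.
Proof.
rewrite /gdens normrM normrM normfV (ger0_norm (ltW (p21 x))).
rewrite mulrA ler_pdivrMr// mul1r indicE.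
have := p20 x; rewrite -real_normK ?num_real//.
case: (x \in _); rewrite /= ?normr0 ?normr1 ?mulr0 ?mulr1; last lra.
by have := sqr_ge0 (`|p x| - 1); rewrite sqrrB1; have := normr_ge0 (p x); lra.
Qed.

Lemma measurable_gdens : measurable_fun setT gdens.
Proof.
apply: measurable_funM; first by apply: measurable_indic; exact: measurableC.
have -> : (fun x => (1 + p x ^+ 2)^-1) = (fun z => (1 + z ^+ 2)^-1) \o p by [].
apply: measurableT_comp => //; apply: continuous_measurable_fun => x.
apply: cvgV; first by rewrite gt_eqF// ltr_wpDr ?sqr_ge0.
by apply: cvgD; [exact: cvg_cst|exact: exprn_continuous].
Qed.

(** The image of the Lebesgue measure is [(1 + p^2) dx + ms] by [pushforward_ginv]. The factor
    [gdens] removes [ms], which lives on [N], and cancels [1 + p^2] off the null set [N]. *)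
Lemma ge0_integral_ginv (f : R -> \bar R) A : measurable A ->
  measurable_fun setT f -> (forall x, 0 <= f x)%E ->
  (\int[leb]_(x in y @^-1` A) (f (y x) * (gdens (y x))%:E) =
   \int[leb]_(x in A) f x)%E.
Proof.
move=> mA mf f0; pose g := f \_ A.
have mg : measurable_fun setT g by apply/(measurable_restrictT _ _).1 => //; exact: measurable_funTS.
have g0 x : (0 <= g x)%E by apply: erestrict_ge0.
pose W x := (g x * (gdens x)%:E)%E.
have W0 x : (0 <= W x)%E by rewrite mule_ge0// lee_fin gdens_ge0.
have mW : measurable_fun setT W.
  by apply: emeasurable_funM => //; apply/measurable_EFinP; exact: measurable_gdens.
transitivity (\int[leb]_x (W (y x)))%E.
  rewrite integral_mkcond; apply: eq_integral => x _; rewrite /W /g !patchE.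
  have -> : (x \in y @^-1` A) = (y x \in A) by apply/idP/idP; rewrite !inE.
  by case: ifP => //; rewrite mul0e.
rewrite -[LHS](@ge0_integral_pushforward _ _ _ _ _ _ my leb setT W)//.
rewrite (@eq_measure_integral _ _ _ setT (measure_add leb mu)); last first.
  by move=> B mB _; exact: pushforward_ginv.
rewrite ge0_integral_measure_add// ge0_integral_measure_add//.
rewrite (@integral_eq_off_null _ _ _ ms setT (~` N) W (cst 0%E)); first last.
- by move=> x /contrapT Nx; rewrite /W gdens0// mule0.
- exact: (profile_ms P).
- exact: measurableC.
rewrite integral0 adde0 ge0_integral_density// -ge0_integralD//; first last.
- apply: emeasurable_funM => //; apply/measurable_EFinP; exact: measurable_sqr_profile.
- by move=> x _; rewrite mule_ge0// lee_fin.
rewrite [RHS]integral_mkcond -/g; apply: (integral_eq_off_null _ mN N0) => x Nx.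
rewrite /W gdensE// -[in X in (X + _)%E](mule1 (g x * _)%E) -ge0_muleDr ?lee_fin//.
by rewrite -EFinD -muleA -EFinM mulVf ?mule1// gt_eqF.
Qed.

End Profile.

(** * Integrals over half-lines *)

Section LineIntegrals.
Variable R : realType.
Notation leb := (@lebesgue_measure R).

Lemma ge0_Rintegral_subset (A B : set (measurableTypeR R)) (f : R -> R) : measurable A ->
  measurable B -> A `<=` B -> leb.-integrable B (EFin \o f) ->
  (forall x, 0 <= f x) -> \int[leb]_(x in A) f x <= \int[leb]_(x in B) f x.
Proof.
move=> mA mB AB fB f0; have fA := integrableS mB mA AB fB.
rewrite fine_le ?integrable_fin_num//; apply: ge0_subset_integral => //.
- exact: measurable_int fB.
- by move=> x _; rewrite lee_fin.
Qed.

Lemma ge0_Rintegral_tail (f : R -> R) : leb.-integrable setT (EFin \o f) ->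
  (forall x, 0 <= f x) -> forall e, 0 < e -> exists x0, forall x, x0 <= x ->
  \int[leb]_x f x - e < \int[leb]_(z in `]-oo, x]) f z.
Proof.
move=> fT f0 e e0; have mf := measurable_int _ fT.
have := @ge0_nondecreasing_set_cvg_integral _ _ _
  (fun n => `]-oo, n%:R]%classic : set (measurableTypeR R)) (EFin \o f) leb.
have <- : setT = \bigcup_n (`]-oo, n%:R]%classic : set (measurableTypeR R)).
  apply/seteqP; split => // z _; exists (Num.truncn `|z|).+1 => //=.
  have /andP[_ h] := truncn_itv (normr_ge0 z).
  by rewrite in_itv/= ltW// (le_lt_trans _ h)// ler_norm.
have nd : nondecreasing_seq (fun n => `]-oo, n%:R]%classic : set (measurableTypeR R)).
  apply/nondecreasing_seqP => n; apply/subsetPset => z /=; rewrite !in_itv/=.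
  by move=> /le_trans; apply; rewrite ler_nat.
have mf' i : measurable_fun (`]-oo, i%:R]%classic : set (measurableTypeR R)) (EFin \o f).
  exact: measurable_funS mf.
move=> /(_ nd (fun n => measurable_itv _) mf').
have f0' (i : nat) (x : R) : `]-oo, i%:R]%classic x -> (0 <= (EFin \o f) x)%E.
  by move=> _; rewrite lee_fin.
move=> /(_ f0').
rewrite -[X in _ --> X]fineK ?(integrable_fin_num _ fT)//.
move=> /fine_cvgP[_] /cvgrPdist_lt /(_ e e0) [n _ /(_ n (leqnn n))] /= h.
exists n%:R => x nx.
apply: (@lt_le_trans _ _ (\int[leb]_(z in `]-oo, n%:R]) f z)).
  rewrite ltrBlDr -ltrBlDl; apply: le_lt_trans h; exact: ler_norm.
apply: ge0_Rintegral_subset => //; last exact: integrableS fT.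
by move=> z /=; rewrite !in_itv/= => /le_trans; apply.
Qed.

(** Exhausting the half-line by []xi - n, xi]] gives [W xi] minus the limit of [W] at [-oo], which
    is 0 by the last two hypotheses. *)
Lemma ge0_integral_itvNy (f W : R -> R) : measurable_fun setT f ->
  (forall x, 0 <= f x) ->
  (forall a b, a <= b ->
    (\int[leb]_(x in `]a, b]) (f x)%:E)%E = (W b - W a)%:E) ->
  (forall x, 0 <= W x) ->
  (forall e, 0 < e -> exists x0, forall x, x <= x0 -> W x < e) ->
  forall xi, (\int[leb]_(x in `]-oo, xi]) (f x)%:E)%E = (W xi)%:E.
Proof.
move=> mf f0 intE W0 Wlim xi.
have := @ge0_nondecreasing_set_cvg_integral _ _ _
  (fun n => `]xi - n%:R, xi]%classic : set (measurableTypeR R)) (EFin \o f) leb.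
have <- : `]-oo, xi]%classic = \bigcup_n (`]xi - n%:R, xi]%classic : set (measurableTypeR R)).
  apply/seteqP; split => z /=; rewrite in_itv/=; last first.
    by move=> [n _] /=; rewrite in_itv/= => /andP[].
  move=> zx; exists (Num.truncn `|xi - z|).+1 => //=.
  have /andP[_ h] := truncn_itv (normr_ge0 (xi - z)).
  by rewrite in_itv/= zx andbT ltrBlDr -ltrBlDl (le_lt_trans _ h)// ler_norm.
have nd : nondecreasing_seq (fun n => `]xi - n%:R, xi]%classic : set (measurableTypeR R)).
  apply/nondecreasing_seqP => n; apply/subsetPset => z /=; rewrite !in_itv/=.
  by move=> /andP[h ->]; rewrite andbT (le_lt_trans _ h)// lerD2l lerN2 ler_nat.
have mfE i : measurable_fun (`]xi - i%:R, xi]%classic : set (measurableTypeR R)) (EFin \o f).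
  by apply: measurable_funTS; exact/measurable_EFinP.
move=> /(_ nd (fun n => measurable_itv _) mfE).
have f0' (i : nat) x : (`]xi - i%:R, xi]%classic : set (measurableTypeR R)) x ->
    (0 <= (f x)%:E)%E by move=> _; rewrite lee_fin.
move=> /(_ f0') lim1.
suff lim2 : (\int[leb]_(x in `](xi - n%:R)%R, xi]) (f x)%:E)%E
    @[n --> \oo] --> (W xi)%:E by exact: (cvg_unique (@ereal_hausdorff R) lim1 lim2).
under eq_cvg do rewrite intE ?gerBl//.
apply: cvg_EFin; first by near=> n.
apply/cvgrPdist_lt => e e0; have [x0 hx0] := Wlim _ e0.
near=> n; rewrite /= opprB addrC subrK.
rewrite ger0_norm//; apply: hx0; rewrite lerBlDr -lerBlDl; near: n.
exact: nbhs_infty_ger.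
Unshelve. all: end_near. Qed.

Lemma ge0_integral_itvT (f W : R -> R) (l : R) : measurable_fun setT f ->
  (forall x, 0 <= f x) ->
  (forall x, (\int[leb]_(z in `]-oo, x]) (f z)%:E)%E = (W x)%:E) ->
  (forall x, W x <= l) ->
  (forall e, 0 < e -> exists x0, forall x, x0 <= x -> l - e < W x) ->
  (\int[leb]_x (f x)%:E)%E = l%:E.
Proof.
move=> mf f0 intE Wl Wlim.
have := @ge0_nondecreasing_set_cvg_integral _ _ _
  (fun n => `]-oo, n%:R]%classic : set (measurableTypeR R)) (EFin \o f) leb.
have <- : setT = \bigcup_n (`]-oo, n%:R]%classic : set (measurableTypeR R)).
  apply/seteqP; split => // z _; exists (Num.truncn `|z|).+1 => //=.
  have /andP[_ h] := truncn_itv (normr_ge0 z).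
  by rewrite in_itv/= ltW// (le_lt_trans _ h)// ler_norm.
have nd : nondecreasing_seq (fun n => `]-oo, n%:R]%classic : set (measurableTypeR R)).
  apply/nondecreasing_seqP => n; apply/subsetPset => z /=; rewrite !in_itv/=.
  by move=> /le_trans; apply; rewrite ler_nat.
have mf' i : measurable_fun (`]-oo, i%:R]%classic : set (measurableTypeR R)) (EFin \o f).
  by apply: measurable_funTS; exact/measurable_EFinP.
move=> /(_ nd (fun n => measurable_itv _) mf').
have f0' (i : nat) (x : R) : `]-oo, i%:R]%classic x -> (0 <= (f x)%:E)%E.
  by move=> _; rewrite lee_fin.
move=> /(_ f0') lim1.
suff lim2 : (\int[leb]_(x in `]-oo, (n%:R)%R]) (f x)%:E)%E
    @[n --> \oo] --> l%:E by exact: (cvg_unique (@ereal_hausdorff R) lim1 lim2).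
under eq_cvg do rewrite intE.
apply: cvg_EFin; first by near=> n.
apply/cvgrPdist_lt => e e0; have [x0 hx0] := Wlim _ e0.
near=> n; rewrite /= ger0_norm ?subr_ge0// ltrBlDr -ltrBlDl; apply: hx0; near: n.
exact: nbhs_infty_ger.
Unshelve. all: end_near. Qed.

End LineIntegrals.

(** * Change of variables along [ginv F] *)

Section Lagrangian.
Variable R : realType.
Notation leb := (@lebesgue_measure R).
Variables (u p F : R -> R) (ms : {measure set (measurableTypeR R) -> \bar R}).
Variables (N : set (measurableTypeR R)) (G : R).
Hypothesis P : profile u p F ms N G.
Notation y := (ginv F).
Notation g := (gdens p N).
Let cF := profile_cumulative P.
Let mp := profile_p P.
Let yh := ginv_homo cF.
Let my : measurable_fun setT y.
Proof. exact: measurable_ginv cF. Qed.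
Let mg := measurable_gdens P.

(** The interval []a, b]] need not be a preimage, since [ginv F] is flat over the jumps of [F]. It
    lies between the preimages of []y a, y b[] and [[y a, y b]], and the two endpoints carry no
    Lebesgue mass on the right-hand side. *)
Lemma ge0_integral_ginv_itv (f : R -> \bar R) a b : a <= b ->
  measurable_fun setT f -> (forall x, 0 <= f x)%E ->
  (\int[leb]_(x in `]a, b]) (f (y x) * (g (y x))%:E) =
   \int[leb]_(x in `]y a, y b]) f x)%E.
Proof.
move=> ab mf f0.
have mfg : measurable_fun setT (fun x => f (y x) * (g (y x))%:E)%E.
  apply: emeasurable_funM; first exact: measurableT_comp.
  by apply/measurable_EFinP; exact: measurableT_comp.
have mpre A : measurable A -> measurable (y @^-1` A).
  by move=> mA; rewrite -[X in measurable X]setTI; exact: my.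
have fg0 x : (0 <= f (y x) * (g (y x))%:E)%E.
  by rewrite mule_ge0// lee_fin gdens_ge0.
have mfT A : measurable_fun A f by exact: measurable_funTS.
apply/eqP; rewrite eq_le; apply/andP; split.
  apply: (@le_trans _ _ (\int[leb]_(x in y @^-1` `[y a, y b]) (f (y x) * (g (y x))%:E))%E).
    apply: ge0_subset_integral => //; first exact: mpre.
    - exact: measurable_funTS.
    - by move=> x /=; rewrite !in_itv/= => /andP[/ltW ax xb]; rewrite !yh.
  rewrite (ge0_integral_ginv P)// -(@integral_itv_obnd_cbnd _ (y a) (BRight (y b)))//.
apply: (@le_trans _ _ (\int[leb]_(x in y @^-1` `]y a, y b[) (f (y x) * (g (y x))%:E))%E).
  rewrite (ge0_integral_ginv P)// -(@integral_itv_bndo_bndc _ (BRight (y a)) (y b))//.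
apply: ge0_subset_integral => //; first exact: mpre.
- exact: measurable_funTS.
- move=> x /=; rewrite !in_itv/= => /andP[ax xb].
  apply/andP; split; first by rewrite ltNge; apply: contraTN ax => /yh; rewrite leNgt.
  by rewrite leNgt; apply: contraTN xb => /ltW/yh; rewrite leNgt.
Qed.

Lemma ge0_integral_ginv_itvNy (f : R -> \bar R) b :
  measurable_fun setT f -> (forall x, 0 <= f x)%E ->
  (\int[leb]_(x in `]-oo, b]) (f (y x) * (g (y x))%:E) =
   \int[leb]_(x in `]-oo, y b]) f x)%E.
Proof.
move=> mf f0.
have mfg : measurable_fun setT (fun x => f (y x) * (g (y x))%:E)%E.
  apply: emeasurable_funM; first exact: measurableT_comp.
  by apply/measurable_EFinP; exact: measurableT_comp.
have mpre A : measurable A -> measurable (y @^-1` A).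
  by move=> mA; rewrite -[X in measurable X]setTI; exact: my.
have fg0 x : (0 <= f (y x) * (g (y x))%:E)%E.
  by rewrite mule_ge0// lee_fin gdens_ge0.
have mfT A : measurable_fun A f by exact: measurable_funTS.
apply/eqP; rewrite eq_le; apply/andP; split.
  apply: (@le_trans _ _ (\int[leb]_(x in y @^-1` `]-oo, y b]) (f (y x) * (g (y x))%:E))%E).
    apply: ge0_subset_integral => //; first exact: mpre.
    - exact: measurable_funTS.
    - by move=> x /=; rewrite !in_itv/= => xb; rewrite !yh.
  by rewrite (ge0_integral_ginv P).
apply: (@le_trans _ _ (\int[leb]_(x in y @^-1` `]-oo, y b[) (f (y x) * (g (y x))%:E))%E).
  rewrite (ge0_integral_ginv P)// -(@integral_itv_bndo_bndc _ -oo%O (y b))//.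
apply: ge0_subset_integral => //; first exact: mpre.
- exact: measurable_funTS.
- move=> x /=; rewrite !in_itv/= => xb.
  by rewrite leNgt; apply: contraTN xb => /ltW/yh; rewrite leNgt.
Qed.

Lemma Rintegral_ginv_itv (f : R -> R) a b : a <= b -> measurable_fun setT f ->
  \int[leb]_(x in `]a, b]) (f (y x) * g (y x)) = \int[leb]_(x in `]y a, y b]) f x.
Proof.
move=> ab mf; congr fine; rewrite integralE [RHS]integralE.
have mfE : measurable_fun setT (EFin \o f) by exact/measurable_EFinP.
rewrite -ge0_integral_ginv_itv//; last exact: measurable_funepos.
rewrite -[X in (_ = _ - X)%E]ge0_integral_ginv_itv//; last exact: measurable_funeneg.
have g0 x : (0 <= (g (y x))%:E)%E by rewrite lee_fin gdens_ge0.
congr (_ - _)%E; apply: eq_integral => x _.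
  by rewrite !funeposE /= EFinM maxe_pMl ?mul0e.
by rewrite !funenegE /= maxe_pMl ?mul0e // -EFinM mulNr.
Qed.

Lemma ginv_increment a b : a <= b ->
  y b - y a = \int[leb]_(x in `]a, b]) g (y x).
Proof.
move=> ab; under eq_Rintegral do rewrite -[g _]mul1r.
by rewrite (@Rintegral_ginv_itv (cst 1))//= Rintegral_cst_itvoc ?mul1r// yh.
Qed.

Lemma u_ginv_increment a b : a <= b ->
  u (y b) - u (y a) = \int[leb]_(x in `]a, b]) (p (y x) * g (y x)).
Proof. by move=> ab; rewrite Rintegral_ginv_itv// -(profile_u P)// yh. Qed.

Lemma ae_derive1_ginv : {ae leb, forall x : R,
  derivable y x 1 /\ derive1 y x = g (y x)}.
Proof.
apply: (@ae_derive1_of_increments _ _ (g \o y) 1).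
- exact: measurableT_comp.
- by move=> x /=; rewrite ger0_norm ?gdens_ge0 ?gdens_le1.
- exact: ginv_increment.
Qed.

Lemma ae_derive1_u_ginv : {ae leb, forall x : R,
  derivable (u \o y) x 1 /\ derive1 (u \o y) x = p (y x) * g (y x)}.
Proof.
apply: (@ae_derive1_of_increments _ _ (fun x => p (y x) * g (y x)) 1).
- by apply: measurable_funM; exact: measurableT_comp.
- by move=> x; exact: normM_gdens_le1.
- exact: u_ginv_increment.
Qed.

End Lagrangian.

(** * Closed form of the evolution *)

Section TimeIntegrals.
Variable R : realType.
Notation leb := (@lebesgue_measure R).
Implicit Types t q r : R.

(* Energy density lost up to time t at a point where u_x = q, and its first and
   second primitives in t. *)
Definition loss t q : R := if t * q <= -2 then q ^+ 2 else 0.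
Definition loss1 t q : R := q * Num.min (t * q + 2) 0.
Definition loss2 t q : R := 2^-1 * Num.min (t * q + 2) 0 ^+ 2.

Lemma loss_ge0 t q : 0 <= loss t q.
Proof. by rewrite /loss; case: ifP => // _; exact: sqr_ge0. Qed.

Lemma loss_le t q : loss t q <= q ^+ 2.
Proof. by rewrite /loss; case: ifP => // _; exact: sqr_ge0. Qed.

Lemma loss1_ge0 t q : 0 <= t -> 0 <= loss1 t q.
Proof.
move=> t0; rewrite /loss1; case: (ltP (t * q + 2) 0) => h; last by rewrite mulr0.
have q0 : q < 0 by rewrite ltNge; apply/negP => q0; have := mulr_ge0 t0 q0; lra.
by apply: mulr_le0; lra.
Qed.

Lemma loss1_le t q : 0 <= t -> loss1 t q <= t * q ^+ 2.
Proof.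
move=> t0; have tq : 0 <= t * q ^+ 2 by rewrite mulr_ge0 ?sqr_ge0.
rewrite /loss1; case: (ltP (t * q + 2) 0) => h; last by rewrite mulr0.
have q0 : q < 0 by rewrite ltNge; apply/negP => q0; have := mulr_ge0 t0 q0; lra.
by rewrite expr2; nra.
Qed.

Lemma loss2_ge0 t q : 0 <= loss2 t q.
Proof. by rewrite /loss2 mulr_ge0 ?sqr_ge0// invr_ge0. Qed.

Lemma loss2_le t q : 0 <= t -> loss2 t q <= t ^+ 2 * q ^+ 2.
Proof.
move=> t0; rewrite /loss2; case: (ltP (t * q + 2) 0) => h; last first.
  by rewrite expr0n mulr0 mulr_ge0// sqr_ge0.
by rewrite -exprMn; nra.
Qed.

Lemma measurable_loss (d : measure_display) (T : measurableType d) (f g : T -> R) :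
  measurable_fun setT f -> measurable_fun setT g ->
  measurable_fun setT (fun x => loss (f x) (g x)).
Proof.
move=> mf mg; apply: measurable_fun_ifT => //; last exact: measurable_funX.
by apply: measurable_fun_ler => //; exact: measurable_funM.
Qed.

Lemma measurable_loss1 (d : measure_display) (T : measurableType d) (f g : T -> R) :
  measurable_fun setT f -> measurable_fun setT g ->
  measurable_fun setT (fun x => loss1 (f x) (g x)).
Proof.
move=> mf mg; apply: measurable_funM => //; apply: measurable_minr => //.
by apply: measurable_funD => //; exact: measurable_funM.
Qed.

Lemma measurable_loss2 (d : measure_display) (T : measurableType d) (f g : T -> R) :
  measurable_fun setT f -> measurable_fun setT g ->
  measurable_fun setT (fun x => loss2 (f x) (g x)).
Proof.
move=> mf mg; apply: measurable_funM => //; apply: measurable_funX.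
apply: measurable_minr => //.
by apply: measurable_funD => //; exact: measurable_funM.
Qed.

Lemma break_time t q : 0 <= t -> t * q <= -2 ->
  [/\ q < 0, 0 < - 2 / q, - 2 / q <= t &
      forall r, (r * q <= -2) = (- 2 / q <= r)].
Proof.
move=> t0 tq; have q0 : q < 0.
  by rewrite ltNge; apply/negP => q0; have := mulr_ge0 t0 q0; lra.
have rE r : (r * q <= -2) = (- 2 / q <= r) by rewrite ler_ndivrMr.
split=> //; last by rewrite -rE.
by rewrite mulNr oppr_gt0 pmulr_rlt0// invr_lt0.
Qed.

Lemma integral_loss t q : 0 <= t ->
  (\int[leb]_(r in `[0%R, t]) (loss r q)%:E = (loss1 t q)%:E)%E.
Proof.
move=> t0; have [tq|tq] := leP (t * q) (-2); last first.
  rewrite /loss1 min_r ?mulr0; last lra.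
  apply: integral0_eq => r; rewrite /= in_itv/= => /andP[r0 rt].
  rewrite /loss ifF//; apply/negbTE; rewrite -ltNge.
  have [q0|/ltW q0] := leP 0 q; first by have := mulr_ge0 r0 q0; lra.
  by have := ler_wnM2r q0 rt; lra.
have [q0 s0 st rE] := break_time t0 tq.
have -> : (\int[leb]_(r in `[0%R, t]) (loss r q)%:E =
    \int[leb]_(r in `[(- 2 / q)%R, t]) (q ^+ 2)%:E)%E.
  rewrite integral_mkcond [RHS]integral_mkcond; apply: eq_integral => r _.
  rewrite !patchE /loss rE; case: ifPn; rewrite ?inE ?notin_setE /= ?in_itv/=.
    move=> /andP[r0 rt]; case: ifPn => sr; case: ifPn => //; rewrite ?inE ?notin_setE /= in_itv/=.
      by rewrite sr rt.
    by move=> /andP[]; rewrite (negbTE sr).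
  move=> nr; case: ifPn => //; rewrite inE /= in_itv/= => /andP[sr rt].
  by exfalso; apply: nr; rewrite rt andbT; lra.
rewrite integral_cst// /loss1 min_l; last lra.
rewrite -[LHS]/((q ^+ 2)%:E * leb `[(- 2 / q)%R, t]%classic)%E.
have -> : leb `[(- 2 / q)%R, t]%classic = (t - (- 2 / q))%:E.
  rewrite lebesgue_measure_itv/= lte_fin; case: ltgtP st => //= -> _.
  by rewrite subrr.
by rewrite -EFinM; congr _%:E; field; rewrite lt_eqF.
Qed.

Lemma integral_loss1 t q : 0 <= t ->
  (\int[leb]_(r in `[0%R, t]) (loss1 r q)%:E = (loss2 t q)%:E)%E.
Proof.
move=> t0; have [tq|tq] := leP (t * q) (-2); last first.
  rewrite /loss2 min_r ?expr0n ?mulr0; last lra.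
  apply: integral0_eq => r; rewrite /= in_itv/= => /andP[r0 rt].
  rewrite /loss1 min_r ?mulr0//.
  have [q0|/ltW q0] := leP 0 q; first by have := mulr_ge0 r0 q0; lra.
  by have := ler_wnM2r q0 rt; lra.
have [q0 s0 st rE] := break_time t0 tq.
have -> : (\int[leb]_(r in `[0%R, t]) (loss1 r q)%:E =
    \int[leb]_(r in `[(- 2 / q)%R, t]) (q * (r * q + 2))%:E)%E.
  rewrite integral_mkcond [RHS]integral_mkcond; apply: eq_integral => r _.
  have [sr|rs] := leP (- 2 / q) r.
    have rq : r * q <= -2 by rewrite rE.
    rewrite !patchE /loss1 min_l; last lra.
    have -> : (r \in `[0%R, t]%classic) = (r \in `[(- 2 / q)%R, t]%classic).
      by apply/idP/idP; rewrite !inE /= !in_itv/= sr => /andP[_ ->]//; rewrite andbT; lra.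
    by [].
  have rq : -2 < r * q by rewrite ltNge rE -ltNge.
  rewrite !patchE /loss1 min_r ?mulr0; last lra.
  rewrite [in RHS]ifF; first by case: ifP.
  by apply/negbTE; rewrite notin_setE /= in_itv/= leNgt rs.
rewrite /loss2 min_l; last lra.
(* The fundamental theorem is applied on a nondegenerate interval, so breaking exactly at time [t]
   is treated apart. *)
have [sE|ns] := eqVneq (- 2 / q) t.
  rewrite sE set_itv1 integral_set1 -sE divfK ?lt_eqF//.
  by rewrite addNr expr0n mulr0.
have slt : - 2 / q < t by rewrite lt_neqAle ns.
(* This primitive vanishes at the breaking time [-2 / q], so only its value at [t] remains. *)
pose A (r : R) : R := 2^-1 * (r * q + 2) ^+ 2.
have dA r : is_derive r 1 A (q * (r * q + 2)).
  rewrite /A; apply: is_derive_eq; rewrite /GRing.scale/=.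
  by field.
have cA : continuous A.
  by move=> r; apply: differentiable_continuous; apply/derivable1_diffP; exact: ex_derive.
have dAE r : derive1 A r = q * (r * q + 2).
  by rewrite derive1E derive_val.
rewrite (@continuous_FTC2 _ _ A)//.
- rewrite /A divfK ?lt_eqF// [X in (_ - (_ * X ^+ 2)%:E)%E]addNr expr0n mulr0 sube0//.
- apply: continuous_subspaceT => r.
  apply: cvgM; first exact: cvg_cst.
  by apply: cvgD; [apply: cvgM; [exact: cvg_id|exact: cvg_cst]|exact: cvg_cst].
- split=> //.
  + by apply: cvg_at_right_filter; exact: cA.
  + by apply: cvg_at_left_filter; exact: cA.
Qed.

End TimeIntegrals.

(** * Exchange of time and space integrals *)

Section TonelliInTime.
Variable R : realType.
Notation leb := (@lebesgue_measure R).

(** Integrability in time is part of the conclusion because the integrated equations for [U] and [y]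
    are split by linearity. *)
Lemma Rintegral_tonelli_time (f f1 : R -> R -> R) (p : R -> R)
    (S : set (measurableTypeR R)) t :
  measurable S -> 0 <= t ->
  measurable_fun setT (fun z : measurableTypeR R * measurableTypeR R => f z.1 (p z.2)) ->
  (forall r q, 0 <= r -> 0 <= f r q) ->
  (forall r, 0 <= r -> leb.-integrable S (EFin \o (fun x => f r (p x)))) ->
  (forall q, (\int[leb]_(r in `[0%R, t]) (f r q)%:E = (f1 t q)%:E)%E) ->
  leb.-integrable S (EFin \o (fun x => f1 t (p x))) ->
  leb.-integrable `[0, t] (EFin \o (fun r => \int[leb]_(x in S) f r (p x))) /\
  \int[leb]_(r in `[0, t]) (\int[leb]_(x in S) f r (p x)) =
  \int[leb]_(x in S) f1 t (p x).
Proof.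
move=> mS t0 mf f0 fS ff1 f1S.
pose I : set (measurableTypeR R) := `[0, t]%classic.
have mI : measurable I by exact: measurable_itv.
have I0 r : I r -> 0 <= r by rewrite /I /= in_itv/= => /andP[].
(* The absolute value makes [phi] nonnegative by construction; on [I] it changes nothing, as [f r]
   is nonnegative for [r >= 0]. *)
pose phi := (fun z : measurableTypeR R * measurableTypeR R =>
  (`|f z.1 (p z.2)|)%:E) \_ (I `*` S).
have phi0 z : (0 <= phi z)%E.
  by apply: erestrict_ge0 => ? _; rewrite lee_fin.
have mphi : measurable_fun setT phi.
  apply/(measurable_restrictT _ _).1; first exact: measurableX.
  by apply: measurable_funTS; apply/measurable_EFinP; exact: measurableT_comp.
have phiE r x : phi (r, x) = if r \in I then (if x \in S then (f r (p x))%:E else 0%E) else 0%E.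
  rewrite /phi patchE in_setX/=; case: ifP => //=.
    by move=> /andP[rI ->]; rewrite rI ger0_norm// f0// I0// -in_setE.
  by case: ifP => //= rI; case: ifP.
have F1 : (\int[leb]_r (\int[leb]_x phi (r, x)) =
    \int[leb]_(r in I) (\int[leb]_(x in S) f r (p x))%:E)%E.
  rewrite [RHS]integral_mkcond; apply: eq_integral => r _; rewrite patchE.
  case: ifPn => rI; last first.
    by apply: integral0_eq => x _; rewrite phiE (negbTE rI).
  rewrite /Rintegral fineK; last first.
    apply: (integrable_fin_num mS); apply: fS; apply: I0; exact: set_mem.
  rewrite [RHS]integral_mkcond; apply: eq_integral => x _.
  by rewrite phiE rI patchE.
have F2 : (\int[leb]_x (\int[leb]_r phi (r, x)) =
    \int[leb]_(x in S) (f1 t (p x))%:E)%E.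
  rewrite [RHS]integral_mkcond; apply: eq_integral => x _; rewrite patchE.
  case: ifPn => xS; last first.
    by apply: integral0_eq => r _; rewrite phiE (negbTE xS); case: ifP.
  rewrite -ff1 [RHS]integral_mkcond; apply: eq_integral => r _.
  by rewrite phiE patchE xS.
have E12 : (\int[leb]_(r in I) (\int[leb]_(x in S) f r (p x))%:E =
    \int[leb]_(x in S) (f1 t (p x))%:E)%E.
  by rewrite -F1 -F2; exact: (fubini_tonelli phi).
have mint : measurable_fun I (EFin \o (fun r => \int[leb]_(x in S) f r (p x))).
  have mF := measurable_fun_fubini_tonelli_F (m2 := leb) phi mphi phi0.
  apply: (eq_measurable_fun (fubini_F leb phi)).
    move=> r rI; rewrite /fubini_F /Rintegral /= fineK; last first.
      apply: (integrable_fin_num mS); apply: fS; apply: I0; exact: set_mem.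
    rewrite [RHS]integral_mkcond; apply: eq_integral => x _.
    by rewrite phiE rI patchE.
  exact: measurable_funTS.
split; last by rewrite {1}/Rintegral -/I E12.
apply/integrableP; split => //.
apply: (@le_lt_trans _ _ (\int[leb]_(r in I) (\int[leb]_(x in S) f r (p x))%:E)%E).
  rewrite le_eqVlt; apply/orP; left; apply/eqP.
  apply: eq_integral => r /set_mem rI /=; rewrite ger0_norm//.
  by apply: Rintegral_ge0 => x _; apply: f0; exact: I0.
by rewrite E12; exact: integrable_lty.
Qed.

End TonelliInTime.

(** * The evolution of [V], [U] and [y] in terms of the initial data *)

Section ExplicitEvolution.
Variable R : realType.
Notation leb := (@lebesgue_measure R).
Variables (u p F E : R -> R) (ms : {measure set (measurableTypeR R) -> \bar R}).
Variables (N : set (measurableTypeR R)) (G : R).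
Hypothesis P : profile u p F ms N G.
Notation y := (ginv F).
Notation g := (gdens p N).
Let cF := profile_cumulative P.
Let mp := profile_p P.
Let yh := ginv_homo cF.
Let my : measurable_fun setT y.
Proof. exact: measurable_ginv cF. Qed.
Let mg := measurable_gdens P.
Let X := mapL (Eulerian u E F).

Lemma gap_cvg_Ny e : 0 < e -> exists x0, forall x, x <= x0 -> x - y x < e.
Proof.
move=> e0; have e2 : 0 < e / 2 by lra.
have [x0 Fx0] := profile_F_Ny P e2.
exists (x0 - e / 2) => x xx0.
have := cumF_ginv_ge cF (ltac:(lra) : y x < y x + e / 2).
have := Fx0 (y x + e / 2); have := ginv_le_id cF x.
move=> h1 h2 h3; have := h2 (ltac:(lra)); lra.
Qed.

Lemma gap_cvg_y e : 0 < e -> exists x0, forall x, x0 <= x -> G - e < x - y x.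
Proof.
move=> e0; have [x0 Fx0] := profile_F_y P e0.
exists (x0 + G) => x xx0.
have := cumF_ginv_le cF x; have := Fx0 (y x); have := ginv_ge_id cF x.
move=> h1 h2 h3; have := h2 (ltac:(lra)); lra.
Qed.

(** On the half-line neither 1 nor [g \o y] is integrable, only their difference is. The terms are
    separated on bounded intervals, and the half-line is reached through the limit 0 of the gap at
    [-oo]. *)
Lemma integral_gap xi :
  leb.-integrable `]-oo, xi] (EFin \o (fun x => 1 - g (y x))) /\
  \int[leb]_(x in `]-oo, xi]) (1 - g (y x)) = xi - y xi.
Proof.
have m1g : measurable_fun setT (fun x => 1 - g (y x)).
  by apply: measurable_funB => //; exact: measurableT_comp.
have g1 x : 0 <= 1 - g (y x) by rewrite subr_ge0 gdens_le1.
have intg a b : leb.-integrable `]a, b] (EFin \o (fun x => g (y x))).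
  apply: (@integrable_bounded _ _ _ _ _ _ 1) => //.
  - exact: lebesgue_measure_itv_lty.
  - by apply: measurable_funTS; exact: measurableT_comp.
  - by move=> x _; rewrite ger0_norm ?gdens_ge0 ?gdens_le1.
have int1 a b := integrable_itvoc_cst a b (1 : R).
have iE : (\int[leb]_(x in `]-oo, xi]) (1 - g (y x))%:E = (xi - y xi)%:E)%E.
  apply: (@ge0_integral_itvNy _ (fun x => 1 - g (y x)) (fun x => x - y x)) => //.
  - move=> a b ab; have : \int[leb]_(x in `]a, b]) (1 - g (y x)) = (b - y b) - (a - y a).
      rewrite RintegralB// Rintegral_cst_itvoc// -(ginv_increment P)//; lra.
    rewrite /Rintegral => <-; rewrite fineK//; apply: integrable_fin_num => //.
    exact: (integrableB _ (int1 a b) (intg a b)).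
  - by move=> x; have /andP[] := ginv_gap_bounds cF x.
  - exact: gap_cvg_Ny.
split; last by rewrite /Rintegral iE.
apply/integrableP; split; first by apply: measurable_funTS; exact/measurable_EFinP.
under eq_integral do rewrite /= ger0_norm//.
by move: iE => /= ->; rewrite ltry.
Qed.

End ExplicitEvolution.

Section Evolution.
Variable R : realType.
Notation leb := (@lebesgue_measure R).
Variables (u p F E : R -> R) (ms : {measure set (measurableTypeR R) -> \bar R}).
Variables (N : set (measurableTypeR R)) (G : R).
Hypothesis P : profile u p F ms N G.
Notation y := (ginv F).
Notation g := (gdens p N).
Let cF := profile_cumulative P.
Let mp := profile_p P.
Let yh := ginv_homo cF.
Let my : measurable_fun setT y.
Proof. exact: measurable_ginv cF. Qed.
Let mg := measurable_gdens P.
Notation X := (mapL (Eulerian u E F)).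
Implicit Types (t : R) (S : set (measurableTypeR R)).

(** The factor [1 - g (y x)] is the derivative of the initial [V]. Off [N] it equals [p^2 g], and
    [tau] is [-2 / p] when [p < 0], the factor [g] cancelling in the quotient. On [N] both
    derivatives vanish, so [tau = 0]: energy that is concentrated at the initial time is never
    dissipated. *)
Lemma tau_loss t x : 0 <= t ->
  derive1 y x = g (y x) -> derive1 (u \o y) x = p (y x) * g (y x) ->
  \1_[set w | (0 < tau X w <= t%:E)%E] x * (1 - g (y x)) =
  loss t (p (y x)) * g (y x).
Proof.
move=> t0 dy du.
have tauE : tau X x = if (g (y x) == 0) && (p (y x) * g (y x) == 0) then 0%E
    else if p (y x) * g (y x) < 0 then (- 2 * g (y x) / (p (y x) * g (y x)))%:E
    else +oo%E.
  by rewrite -du -dy.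
have [Ny|Ny] := pselect (N (y x)).
  rewrite gdens0// mulr0 indicE memNset ?mul0r//= tauE gdens0// mulr0 eqxx /=.
  by rewrite ltxx.
have g0 : 0 < g (y x) by rewrite gdensE// invr_gt0; have := sqr_ge0 (p (y x)); lra.
have gE : 1 - g (y x) = p (y x) ^+ 2 * g (y x).
  by rewrite gdensE//; field; have := sqr_ge0 (p (y x)); lra.
rewrite gE mulrA; congr (_ * _); rewrite indicE.
rewrite gt_eqF//= pmulr_llt0// in tauE.
have -> : (x \in [set w | (0 < tau X w <= t%:E)%E]) = (t * p (y x) <= -2).
  apply/idP/idP => [|tp].
    rewrite inE /= tauE; case: ifP => [p0|_]; last by rewrite andbC leye_eq.
    rewrite lee_fin => /andP[_].
    rewrite -mulf_div divff ?gt_eqF// mulr1 ler_ndivrMr//.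
  have [p0 s0 st _] := break_time t0 tp.
  rewrite inE /= tauE p0 lte_fin lee_fin -mulf_div divff ?gt_eqF// mulr1.
  by rewrite s0 st.
by rewrite /loss; case: ifP; rewrite ?mul1r ?mul0r.
Qed.

Lemma integrable_loss t S : measurable S ->
  leb.-integrable S (EFin \o (fun x => loss t (p x))).
Proof.
move=> mS; apply: (@integrable_dom _ _ _ leb S (fun x => loss t (p x)) (fun x => p x ^+ 2)) => //.
- by apply: measurable_funTS; apply: measurable_loss.
- by move=> x _; rewrite ger0_norm ?loss_ge0// loss_le.
- exact: integrableS (profile_integrable_sqr P).
Qed.

Lemma integrable_loss1 t S : 0 <= t -> measurable S ->
  leb.-integrable S (EFin \o (fun x => loss1 t (p x))).
Proof.
move=> t0 mS; apply: (@integrable_dom _ _ _ leb S (fun x => loss1 t (p x)) (fun x => t * p x ^+ 2)) => //.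
- by apply: measurable_funTS; apply: measurable_loss1.
- by move=> x _; rewrite ger0_norm ?loss1_ge0// loss1_le.
- apply: (integrableZl _ _ (integrableS _ _ _ (profile_integrable_sqr P))) => //.
Qed.

Lemma integrable_loss2 t S : 0 <= t -> measurable S ->
  leb.-integrable S (EFin \o (fun x => loss2 t (p x))).
Proof.
move=> t0 mS; apply: (@integrable_dom _ _ _ leb S (fun x => loss2 t (p x)) (fun x => t ^+ 2 * p x ^+ 2)) => //.
- by apply: measurable_funTS; apply: measurable_loss2.
- by move=> x _; rewrite ger0_norm ?loss2_ge0// loss2_le.
- apply: (integrableZl _ _ (integrableS _ _ _ (profile_integrable_sqr P))) => //.
Qed.

Lemma evolV_eq alpha t xi : 0 <= t ->
  evolV alpha X t xi = (xi - y xi) - alpha * \int[leb]_(x in `]-oo, y xi]) loss t (p x).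
Proof.
move=> t0.
have [E1 [mE1 E10 sE1]] := ae_derive1_ginv P.
have [E2 [mE2 E20 sE2]] := ae_derive1_u_ginv P.
have mE : measurable (E1 `|` E2) by exact: measurableU.
have E0 : leb (E1 `|` E2) = 0%E.
  apply/eqP; rewrite eq_le measure_ge0 andbT.
  by rewrite (le_trans (measureU2 _ mE1 mE2))//= E10 E20 adde0.
have [ig igE] := integral_gap P xi.
have mlg : measurable_fun setT (fun x => loss t (p (y x)) * g (y x)).
  apply: measurable_funM; last exact: measurableT_comp.
  by apply: measurable_loss => //; exact: measurableT_comp.
have lg0 x : 0 <= loss t (p (y x)) * g (y x).
  by rewrite mulr_ge0 ?loss_ge0 ?gdens_ge0.
have iE : (\int[leb]_(x in `]-oo, xi]) (loss t (p (y x)) * g (y x))%:E =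
    \int[leb]_(x in `]-oo, y xi]) (loss t (p x))%:E)%E.
  rewrite -(ge0_integral_ginv_itvNy P)//.
  - by apply/measurable_EFinP; apply: measurable_loss.
  - by move=> x; rewrite lee_fin loss_ge0.
have il : leb.-integrable `]-oo, xi] (EFin \o (fun x => loss t (p (y x)) * g (y x))).
  apply/integrableP; split; first by apply: measurable_funTS; exact/measurable_EFinP.
  under eq_integral do rewrite /= ger0_norm//.
  rewrite iE; apply: integrable_lty => //; exact: integrable_loss.
have -> : \int[leb]_(x in `]-oo, y xi]) loss t (p x) =
    \int[leb]_(x in `]-oo, xi]) (loss t (p (y x)) * g (y x)).
  by rewrite /Rintegral iE.
rewrite /evolV -igE -RintegralZl// -RintegralB//; last exact: (integrableZl _ _ il).
apply: (Rintegral_eq_off_null _ mE E0) => x Ex.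
have [dy1 dyE] : derivable y x 1 /\ derive1 y x = g (y x).
  by apply: contrapT => h; apply: Ex; left; exact: sE1.
have [_ duE] : derivable (u \o y) x 1 /\ derive1 (u \o y) x = p (y x) * g (y x).
  by apply: contrapT => h; apply: Ex; right; exact: sE2.
have -> : derive1 (LV X) x = 1 - g (y x).
  rewrite derive1E [LHS](_ : _ = 'D_1 (id - y) x)//.
  by rewrite deriveB// derive_id -derive1E dyE.
by rewrite mulrBl mul1r -mulrA tau_loss.
Qed.

Lemma evolVinf_eq alpha t : 0 <= t ->
  evolVinf alpha X t = G - alpha * \int[leb]_x loss t (p x).
Proof.
move=> t0; apply: cvg_lim; first exact: Rhausdorff.
have -> : evolV alpha X t = fun xi =>
    (xi - y xi) - alpha * \int[leb]_(x in `]-oo, y xi]) loss t (p x).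
  by apply/funext => xi; rewrite evolV_eq.
apply: cvgB.
  apply/cvgrPdist_lt => e e0; have [x0 hx0] := gap_cvg_y P e0.
  near=> x; have /andP[_ xG] := ginv_gap_bounds cF x.
  have : x0 <= x by near: x; by apply: nbhs_pinfty_ge; rewrite num_real.
  by move=> /hx0; rewrite ger0_norm ?subr_ge0//; lra.
apply: cvgM; first exact: cvg_cst.
apply/cvgrPdist_lt => e e0.
have [x0 hx0] := ge0_Rintegral_tail (integrable_loss t measurableT)
  (fun x => loss_ge0 t (p x)) e0.
near=> x.
have : x0 <= y x.
  apply: le_trans (ginv_ge_id cF x); rewrite lerBrDr; near: x.
  by apply: nbhs_pinfty_ge; rewrite num_real.
move=> /hx0 h; rewrite ger0_norm; first lra.
rewrite subr_ge0; apply: (@ge0_Rintegral_subset R) => //; first exact: (integrable_loss t measurableT).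
by move=> z; exact: loss_ge0.
Unshelve. all: end_near. Qed.

End Evolution.

Section ExplicitSolution.
Variable R : realType.
Notation leb := (@lebesgue_measure R).

Lemma integrable_itvcc_cst (t c : R) : leb.-integrable `[0, t] (EFin \o (fun=> c)).
Proof.
apply: (@integrable_bounded _ _ _ _ _ _ `|c|) => //.
exact: lebesgue_measure_itv_lty.
Qed.

Lemma Rintegral_itvcc_cst (t c : R) : 0 <= t -> \int[leb]_(r in `[0, t]) c = c * t.
Proof.
move=> t0; have := @Rintegral_cst_itvoc _ 0 t c t0.
rewrite subr0 => <-; rewrite Rintegral_itv_obnd_cbnd//.
apply: (@integrable_bounded _ _ _ _ _ _ `|c|) => //.
exact: lebesgue_measure_itv_lty.
Qed.

Lemma integrable_itvcc_id (t : R) : leb.-integrable `[0, t] (EFin \o id).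
Proof.
apply: (@integrable_bounded _ _ _ _ _ _ t) => //.
  exact: lebesgue_measure_itv_lty.
by move=> r /=; rewrite in_itv/= => /andP[r0 rt]; rewrite ger0_norm.
Qed.

Lemma Rintegral_itvcc_id (t : R) : 0 <= t ->
  \int[leb]_(r in `[0, t]) r = 2^-1 * t ^+ 2.
Proof.
rewrite le_eqVlt => /predU1P[<-|t0].
  by rewrite set_itv1 Rintegral_set1 expr0n mulr0.
pose A (r : R) : R := 2^-1 * r ^+ 2.
have dA (r : R) : is_derive r 1 A r.
  by rewrite /A; apply: is_derive_eq; rewrite /GRing.scale/=; field.
have cA : continuous A.
  by move=> r; apply: differentiable_continuous; apply/derivable1_diffP; exact: ex_derive.
rewrite /Rintegral (@continuous_FTC2 _ (fun r => r) A)//.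
- by rewrite /A expr0n mulr0 sube0.
- by apply: continuous_subspaceT => r; exact: cvg_id.
- split=> //.
  + by apply: cvg_at_right_filter; exact: cA.
  + by apply: cvg_at_left_filter; exact: cA.
- by move=> r _; rewrite derive1E derive_val.
Qed.

Variables (u p F E : R -> R) (ms : {measure set (measurableTypeR R) -> \bar R}).
Variables (N : set (measurableTypeR R)) (G : R).
Hypothesis P : profile u p F ms N G.
Notation y := (ginv F).
Notation X := (mapL (Eulerian u E F)).
Implicit Types (t : R) (S : set (measurableTypeR R)).
Let mp := profile_p P.

Let mp2 : measurable_fun setT
  (fun z : measurableTypeR R * measurableTypeR R => p z.2).
Proof. exact: measurableT_comp. Qed.

Lemma Rintegral_time_loss t S : measurable S -> 0 <= t ->
  leb.-integrable `[0, t] (EFin \o (fun r => \int[leb]_(x in S) loss r (p x))) /\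
  \int[leb]_(r in `[0, t]) (\int[leb]_(x in S) loss r (p x)) =
  \int[leb]_(x in S) loss1 t (p x).
Proof.
move=> mS t0; apply: Rintegral_tonelli_time => //.
- by apply: measurable_loss => //; exact: measurable_fst.
- by move=> r q _; exact: loss_ge0.
- by move=> r _; exact: integrable_loss P _ _ _.
- by move=> q; exact: integral_loss.
- exact: integrable_loss1 P _ _ _ _.
Qed.

Lemma Rintegral_time_loss1 t S : measurable S -> 0 <= t ->
  leb.-integrable `[0, t] (EFin \o (fun r => \int[leb]_(x in S) loss1 r (p x))) /\
  \int[leb]_(r in `[0, t]) (\int[leb]_(x in S) loss1 r (p x)) =
  \int[leb]_(x in S) loss2 t (p x).
Proof.
move=> mS t0; apply: Rintegral_tonelli_time => //.
- by apply: measurable_loss1 => //; exact: measurable_fst.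
- by move=> r q r0; exact: loss1_ge0.
- by move=> r r0; exact: integrable_loss1 P _ _ _ _.
- by move=> q; exact: integral_loss1.
- exact: integrable_loss2 P _ _ _ _.
Qed.

Lemma evolU_eq alpha t xi : 0 <= t -> evolU alpha X t xi =
  u (y xi) + ((xi - y xi) / 2 - G / 4) * t -
  alpha * ((\int[leb]_(x in `]-oo, y xi]) loss1 t (p x)) / 2 -
           (\int[leb]_x loss1 t (p x)) / 4).
Proof.
move=> t0; rewrite /evolU -[LU X xi]/(u (y xi)) -addrA; congr (_ + _).
pose c := (xi - y xi) / 2 - G / 4.
pose S : set (measurableTypeR R) := `]-oo, y xi]%classic.
have mS : measurable S by exact: measurable_itv.
have mI : measurable (`[0, t]%classic : set (measurableTypeR R)) by exact: measurable_itv.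
have [iS eS] := Rintegral_time_loss mS t0.
have [iT eT] := Rintegral_time_loss measurableT t0.
rewrite -eT -eS -/S.
transitivity (\int[leb]_(r in `[0, t])
    (c - (alpha / 2 * (\int[leb]_(x in S) loss r (p x)) -
          alpha / 4 * (\int[leb]_x loss r (p x))))).
  apply: eq_Rintegral => r; rewrite inE /= in_itv/= => /andP[r0 rt].
  by rewrite (evolV_eq E P)// (evolVinf_eq E P)// /c -/S; field.
have iS' := integrableZl mI (alpha / 2) iS.
have iT' := integrableZl mI (alpha / 4) iT.
rewrite RintegralB//; last 2 first.
- exact: integrable_itvcc_cst.
- exact: (integrableB mI iS' iT').
rewrite Rintegral_itvcc_cst// RintegralB// !RintegralZl//.
by rewrite /c; field.
Qed.

Lemma evoly_eq alpha t xi : 0 <= t -> evoly alpha X t xi =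
  y xi + u (y xi) * t + ((xi - y xi) / 2 - G / 4) * (t ^+ 2 / 2) -
  alpha * ((\int[leb]_(x in `]-oo, y xi]) loss2 t (p x)) / 2 -
           (\int[leb]_x loss2 t (p x)) / 4).
Proof.
move=> t0; rewrite /evoly -[Ly X xi]/(y xi) -!addrA; congr (_ + _).
pose c := (xi - y xi) / 2 - G / 4.
pose S : set (measurableTypeR R) := `]-oo, y xi]%classic.
have mS : measurable S by exact: measurable_itv.
have mI : measurable (`[0, t]%classic : set (measurableTypeR R)) by exact: measurable_itv.
have [iS eS] := Rintegral_time_loss1 mS t0.
have [iT eT] := Rintegral_time_loss1 measurableT t0.
rewrite -eT -eS -/S.
transitivity (\int[leb]_(r in `[0, t])
    ((u (y xi) + c * r) -
     (alpha / 2 * (\int[leb]_(x in S) loss1 r (p x)) -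
      alpha / 4 * (\int[leb]_x loss1 r (p x))))).
  apply: eq_Rintegral => r; rewrite inE /= in_itv/= => /andP[r0 rt].
  by rewrite evolU_eq// /c -/S; field.
have iS' := integrableZl mI (alpha / 2) iS.
have iT' := integrableZl mI (alpha / 4) iT.
have i1 := integrable_itvcc_cst t (u (y xi)).
have i2 := integrableZl mI c (integrable_itvcc_id t).
rewrite RintegralB//; last 2 first.
- exact: (integrableD mI i1 i2).
- exact: (integrableB mI iS' iT').
rewrite RintegralD// Rintegral_itvcc_cst// RintegralB// !RintegralZl//; last first.
  exact: integrable_itvcc_id.
by rewrite Rintegral_itvcc_id// /c; field.
Qed.

End ExplicitSolution.

Lemma dist_half (R : realFieldType) (a b C : R) : `|a - b| <= C + `|b| / 2 ->
  (0 <= b -> b / 2 - C <= a) /\ (b <= 0 -> a <= b / 2 + C).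
Proof.
move=> h; split => b0.
  by move: h; rewrite (ger0_norm b0) ler_norml; lra.
by move: h; rewrite (ler0_norm b0) ler_norml; lra.
Qed.

Lemma continuous_surjective_between (R : realType) (f : R -> R) (a b x : R) :
  a <= b -> continuous f -> f a <= x -> x <= f b -> exists c, f c = x.
Proof.
move=> ab cf fa fb; have [] := @IVT R f a b x ab.
- exact: continuous_subspaceT.
- by rewrite ge_min fa le_max fb orbT.
by move=> c _ cx; exists c.
Qed.

Lemma increment_bound_sym (R : realDomainType) (f g : R -> R) (l c : R) :
  (forall a b, a <= b -> l * `|f b - f a| <= c + `|g b - g a|) ->
  forall a b, l * `|f b - f a| <= c + `|g b - g a|.
Proof.
move=> H a b; have [ab|/ltW ba] := leP a b; first exact: H.
by rewrite (distrC (f b)) (distrC (g b)); exact: H.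
Qed.

Lemma norm_le_of_signed (R : realFieldType) (l H G dU dY : R) :
  2 * l * dU <= l ^+ 2 * H + dY -> 2 * (- l) * dU <= l ^+ 2 * H + dY ->
  l ^+ 2 * H <= l ^+ 2 * G -> 2 * l * `|dU| <= l ^+ 2 * G + `|dY|.
Proof.
move=> h1 h2 h3; have h4 := ler_norm dY.
have [dU0|/ltW dU0] := leP 0 dU; first by rewrite (ger0_norm dU0); lra.
by rewrite (ler0_norm dU0); lra.
Qed.

(** * Regularity and comparison of solutions *)

Section SolutionEstimates.
Variable R : realType.
Notation leb := (@lebesgue_measure R).
Variables (u p F E : R -> R) (ms : {measure set (measurableTypeR R) -> \bar R}).
Variables (N : set (measurableTypeR R)) (G : R).
Hypothesis P : profile u p F ms N G.
Notation y := (ginv F).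
Notation X := (mapL (Eulerian u E F)).
Implicit Types (t : R) (S : set (measurableTypeR R)).
Let mp := profile_p P.
Let cF := profile_cumulative P.
Let yh := ginv_homo cF.
Let G0 : 0 <= G. Proof. exact: le_trans (cumF_ge0 cF 0) (cumF_le cF 0). Qed.

Lemma Rintegral_itv_split (f : R -> R) (a b : R) : a <= b ->
  leb.-integrable setT (EFin \o f) ->
  \int[leb]_(x in `]-oo, b]) f x - \int[leb]_(x in `]-oo, a]) f x =
  \int[leb]_(x in `]a, b]) f x.
Proof.
move=> ab fT; rewrite Rintegral_itvB ?bnd_simp//.
exact: integrableS fT.
Qed.

Lemma integrable_itv_profile a b : leb.-integrable `]a, b] (EFin \o p).
Proof.
apply: (@integrable_dom _ _ _ leb _ p (fun x => 1 + p x ^+ 2)) => //.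
- exact: measurable_funTS.
- move=> x _; rewrite -real_normK ?num_real//.
  have := sqr_ge0 (`|p x| - 1); rewrite sqrrB1; have := normr_ge0 (p x); lra.
- have i2 : leb.-integrable `]a, b] (EFin \o (fun x => p x ^+ 2)).
    exact: integrableS (profile_integrable_sqr P).
  exact: (integrableD _ (integrable_itvoc_cst a b 1) i2).
Qed.

(** On [N] the density [1 - gdens p N] of the gap is 1 while [p^2 * gdens p N] is 0; off [N] they
    agree. The defect is the singular energy met between [a] and [b]. *)
Lemma sqr_le_gap a b : a <= b ->
  \int[leb]_(x in `]y a, y b]) (p x ^+ 2) <= (b - y b) - (a - y a).
Proof.
move=> ab.
have intg : leb.-integrable `]a, b] (EFin \o (fun x => gdens p N (y x))).
  apply: (@integrable_bounded _ _ _ _ _ _ 1) => //.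
  - exact: lebesgue_measure_itv_lty.
  - apply: measurable_funTS; apply: measurableT_comp (measurable_gdens P) _.
    exact: measurable_ginv cF.
  - by move=> x _; rewrite ger0_norm ?gdens_ge0 ?gdens_le1.
have int1 := integrable_itvoc_cst a b (1 : R).
have -> : (b - y b) - (a - y a) = \int[leb]_(x in `]a, b]) (1 - gdens p N (y x)).
  by rewrite RintegralB// Rintegral_cst_itvoc// -(ginv_increment P)//; lra.
rewrite -(Rintegral_ginv_itv P)//; last exact: measurable_funX.
have le1 x : p (y x) ^+ 2 * gdens p N (y x) <= 1 - gdens p N (y x).
  have [Ny|Ny] := pselect (N (y x)); first by rewrite gdens0// mulr0 subr0.
  rewrite gdensE//; have := sqr_ge0 (p (y x)) => p20.
  rewrite le_eqVlt; apply/orP; left; apply/eqP; field; lra.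
apply: le_Rintegral => //; last exact: (integrableB _ int1 intg).
apply: (@integrable_bounded _ _ _ _ _ _ 1) => //.
- exact: lebesgue_measure_itv_lty.
- apply: measurable_funTS; apply: measurable_funM.
    by apply: measurable_funX; apply: measurableT_comp mp _; exact: measurable_ginv cF.
  by apply: measurableT_comp (measurable_gdens P) _; exact: measurable_ginv cF.
- move=> x _; rewrite ger0_norm; last by apply: mulr_ge0; [exact: sqr_ge0|exact: gdens_ge0].
  by apply: le_trans (le1 x) _; have := gdens_ge0 p N (y x); lra.
Qed.

Variable alpha : R.
Hypothesis alpha01 : 0 <= alpha <= 1.

Lemma evol_increments t a b : 0 <= t -> a <= b ->
  evolU alpha X t b - evolU alpha X t a =
    \int[leb]_(x in `]y a, y b]) p x + ((b - y b) - (a - y a)) * t / 2 -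
    alpha * (\int[leb]_(x in `]y a, y b]) loss1 t (p x)) / 2 /\
  evoly alpha X t b - evoly alpha X t a =
    y b - y a + t * \int[leb]_(x in `]y a, y b]) p x +
    ((b - y b) - (a - y a)) * t ^+ 2 / 4 -
    alpha * (\int[leb]_(x in `]y a, y b]) loss2 t (p x)) / 2.
Proof.
move=> t0 ab; rewrite !(evolU_eq E P)// !(evoly_eq E P)//.
rewrite -(profile_u P) ?yh//.
rewrite -!(@Rintegral_itv_split (fun x => _ (p x))) ?yh//.
- by split; field.
- exact: (integrable_loss2 P t0 measurableT).
- exact: (integrable_loss1 P t0 measurableT).
Qed.

(** With [q = u_x], this is [l^2] times the initial energy density, plus the density of [y(t)],
    minus [2 l] times the density of [U(t)], all with respect to [dx]. Put [w = t q + 2]. Before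
    breaking it is the square of [l q - w / 2]; afterwards it is the square of
    [l q - (1 - alpha) w / 2] plus [alpha (1 - alpha) w^2 / 4], where [0 <= alpha <= 1] enters. *)
Lemma dissipated_square_ge0 (t l q : R) :
  0 <= l ^+ 2 * q ^+ 2 + 1 + t * q + t ^+ 2 / 4 * q ^+ 2 - alpha / 2 * loss2 t q
       - 2 * l * (q + t / 2 * q ^+ 2 - alpha / 2 * loss1 t q).
Proof.
rewrite /loss1 /loss2; case: (ltP (t * q + 2) 0) => w.
  have -> : l ^+ 2 * q ^+ 2 + 1 + t * q + t ^+ 2 / 4 * q ^+ 2 -
     alpha / 2 * (2^-1 * (t * q + 2) ^+ 2)
     - 2 * l * (q + t / 2 * q ^+ 2 - alpha / 2 * (q * (t * q + 2))) =
     (l * q - 2^-1 * (1 - alpha) * (t * q + 2)) ^+ 2 +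
     4^-1 * (alpha * (1 - alpha)) * (t * q + 2) ^+ 2 by field.
  apply: addr_ge0; first exact: sqr_ge0.
  apply: mulr_ge0; last exact: sqr_ge0.
  by apply: mulr_ge0 => //; apply: mulr_ge0; move: alpha01 => /andP[? ?]; lra.
have -> : l ^+ 2 * q ^+ 2 + 1 + t * q + t ^+ 2 / 4 * q ^+ 2 -
     alpha / 2 * (2^-1 * 0 ^+ 2)
     - 2 * l * (q + t / 2 * q ^+ 2 - alpha / 2 * (q * 0)) =
     (l * q - 2^-1 * (t * q + 2)) ^+ 2 by field.
exact: sqr_ge0.
Qed.

(** [dissipated_square_ge0] is integrated over []y a, y b]]. The part [H - A] of the gap that this
    integral misses is singular and not dissipated; it contributes [(l - t / 2)^2 (H - A)],
    nonnegative by [sqr_le_gap]. Taking [l = 0] gives monotonicity of [y(t)], and taking both signs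
    of [l] the bound on the absolute increment of [U(t)]. *)
Lemma evol_hoelder t l a b : 0 <= t -> a <= b ->
  2 * l * (evolU alpha X t b - evolU alpha X t a) <=
  l ^+ 2 * ((b - y b) - (a - y a)) + (evoly alpha X t b - evoly alpha X t a).
Proof.
move=> t0 ab; have [-> ->] := evol_increments t0 ab.
have S0 := sqr_le_gap ab.
set H := (b - y b) - (a - y a) in S0 *.
pose J : set (measurableTypeR R) := `]y a, y b]%classic.
have mJ : measurable J by exact: measurable_itv.
have ip : leb.-integrable J (EFin \o p) := integrable_itv_profile (y a) (y b).
have ip2 : leb.-integrable J (EFin \o (fun x => p x ^+ 2)).
  exact: integrableS (profile_integrable_sqr P).
have i1 : leb.-integrable J (EFin \o loss1 t \o p) by exact: (integrable_loss1 P t0 mJ).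
have i2 : leb.-integrable J (EFin \o loss2 t \o p) by exact: (integrable_loss2 P t0 mJ).
have ic : leb.-integrable J (EFin \o (fun=> 1)) := integrable_itvoc_cst _ _ _.
have := Rintegral_ge0 leb (D := J) (fun x _ => dissipated_square_ge0 t l (p x)).
have -> : \int[leb]_(x in J) (l ^+ 2 * p x ^+ 2 + 1 + t * p x + t ^+ 2 / 4 * p x ^+ 2
    - alpha / 2 * loss2 t (p x)
    - 2 * l * (p x + t / 2 * p x ^+ 2 - alpha / 2 * loss1 t (p x))) =
   \int[leb]_(x in J) (1 + ((l ^+ 2 + t ^+ 2 / 4 - l * t) * p x ^+ 2 +
      ((t - 2 * l) * p x + (l * alpha * loss1 t (p x) + (- (alpha / 2)) * loss2 t (p x))))).
  by apply: eq_Rintegral => x _; field.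
have j1 := integrableZl mJ (l * alpha) i1.
have j2 := integrableZl mJ (- (alpha / 2)) i2.
have jp := integrableZl mJ (t - 2 * l) ip.
have jp2 := integrableZl mJ (l ^+ 2 + t ^+ 2 / 4 - l * t) ip2.
have j12 := integrableD mJ j1 j2.
have jp12 := integrableD mJ jp j12.
rewrite RintegralD//; last exact: (integrableD mJ jp2 jp12).
have cE : \int[leb]_(x in J) 1 = 1 * (y b - y a) by rewrite Rintegral_cst_itvoc// yh.
rewrite RintegralD// RintegralD// RintegralD// cE.
rewrite (RintegralZl (l * alpha) mJ i1) (RintegralZl (- (alpha / 2)) mJ i2).
rewrite (RintegralZl (t - 2 * l) mJ ip) (RintegralZl (l ^+ 2 + t ^+ 2 / 4 - l * t) mJ ip2).
rewrite -/J in S0 *; set A := \int[leb]_(x in J) (p x ^+ 2) in S0 *.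
set B := \int[leb]_(x in J) p x; set C := \int[leb]_(x in J) (loss1 t \o p) x.
set D := \int[leb]_(x in J) (loss2 t \o p) x.
move=> h; rewrite -subr_ge0.
have -> : l ^+ 2 * H + (y b - y a + t * B + H * t ^+ 2 / 4 - alpha * D / 2) -
    2 * l * (B + H * t / 2 - alpha * C / 2) =
  (l - t / 2) ^+ 2 * (H - A) + (1 * (y b - y a) +
     ((l ^+ 2 + t ^+ 2 / 4 - l * t) * A + ((t - 2 * l) * B + (l * alpha * C + - (alpha / 2) * D)))) by field.
by rewrite addr_ge0// mulr_ge0 ?sqr_ge0// subr_ge0.
Qed.

Lemma evoly_homo t a b : 0 <= t -> a <= b -> evoly alpha X t a <= evoly alpha X t b.
Proof.
move=> t0 ab; have := evol_hoelder 0 t0 ab.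
by rewrite mulr0 mul0r expr0n mul0r add0r subr_ge0.
Qed.

Lemma evol_hoelder_abs t l a b : 0 <= t -> 0 < l ->
  2 * l * `|evolU alpha X t b - evolU alpha X t a| <=
  l ^+ 2 * G + `|evoly alpha X t b - evoly alpha X t a|.
Proof.
move=> t0 l0; apply: increment_bound_sym => {}a {}b ab.
have hG : l ^+ 2 * ((b - y b) - (a - y a)) <= l ^+ 2 * G.
  apply: ler_wpM2l; first exact: sqr_ge0.
  by have /andP[_ +] := ginv_gap_bounds cF b; have /andP[+ _] := ginv_gap_bounds cF a; lra.
have h1 := evol_hoelder l t0 ab; have h2 := evol_hoelder (- l) t0 ab.
rewrite sqrrN in h2.
exact: norm_le_of_signed h1 h2 hG.
Qed.

(** Young's inequality [2 |p| <= l p^2 + 1 / l]. The weight [l] is 1 inside a cell and [t + 1] for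
    the growth at infinity. *)
Lemma profile_u_increment l a b : 0 < l -> a <= b ->
  2 * `|u b - u a| <= l * \int[leb]_(x in `]a, b]) (p x ^+ 2) + (b - a) / l.
Proof.
move=> l0 ab; rewrite (profile_u P)//.
have ip := integrable_itv_profile a b.
have ip2 : leb.-integrable `]a, b] (EFin \o (fun x => p x ^+ 2)).
  exact: integrableS (profile_integrable_sqr P).
have mJ : measurable (`]a, b]%classic : set (measurableTypeR R)) by exact: measurable_itv.
have h1 := integrableZl mJ l ip2.
have h2 := integrable_itvoc_cst a b l^-1.
have : 2 * \int[leb]_(x in `]a, b]) `|p x| <=
    \int[leb]_(x in `]a, b]) (l * p x ^+ 2 + l^-1).
  rewrite -RintegralZl//; last exact: integrable_norm.
  apply: le_Rintegral => //.
  - exact: (integrableZl mJ 2 (integrable_norm ip)).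
  - exact: (integrableD mJ h1 h2).
  - move=> x _; rewrite -[p x ^+ 2]real_normK ?num_real// -subr_ge0.
    have -> : l * `|p x| ^+ 2 + l^-1 - 2 * `|p x| = l^-1 * (l * `|p x| - 1) ^+ 2.
      by field; rewrite gt_eqF.
    by rewrite mulr_ge0 ?sqr_ge0// invr_ge0 ltW.
rewrite RintegralD// RintegralZl// Rintegral_cst_itvoc// [_ / l]mulrC; apply: le_trans.
by rewrite ler_pM2l//; apply: le_normr_Rintegral.
Qed.

Lemma profile_u_growth l x : 0 < l -> 2 * `|u x - u 0| <= l * G + `|x| / l.
Proof.
move=> l0.
have sq a b : \int[leb]_(x in `]a, b]) (p x ^+ 2) <= G.
  apply: le_trans (profile_sqr_le P).
  apply: (@ge0_Rintegral_subset R) => //; first exact: (profile_integrable_sqr P).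
  by move=> z; exact: sqr_ge0.
have lsq a b : l * \int[leb]_(x in `]a, b]) (p x ^+ 2) <= l * G.
  by rewrite ler_pM2l.
have [x0|/ltW x0] := leP 0 x.
  rewrite (ger0_norm x0); have := profile_u_increment l0 x0; rewrite subr0.
  by have := lsq 0 x; lra.
rewrite distrC (ler0_norm x0); have := profile_u_increment l0 x0; rewrite sub0r.
by have := lsq x 0; lra.
Qed.

(** This serves the intermediate value theorem. By [p <= 1 + p^2] the integral of [p] is at most the
    sum of the increments of [y] and of the gap, which is [b - a]. *)
Lemma evoly_lipschitz t a b : 0 <= t -> a <= b ->
  `|evoly alpha X t b - evoly alpha X t a| <= (1 + 2 * t + t ^+ 2 / 4) * (b - a).
Proof.
move=> t0 ab; rewrite ger0_norm ?subr_ge0 ?evoly_homo//.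
have [_ ->] := evol_increments t0 ab.
have S0 := sqr_le_gap ab.
have yab := yh ab; have yl := ginv_lipschitz cF ab.
pose J : set (measurableTypeR R) := `]y a, y b]%classic.
have mJ : measurable J by exact: measurable_itv.
have ip2 : leb.-integrable J (EFin \o (fun x => p x ^+ 2)).
  exact: integrableS (profile_integrable_sqr P).
have ic : leb.-integrable J (EFin \o (fun=> 1)) := integrable_itvoc_cst _ _ _.
have pB : \int[leb]_(x in J) p x <= y b - y a + \int[leb]_(x in J) (p x ^+ 2).
  have -> : y b - y a = \int[leb]_(x in J) 1 by rewrite Rintegral_cst_itvoc ?mul1r.
  rewrite -RintegralD//; apply: le_Rintegral => //.
  - exact: integrable_itv_profile.
  - exact: (integrableD mJ ic ip2).
  - by move=> x _; have := sqr_ge0 (p x - 2^-1); rewrite sqrrB; have := sqr_ge0 (p x); lra.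
have D0 : 0 <= alpha * \int[leb]_(x in J) loss2 t (p x).
  move: alpha01 => /andP[a0 _]; apply: mulr_ge0 => //.
  by apply: Rintegral_ge0 => x _; exact: loss2_ge0.
have tB := ler_wpM2l t0 pB.
have tS := ler_wpM2l t0 S0.
have yl' := ler_wpM2l t0 yl.
have t2 : 0 <= t ^+ 2 by exact: sqr_ge0.
have yab' := ler_wpM2l t2 (ltac:(lra) : 0 <= y b - y a).
have tyab := ler_wpM2l t0 (ltac:(lra) : 0 <= y b - y a).
rewrite -/J in S0 tS *.
move: D0 tB tS yl' yab' tyab S0.
set A := Rintegral _ _ _; set B := Rintegral _ _ _; set D := Rintegral _ _ _.
by move: (t ^+ 2) => t2'; lra.
Qed.

Lemma evoly_continuous t : 0 <= t -> continuous (evoly alpha X t).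
Proof.
move=> t0; apply: (@lipschitz_continuous _ (1 + 2 * t + t ^+ 2 / 4)).
  by have := sqr_ge0 t; lra.
by move=> a b ab; exact: evoly_lipschitz.
Qed.

(** A profile carries no bound on [u]. The growth estimate with weight [t + 1] bounds [t |u x|] by a
    constant plus [|x| / 2], and this slope, below 1, is enough for [y(t)] to be onto. *)
Lemma evoly_near_ginv t : 0 <= t ->
  exists C, forall xi, `|evoly alpha X t xi - y xi| <= C + `|y xi| / 2.
Proof.
move=> t0; exists (t * `|u 0| + t * (t + 1) * G / 2 + 2 * t ^+ 2 * G) => xi.
rewrite (evoly_eq E P)//.
have t1 : 0 < t + 1 by lra.
have ut : t * `|u (y xi)| <= t * `|u 0| + t * (t + 1) * G / 2 + `|y xi| / 2.
  have h1 : `|u (y xi)| <= `|u 0| + `|u (y xi) - u 0|.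
    by rewrite -{1}(subrKC (u 0) (u (y xi))) ler_normD.
  have h2 := profile_u_growth (y xi) t1.
  have h3 : t * (`|y xi| / (t + 1)) <= `|y xi|.
    rewrite mulrCA ler_piMr// ler_pdivrMr//; lra.
  have h4 : t * `|u (y xi)| <= t * (`|u 0| + ((t + 1) * G + `|y xi| / (t + 1)) / 2).
    by apply: ler_wpM2l => //; lra.
  by apply: le_trans h4 _; lra.
have i2 S : measurable S -> leb.-integrable S (EFin \o (fun x => loss2 t (p x))).
  by move=> mS; exact: (integrable_loss2 P t0 mS).
have B1 : 0 <= \int[leb]_(x in `]-oo, y xi]) loss2 t (p x).
  by apply: Rintegral_ge0 => x _; exact: loss2_ge0.
have B12 : \int[leb]_(x in `]-oo, y xi]) loss2 t (p x) <= \int[leb]_x loss2 t (p x).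
  apply: (@ge0_Rintegral_subset R) => //; first exact: (i2 _ measurableT).
  by move=> x; exact: loss2_ge0.
have B2 : \int[leb]_x loss2 t (p x) <= t ^+ 2 * G.
  apply: (@le_trans _ _ (\int[leb]_x (t ^+ 2 * p x ^+ 2))).
    apply: le_Rintegral => //.
    - exact: (i2 _ measurableT).
    - exact: (integrableZl measurableT (t ^+ 2) (profile_integrable_sqr P)).
    - by move=> x _; exact: loss2_le.
  rewrite RintegralZl//; last exact: (profile_integrable_sqr P).
  by rewrite ler_wpM2l ?sqr_ge0//; exact: (profile_sqr_le P).
have := ginv_gap_bounds cF xi => /andP[H0 HG].
move: B1 B12 B2; set B := Rintegral _ _ _; set C := Rintegral _ _ _ => B1 B12 B2.
have aBC : `|alpha * (B / 2 - C / 4)| <= t ^+ 2 * G.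
  move: alpha01 => /andP[a0 a1]; rewrite normrM ger0_norm//.
  apply: (@le_trans _ _ (1 * `|B / 2 - C / 4|)); first exact: ler_wpM2r.
  rewrite mul1r ler_norml; lra.
have Ht : `|((xi - y xi) / 2 - G / 4) * (t ^+ 2 / 2)| <= t ^+ 2 * G.
  have t2 := sqr_ge0 t; rewrite normrM (ger0_norm (ltac:(lra) : 0 <= t ^+ 2 / 2)).
  apply: (@le_trans _ _ (G * (t ^+ 2 / 2))).
    by apply: ler_wpM2r; [lra|rewrite ler_norml; lra].
  have := mulr_ge0 t2 G0; lra.
have uu : `|u (y xi) * t| <= t * `|u 0| + t * (t + 1) * G / 2 + `|y xi| / 2.
  by rewrite normrM (ger0_norm t0) mulrC.
rewrite ler_norml in aBC; rewrite ler_norml in Ht; rewrite ler_norml in uu.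
by rewrite ler_norml; lra.
Qed.

Lemma evoly_surjective t x : 0 <= t -> exists xi, evoly alpha X t xi = x.
Proof.
move=> t0; have [C hC] := evoly_near_ginv t0.
(* As [y M >= M - G], half of [y M] is at least [|C| + |x|], which absorbs [C] and still reaches
   [x]; the same [M] works at [-M]. *)
have [M ME] : exists M, M = 2 * (`|C| + `|x|) + G by eexists.
have G0' : 0 <= G := G0; have nC := ler_norm C; have C0 := normr_ge0 C.
have nx := ler_norm x; have x0 := normr_ge0 x.
have nx' : - x <= `|x| by rewrite -normrN ler_norm.
have up : x <= evoly alpha X t M.
  have h1 := hC M; have h2 := ginv_ge_id cF M.
  have y0 : 0 <= y M by lra.
  by have := (dist_half h1).1 y0; lra.
have M0 : - M <= M by clear up hC; have := G0'; lra.
have lo : evoly alpha X t (- M) <= x.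
  clear up.
  have h1 := hC (- M); have h2 := ginv_le_id cF (- M).
  have y0 : y (- M) <= 0 by lra.
  by have := (dist_half h1).2 y0; lra.
exact: (continuous_surjective_between M0 (evoly_continuous t0) lo up).
Qed.

(** The default value of [xget] in [mapM] is never taken, since [x] has a preimage by
    [evoly_surjective]. *)
Lemma sol_uP t x : 0 <= t -> exists xi,
  evoly alpha X t xi = x /\ sol_u (mapT alpha t (Eulerian u E F)) x = evolU alpha X t xi.
Proof.
move=> t0; have [xi0 hxi0] := evoly_surjective x t0.
exists (xget 0 [set xi | evoly alpha X t xi = x]); split; last reflexivity.
exact: (@xgetPex _ 0 [set xi | evoly alpha X t xi = x] (ex_intro _ xi0 hxi0)).
Qed.

End SolutionEstimates.

(** * Distance between two evolutions *)

Section Comparison.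
Variable R : realType.
Notation leb := (@lebesgue_measure R).

Lemma comparison_arith (t T e v W : R) : 0 <= t -> t <= T -> 0 <= e -> 0 <= v ->
  0 <= W ->
  v + t * (2 * e) / 2 + t * W <=
    v + T * v + 2 * e + T * e + T ^+ 2 * e + T * W + T ^+ 2 * W /\
  2 * e + t * v + t ^+ 2 * (2 * e) / 4 + t ^+ 2 * W <=
    v + T * v + 2 * e + T * e + T ^+ 2 * e + T * W + T ^+ 2 * W.
Proof.
move=> t0 tT e0 v0 W0; have T0 := le_trans t0 tT; have T20 := sqr_ge0 T.
have t2T : t ^+ 2 <= T ^+ 2 by rewrite ler_sqr ?nnegrE.
have a1 := ler_wpM2r e0 tT; have a2 := ler_wpM2r v0 tT; have a3 := ler_wpM2r W0 tT.
have b1 := ler_wpM2r e0 t2T; have b3 := ler_wpM2r W0 t2T.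
have c1 := mulr_ge0 T0 e0; have c2 := mulr_ge0 T0 v0; have c3 := mulr_ge0 T0 W0.
have d1 := mulr_ge0 T20 e0; have d3 := mulr_ge0 T20 W0.
move: a1 a2 a3 b1 b3 c1 c2 c3 d1 d3; move: (t ^+ 2) (T ^+ 2) => t2 T2; lra.
Qed.

(** Here [A], [B], [D] stand for [U(xi)], [U_1(xi)], [U_1(xi_1)], and [YA], [YB], [YD] for the
    corresponding positions, with [xi] and [xi_1] the preimages of [x]. The Hoelder inequality at
    [l = r] has a right-hand side of order [r^2], and division by [r] leaves the order [r]. *)
Lemma hoelder_combine (x e r C H A B D YA YB YD SA SD : R) : e = r ^+ 2 ->
  0 < r -> r <= 1 -> 0 <= H ->
  `|A - B| <= C * e -> `|YA - YB| <= C * e -> YA = x -> YD = x ->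
  2 * r * `|D - B| <= r ^+ 2 * H + `|YD - YB| -> SA = A -> SD = D -> `|SA - SD| <= (2 * C + H) * r.
Proof.
move=> -> r0 r1 H0 h1 dY YAx YDx; rewrite YDx -YAx => h -> ->.
have C0 := le_trans (normr_ge0 _) h1.
have C1 : 0 <= C by rewrite -(pmulr_lge0 _ (exprn_gt0 2 r0)).
have rr : r ^+ 2 <= r by rewrite expr2 ler_piMr// ltW.
have h2 := ler_wpM2l C1 rr.
have -> : A - D = (A - B) - (D - B) by ring.
apply: le_trans (ler_normB _ _) _.
have h3 : `|D - B| <= (H + C) * r / 2.
  rewrite -(ler_pM2l (mulr_gt0 (ltr0n _ 2) r0)); apply: le_trans h _.
  by apply: le_trans (lerD (lexx _) dY) _; rewrite expr2; lra.
have h4 : 0 <= C * r by rewrite mulr_ge0// ltW.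
have h5 : 0 <= H * r by rewrite mulr_ge0// ltW.
by move: h1 h2 h3 h4 h5; rewrite mulrDl; lra.
Qed.

Lemma dist3 (a b c A B C : R) : `|a| <= A -> `|b| <= B -> `|c| <= C ->
  `|a - b / 2 - c| <= A + B / 2 + C.
Proof. by rewrite !ler_norml; lra. Qed.

Lemma dist4 (a b c d A B C D : R) : `|a| <= A -> `|b| <= B -> `|c| <= C -> `|d| <= D ->
  `|a + b - c / 4 - d| <= A + B + C / 4 + D.
Proof. by rewrite !ler_norml; lra. Qed.

Lemma dist_of_increments (a b c d A B h V : R) : `|c - d| <= h ->
  a - c = A -> b - d = B -> 0 <= A <= V -> 0 <= B <= V -> `|a - b| <= h + V.
Proof.
by rewrite !ler_norml => /andP[? ?] ? ? /andP[? ?] /andP[? ?]; lra.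
Qed.

(** The map [min(., 0)] is 1-Lipschitz, and at [t r + 2] it is bounded by [t |r|] because the shift
    by 2 only reduces the negative part. The factor [|q| + |r|] is later paired with the energy. *)
Lemma loss1_lipschitz (t q r : R) : 0 <= t ->
  `|loss1 t q - loss1 t r| <= t * ((`|q| + `|r|) * `|q - r|).
Proof.
move=> t0; rewrite /loss1; set m := Num.min _ _; set n := Num.min _ _.
have mn : `|m - n| <= t * `|q - r|.
  rewrite -[X in _ <= X * _](ger0_norm t0) -normrM mulrBr /m /n.
  have -> : t * q - t * r = (t * q + 2) - (t * r + 2) by ring.
  by rewrite ler_norml; case: (ltP (t * q + 2) 0) => h1; case: (ltP (t * r + 2) 0) => h2;
    have := ler_norm (t * q + 2 - (t * r + 2));
    have := ler_norm (- (t * q + 2 - (t * r + 2))); rewrite normrN; lra.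
have n0 : `|n| <= t * `|r|.
  rewrite -[X in _ <= X * _](ger0_norm t0) -normrM /n; case: (ltP (t * r + 2) 0) => h; last by rewrite normr0.
  by rewrite (ltr0_norm h) ltr0_norm; lra.
have -> : q * m - r * n = q * (m - n) + n * (q - r) by ring.
apply: le_trans (ler_normD _ _) _; rewrite !normrM.
have h1 := ler_wpM2l (normr_ge0 q) mn.
have h2 := ler_wpM2r (normr_ge0 (q - r)) n0.
by apply: le_trans (lerD h1 h2) _; rewrite le_eqVlt; apply/orP; left; apply/eqP; ring.
Qed.

Lemma loss2_lipschitz (t q r : R) : 0 <= t ->
  `|loss2 t q - loss2 t r| <= t ^+ 2 * ((`|q| + `|r|) * `|q - r|).
Proof.
move=> t0; rewrite /loss2; set m := Num.min _ _; set n := Num.min _ _.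
have mn : `|m - n| <= t * `|q - r|.
  rewrite -[X in _ <= X * _](ger0_norm t0) -normrM mulrBr /m /n.
  have -> : t * q - t * r = (t * q + 2) - (t * r + 2) by ring.
  by rewrite ler_norml; case: (ltP (t * q + 2) 0) => h1; case: (ltP (t * r + 2) 0) => h2;
    have := ler_norm (t * q + 2 - (t * r + 2));
    have := ler_norm (- (t * q + 2 - (t * r + 2))); rewrite normrN; lra.
have b0 (s : R) : `|Num.min (t * s + 2) 0| <= t * `|s|.
  rewrite -[X in _ <= X * _](ger0_norm t0) -normrM; case: (ltP (t * s + 2) 0) => h; last by rewrite normr0.
  by rewrite (ltr0_norm h) ltr0_norm; lra.
have -> : 2^-1 * m ^+ 2 - 2^-1 * n ^+ 2 = 2^-1 * ((m + n) * (m - n)) by field.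
rewrite normrM (ger0_norm (_ : 0 <= 2^-1)) ?invr_ge0// normrM.
have mn' : `|m + n| <= t * (`|q| + `|r|).
  by rewrite mulrDr; apply: le_trans (ler_normD _ _) _; apply: lerD; exact: b0.
have h : `|m + n| * `|m - n| <= (t * (`|q| + `|r|)) * (t * `|q - r|).
  exact: ler_pM.
have h0 : 0 <= `|m + n| * `|m - n| by rewrite mulr_ge0.
have -> : t ^+ 2 * ((`|q| + `|r|) * `|q - r|) = (t * (`|q| + `|r|)) * (t * `|q - r|) by ring.
by lra.
Qed.

Variables (u p F E : R -> R) (ms : {measure set (measurableTypeR R) -> \bar R}).
Variables (N : set (measurableTypeR R)) (G : R).
Variables (u1 p1 F1 E1 : R -> R) (ms1 : {measure set (measurableTypeR R) -> \bar R}).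
Variables (N1 : set (measurableTypeR R)).
Hypothesis P : profile u p F ms N G.
Hypothesis P1 : profile u1 p1 F1 ms1 N1 G.
Notation y := (ginv F).
Notation y1 := (ginv F1).
Notation X := (mapL (Eulerian u E F)).
Notation X1 := (mapL (Eulerian u1 E1 F1)).
Let mp := profile_p P.
Let mp1 := profile_p P1.
Let cF := profile_cumulative P.
Let cF1 := profile_cumulative P1.
Let G0 : 0 <= G. Proof. exact: le_trans (cumF_ge0 cF 0) (cumF_le cF 0). Qed.

Variables (e K : R).
Hypothesis e0 : 0 < e.
Hypothesis e1 : e <= 1.
Hypothesis K0 : 0 <= K.
Hypothesis close_L2 : \int[leb]_x (p x - p1 x) ^+ 2 <= K * e ^+ 2.

(** The interval from [c] to [d] will be a cell of the grid: its length [2 dx] is at most [2 e^2],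
    and the projection agrees with [u] at its left end. *)
Hypothesis close_cell : forall xi, exists c d, [/\ c <= y xi <= d, c <= y1 xi <= d,
  d - c <= 2 * e ^+ 2, u c = u1 c &
  \int[leb]_(x in `]c, d]) (p x ^+ 2) <= K * e /\
  \int[leb]_(x in `]c, d]) (p1 x ^+ 2) <= K * e].

Section Functional.
Variables (f : R -> R) (k : R).
Hypothesis mf : measurable_fun setT f.
Hypothesis k0 : 0 <= k.
Hypothesis f0 : forall q, 0 <= f q.
Hypothesis fk : forall q, f q <= k * q ^+ 2.
Hypothesis fL : forall q r, `|f q - f r| <= k * ((`|q| + `|r|) * `|q - r|).

Let integrable_f S : measurable S -> leb.-integrable S (EFin \o (fun x => f (p x))).
Proof.
move=> mS; apply: (@integrable_dom _ _ _ leb S (fun x => f (p x)) (fun x => k * p x ^+ 2)) => //.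
- by apply: measurable_funTS; exact: measurableT_comp.
- by move=> x _; rewrite ger0_norm.
- apply: (integrableZl _ _ (integrableS _ _ _ (profile_integrable_sqr P))) => //.
Qed.

Let integrable_f1 S : measurable S -> leb.-integrable S (EFin \o (fun x => f (p1 x))).
Proof.
move=> mS; apply: (@integrable_dom _ _ _ leb S (fun x => f (p1 x)) (fun x => k * p1 x ^+ 2)) => //.
- by apply: measurable_funTS; exact: measurableT_comp.
- by move=> x _; rewrite ger0_norm.
- apply: (integrableZl _ _ (integrableS _ _ _ (profile_integrable_sqr P1))) => //.
Qed.

Lemma functional_close (S : set (measurableTypeR R)) : measurable S ->
  `|\int[leb]_(x in S) f (p x) - \int[leb]_(x in S) f (p1 x)| <= k * (2 * G + K) * e.
Proof.
move=> mS; have iS := integrable_f mS; have iS1 := integrable_f1 mS.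
rewrite -RintegralB//.
have iB := integrableB mS iS iS1.
have i2 := profile_integrable_sqr P; have i21 := profile_integrable_sqr P1.
have im : leb.-integrable setT (EFin \o (fun x => (p x - p1 x) ^+ 2)).
  apply: (@integrable_dom _ _ _ leb setT _ (fun x => 2 * p x ^+ 2 + 2 * p1 x ^+ 2)) => //.
  - by apply: measurable_funX; exact: measurable_funB.
  - move=> x _; rewrite ger0_norm ?sqr_ge0//.
    have := sqr_ge0 (p x + p1 x); rewrite sqrrB sqrrD; lra.
  - exact: (integrableD measurableT (integrableZl measurableT 2 i2)
                                   (integrableZl measurableT 2 i21)).
(* Young's inequality with weight [e] for [(|p| + |p1|) |p - p1|]: each energy contributes at most
   [G e], and the squared distance [K e^2] divided by [e] contributes [K e]. *)
pose M x : R := k * (e * p x ^+ 2 + (e * p1 x ^+ 2 + e^-1 * (p x - p1 x) ^+ 2)).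
have j2 := integrableZl measurableT e i2.
have j21 := integrableZl measurableT e i21.
have jm := integrableZl measurableT e^-1 im.
have j3 := integrableD measurableT j21 jm.
have j4 := integrableD measurableT j2 j3.
have iM : leb.-integrable setT (EFin \o M) := integrableZl measurableT k j4.
apply: le_trans (le_normr_Rintegral mS iB) _.
apply: (@le_trans _ _ (\int[leb]_(x in S) M x)).
  apply: le_Rintegral => //; first exact: integrable_norm.
    exact: integrableS iM.
  move=> x _; apply: le_trans (fL _ _) _; apply: ler_wpM2l => //.
  rewrite -[p x ^+ 2]real_normK ?num_real// -[p1 x ^+ 2]real_normK ?num_real//.
  rewrite -[(p x - p1 x) ^+ 2]real_normK ?num_real// -subr_ge0.
  move: `|p x| `|p1 x| `|p x - p1 x| => a b c.
  have -> : e * a ^+ 2 + (e * b ^+ 2 + e^-1 * c ^+ 2) - (a + b) * c =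
    e^-1 * ((e * a - c / 2) ^+ 2 + (e * b - c / 2) ^+ 2 + c ^+ 2 / 2).
    by field; rewrite gt_eqF.
  by rewrite mulr_ge0 ?invr_ge0 ?(ltW e0)// !addr_ge0 ?sqr_ge0// divr_ge0 ?sqr_ge0.
apply: (@le_trans _ _ (\int[leb]_x M x)).
  apply: (@ge0_Rintegral_subset R) => // x; rewrite mulr_ge0// !addr_ge0//.
  - by rewrite mulr_ge0 ?sqr_ge0// ltW.
  - by rewrite mulr_ge0 ?sqr_ge0// ltW.
  - by rewrite mulr_ge0 ?sqr_ge0// invr_ge0 ltW.
rewrite (RintegralZl k measurableT j4) -mulrA; apply: ler_wpM2l => //.
rewrite (RintegralD measurableT j2 j3) (RintegralD measurableT j21 jm).
rewrite (RintegralZl e measurableT i2) (RintegralZl e measurableT i21).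
rewrite (RintegralZl e^-1 measurableT im).
have h1 := ler_wpM2l (ltW e0) (profile_sqr_le P).
have h2 := ler_wpM2l (ltW e0) (profile_sqr_le P1).
have ei : 0 <= e^-1 by rewrite invr_ge0 ltW.
have h3 := ler_wpM2l ei close_L2.
have e3 : e^-1 * (K * e ^+ 2) = K * e by field; rewrite gt_eqF.
rewrite e3 in h3; lra.
Qed.

(** Both half-lines are cut at the common left end [c] of the cell. On []-oo, c]] the domains
    coincide and [functional_close] applies; the two remainders both lie between 0 and [k K e], so
    they differ by at most that. *)
Lemma functional_close_cell xi :
  `|\int[leb]_(x in `]-oo, y xi]) f (p x) - \int[leb]_(x in `]-oo, y1 xi]) f (p1 x)| <=
  k * (2 * G + 2 * K) * e.
Proof.
have [c [d [/andP[cy yd] /andP[cy1 y1d] _ _ [Kp Kp1]]]] := close_cell xi.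
have mS : measurable (`]-oo, c]%classic : set (measurableTypeR R)) by exact: measurable_itv.
have h := functional_close mS.
have s := Rintegral_itv_split cy (integrable_f measurableT).
have s1 := Rintegral_itv_split cy1 (integrable_f1 measurableT).
have cell (q : R -> R) z : z <= d -> leb.-integrable setT (EFin \o (fun x => q x ^+ 2)) ->
   leb.-integrable `]c, z] (EFin \o (fun x => f (q x))) ->
   \int[leb]_(x in `]c, d]) (q x ^+ 2) <= K * e ->
   0 <= \int[leb]_(x in `]c, z]) f (q x) <= k * (K * e).
  move=> zd iq ifq Kq; apply/andP; split; first by apply: Rintegral_ge0.
  have mz : measurable (`]c, z]%classic : set (measurableTypeR R)) by exact: measurable_itv.
  have iqz : leb.-integrable `]c, z] (EFin \o (fun x => q x ^+ 2)) by exact: integrableS iq.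
  apply: (@le_trans _ _ (\int[leb]_(x in `]c, z]) (k * q x ^+ 2))).
    by apply: le_Rintegral => //; exact: (integrableZl mz k iqz).
  rewrite RintegralZl//; apply: ler_wpM2l => //; apply: le_trans Kq.
  apply: (@ge0_Rintegral_subset R) => //.
  - by move=> x /=; rewrite !in_itv/= => /andP[-> /le_trans ->].
  - exact: integrableS iq.
  - by move=> x; exact: sqr_ge0.
have q12 := cell p (y xi) yd (profile_integrable_sqr P) (integrable_f (measurable_itv _)) Kp.
have r12 := cell p1 (y1 xi) y1d (profile_integrable_sqr P1) (integrable_f1 (measurable_itv _)) Kp1.
have -> : k * (2 * G + 2 * K) * e = k * (2 * G + K) * e + k * (K * e) by ring.
exact: (dist_of_increments h s s1 q12 r12).
Qed.

End Functional.

Variables (alpha T : R).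
Hypothesis alpha01 : 0 <= alpha <= 1.

Let loss1_close t xi : 0 <= t ->
  `|\int[leb]_(x in `]-oo, y xi]) loss1 t (p x) -
    \int[leb]_(x in `]-oo, y1 xi]) loss1 t (p1 x)| <= t * (2 * G + 2 * K) * e /\
  `|\int[leb]_x loss1 t (p x) - \int[leb]_x loss1 t (p1 x)| <= t * (2 * G + K) * e.
Proof.
move=> t0; have m : measurable_fun setT (loss1 t) by exact: measurable_loss1.
have h0 q := loss1_ge0 q t0; have h1 q := loss1_le q t0.
have h2 q r := loss1_lipschitz q r t0.
by split; [exact: functional_close_cell|exact: functional_close].
Qed.

Let loss2_close t xi : 0 <= t ->
  `|\int[leb]_(x in `]-oo, y xi]) loss2 t (p x) -
    \int[leb]_(x in `]-oo, y1 xi]) loss2 t (p1 x)| <= t ^+ 2 * (2 * G + 2 * K) * e /\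
  `|\int[leb]_x loss2 t (p x) - \int[leb]_x loss2 t (p1 x)| <= t ^+ 2 * (2 * G + K) * e.
Proof.
move=> t0; have m : measurable_fun setT (loss2 t) by exact: measurable_loss2.
have h0 q := loss2_ge0 t q; have h1 q := loss2_le q t0.
have h2 q r := loss2_lipschitz q r t0; have t20 := sqr_ge0 t.
by split; [exact: functional_close_cell|exact: functional_close].
Qed.

Let u_close xi : `|u (y xi) - u1 (y1 xi)| <= (K + 2) * e /\
  `|y xi - y1 xi| <= 2 * e.
Proof.
have [c [d [/andP[cy yd] /andP[cy1 y1d] dc ucE [Kp Kp1]]]] := close_cell xi.
have ee : e ^+ 2 <= e by rewrite expr2 ler_piMr// ltW.
split; last by rewrite ler_norml; lra.
have cell (q : R -> R) z : z <= d -> leb.-integrable setT (EFin \o (fun x => q x ^+ 2)) ->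
   \int[leb]_(x in `]c, d]) (q x ^+ 2) <= K * e ->
   \int[leb]_(x in `]c, z]) (q x ^+ 2) <= K * e.
  move=> zd iq; apply: le_trans.
  apply: (@ge0_Rintegral_subset R) => //.
  - by move=> x /=; rewrite !in_itv/= => /andP[-> /le_trans ->].
  - exact: integrableS iq.
  - by move=> x; exact: sqr_ge0.
have h1 := profile_u_increment P (ltr01 : 0 < 1 :> R) cy.
have h2 := profile_u_increment P1 (ltr01 : 0 < 1 :> R) cy1.
have h3 := cell p _ yd (profile_integrable_sqr P) Kp.
have h4 := cell p1 _ y1d (profile_integrable_sqr P1) Kp1.
have -> : u (y xi) - u1 (y1 xi) = (u (y xi) - u c) - (u1 (y1 xi) - u1 c) by rewrite ucE; ring.
apply: le_trans (ler_normB _ _) _.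
rewrite !divr1 !mul1r in h1 h2; lra.
Qed.

(** One constant for [U] and [y], with powers of [t] replaced by those of [T]: [(K + 2) (1 + T)]
    comes from the values of [u] at the two initial positions, [2 + T + T^2] from these positions,
    and the last term from the dissipated energies. *)
Definition comparison_constant : R :=
  (K + 2) * (1 + T) + 2 + T + T ^+ 2 + (T + T ^+ 2) * (2 * G + 2 * K).

(** Both profiles have the same total energy [G], so the terms in [G / 4] cancel and the gaps at
    equal [xi] differ exactly by the initial positions. *)
Lemma evol_close (t xi : R) : 0 <= t <= T ->
  `|evolU alpha X t xi - evolU alpha X1 t xi| <= comparison_constant * e /\
  `|evoly alpha X t xi - evoly alpha X1 t xi| <= comparison_constant * e.
Proof.
move=> /andP[t0 tT]; have T0 := le_trans t0 tT.
rewrite (evolU_eq E P)// (evolU_eq E1 P1)// (evoly_eq E P)// (evoly_eq E1 P1)//.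
have [a1 a2] := loss1_close xi t0; have [b1 b2] := loss2_close xi t0.
have [u_ y_] := u_close xi.
have W0 : 0 <= (2 * G + 2 * K) * e by rewrite mulr_ge0 ?addr_ge0 ?mulr_ge0// ltW.
have KeP : 0 <= K * e by rewrite mulr_ge0// ltW.
have v0 : 0 <= (K + 2) * e by rewrite mulr_ge0 ?addr_ge0// ltW.
have tu : `|t * (u (y xi) - u1 (y1 xi))| <= t * ((K + 2) * e).
  by rewrite normrM (ger0_norm t0) ler_wpM2l.
have ty : `|t * (y xi - y1 xi)| <= t * (2 * e).
  by rewrite normrM (ger0_norm t0) ler_wpM2l.
have tty : `|t ^+ 2 * (y xi - y1 xi)| <= t ^+ 2 * (2 * e).
  by rewrite normrM (ger0_norm (sqr_ge0 t)) ler_wpM2l ?sqr_ge0.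
have tKe : 0 <= t * (K * e) by exact: mulr_ge0.
have ttKe : 0 <= t ^+ 2 * (K * e) by apply: mulr_ge0 => //; exact: sqr_ge0.
have combine (A A1 B B1 s : R) : 0 <= s -> `|A - A1| <= s * (2 * G + 2 * K) * e ->
    `|B - B1| <= s * (2 * G + K) * e -> 0 <= s * (K * e) ->
    `|alpha * ((A - A1) / 2 - (B - B1) / 4)| <= s * ((2 * G + 2 * K) * e).
  move=> s0 h1 h2 h3; move: alpha01 => /andP[al0 al1].
  rewrite normrM (ger0_norm al0).
  apply: (@le_trans _ _ (1 * `|(A - A1) / 2 - (B - B1) / 4|)); first exact: ler_wpM2r.
  rewrite mul1r; move: h1 h2; rewrite !ler_norml; lra.
have c1 := combine _ _ _ _ _ t0 a1 a2 tKe.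
have c2 := combine _ _ _ _ _ (sqr_ge0 t) b1 b2 ttKe.
have -> : comparison_constant * e = (K + 2) * e + T * ((K + 2) * e) + 2 * e + T * e +
    T ^+ 2 * e + T * ((2 * G + 2 * K) * e) + T ^+ 2 * ((2 * G + 2 * K) * e).
  by rewrite /comparison_constant; ring.
have EU (U U1 Y Y1 A AT B BT : R) :
    U + ((xi - Y) / 2 - G / 4) * t - alpha * (A / 2 - AT / 4) -
    (U1 + ((xi - Y1) / 2 - G / 4) * t - alpha * (B / 2 - BT / 4)) =
    (U - U1) - t * (Y - Y1) / 2 - alpha * ((A - B) / 2 - (AT - BT) / 4) by field.
have EY (U U1 Y Y1 A AT B BT : R) :
    Y + U * t + ((xi - Y) / 2 - G / 4) * (t ^+ 2 / 2) - alpha * (A / 2 - AT / 4) -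
    (Y1 + U1 * t + ((xi - Y1) / 2 - G / 4) * (t ^+ 2 / 2) - alpha * (B / 2 - BT / 4)) =
    (Y - Y1) + t * (U - U1) - t ^+ 2 * (Y - Y1) / 4 -
    alpha * ((A - B) / 2 - (AT - BT) / 4) by field.
rewrite EU EY; clear EU EY combine a1 a2 b1 b2.
split.
  exact: le_trans (dist3 u_ ty c1) (comparison_arith t0 tT (ltW e0) v0 W0).1.
exact: le_trans (dist4 y_ tu tty c2) (comparison_arith t0 tT (ltW e0) v0 W0).2.
Qed.

Lemma sol_u_close (t r x : R) : 0 <= t <= T -> 0 < r -> r <= 1 -> e = r ^+ 2 ->
  `|sol_u (mapT alpha t (Eulerian u E F)) x - sol_u (mapT alpha t (Eulerian u1 E1 F1)) x| <=
  (2 * comparison_constant + G) * r.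
Proof.
move=> tT r0 r1 er; have t0 : 0 <= t by case/andP: tT.
have [xi [Yx Ux]] := sol_uP E P alpha01 x t0.
have [xi1 [Yx1 Ux1]] := sol_uP E1 P1 alpha01 x t0.
have [dU dY] := evol_close xi tT.
have h := evol_hoelder_abs E1 P1 alpha01 xi xi1 t0 r0.
exact: (hoelder_combine er r0 r1 G0 dU dY Yx Yx1 h Ux Ux1).
Qed.

End Comparison.

(** * The projected data *)

Section PiecewiseConstant.
Variable R : realType.
Notation leb := (@lebesgue_measure R).
Variable dx : R.
Hypothesis dx0 : 0 < dx.
Implicit Types (j k : int).

Definition node j : R := grid dx (2 * j).

Lemma nodeE j : node j = j%:~R * (2 * dx).
Proof. by rewrite /node /grid intrM; ring. Qed.

Lemma gridS j : grid dx (2 * j + 1) = node j + dx.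
Proof. by rewrite /node /grid intrD mulrDl mul1r. Qed.

Lemma gridSS j : grid dx (2 * j + 2) = node j + 2 * dx.
Proof. by rewrite /node /grid intrD mulrDl. Qed.

Lemma nodeS j : node (j + 1) = node j + 2 * dx.
Proof. by rewrite !nodeE intrD mulrDl mul1r. Qed.

Lemma node_le j k : (node j <= node k) = (j <= k).
Proof. by rewrite !nodeE ler_pM2r ?ler_int// mulr_gt0. Qed.

Lemma cell_itv x : node (cell dx x) < x <= node (cell dx x) + 2 * dx.
Proof.
have d2 : 0 < 2 * dx by rewrite mulr_gt0.
rewrite -nodeS /cell subrK !nodeE -ltr_pdivlMr// -ler_pdivrMr//.
exact: ceil_itv.
Qed.

Lemma cell_unique j x : node j < x <= node j + 2 * dx -> cell dx x = j.
Proof.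
have d2 : 0 < 2 * dx by rewrite mulr_gt0.
rewrite -nodeS !nodeE -ltr_pdivlMr// -ler_pdivrMr// => h.
by rewrite /cell (@ceil_def _ _ (j + 1)) ?addrK.
Qed.

Definition pw (c1 c2 : int -> R) x : R :=
  if x <= node (cell dx x) + dx then c1 (cell dx x) else c2 (cell dx x).

Lemma pw_left (c1 c2 : int -> R) j x : node j < x <= node j + dx -> pw c1 c2 x = c1 j.
Proof.
move=> /andP[h1 h2]; have h : cell dx x = j by apply: cell_unique; rewrite h1; lra.
by rewrite /pw h h2.
Qed.

Lemma pw_right (c1 c2 : int -> R) j x : node j + dx < x <= node j + 2 * dx -> pw c1 c2 x = c2 j.
Proof.
move=> /andP[h1 h2]; have h : cell dx x = j by apply: cell_unique; rewrite h2; lra.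
by rewrite /pw h leNgt h1.
Qed.

Section Primitive.
Variables (W : R -> R) (c1 c2 : int -> R).
Hypothesis W1 : forall j x, node j <= x <= node j + dx ->
  W x = W (node j) + c1 j * (x - node j).
Hypothesis W2 : forall j x, node j + dx <= x <= node j + 2 * dx ->
  W x = W (node j + dx) + c2 j * (x - (node j + dx)).
Notation q := (pw c1 c2).

(** Integrability travels with the increment: it is required to add integrals over adjacent
    intervals, and measurability of [pw] is read off from it. *)
Let Q a b := a <= b -> leb.-integrable `]a, b] (EFin \o q) /\
  W b - W a = \int[leb]_(x in `]a, b]) q x.

Let Q_cst c a b : (forall x, a < x <= b -> q x = c) ->
  (a <= b -> W b - W a = c * (b - a)) -> Q a b.
Proof.
move=> qc Wc ab; split.
  apply: (@eq_integrable _ _ _ leb `]a, b]%classic _ (EFin \o (fun=> c))) => //.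
    by move=> x; rewrite inE /= in_itv/= => /qc ->.
  exact: integrable_itvoc_cst.
rewrite Wc// -(Rintegral_cst_itvoc c ab); apply: eq_Rintegral => x.
by rewrite inE /= in_itv/= => /qc ->.
Qed.

Let Q_trans a b c : a <= b -> b <= c -> Q a b -> Q b c -> Q a c.
Proof.
move=> ab bc Qab Qbc _; have [i1 e1] := Qab ab; have [i2 e2] := Qbc bc.
have mab : measurable (`]a, b]%classic : set (measurableTypeR R)) by exact: measurable_itv.
have mbc : measurable (`]b, c]%classic : set (measurableTypeR R)) by exact: measurable_itv.
have E : `]a, c]%classic = `]a, b]%classic `|` `]b, c]%classic :> set R.
  apply/seteqP; split => x /=; rewrite !in_itv/=.
    by move=> /andP[-> ->]; have [xb|xb] := leP x b; [left|right].
  move=> [/andP[-> /= xb]|/andP[bx ->]]; first exact: le_trans bc.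
  by rewrite andbT (le_lt_trans ab).
have i : leb.-integrable `]a, c] (EFin \o q).
  have mU : measurable_fun (`]a, b]%classic `|` `]b, c]%classic : set (measurableTypeR R))
      (EFin \o q).
    by apply/measurable_funU => //; split; [exact: measurable_int i1|exact: measurable_int i2].
  rewrite E; apply/integrableP; split=> //.
  have /integrableP[m1 l1] := i1; have /integrableP[m2 l2] := i2.
  rewrite ge0_integral_setU//=.
  - exact: lte_add_pinfty.
  - apply/measurable_EFinP; apply: measurableT_comp => //; exact/measurable_EFinP.
  - by apply/disj_setPS => x /=; rewrite !in_itv/= => -[/andP[_ xb] /andP[bx _]]; lra.
split=> //; rewrite [in RHS]E Rintegral_setU//.
- by rewrite -e1 -e2; ring.
- by rewrite -E.
- by apply/disj_setPS => x /=; rewrite !in_itv/= => -[/andP[_ xb] /andP[bx _]]; lra.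
Qed.

Let Q_left j a b : node j <= a -> b <= node j + dx -> Q a b.
Proof.
move=> ja bj; apply: (@Q_cst (c1 j)) => [x /andP[ax xb]|ab].
  by apply: pw_left; rewrite (le_lt_trans ja ax) (le_trans xb bj).
have ha : node j <= a <= node j + dx by rewrite ja (le_trans ab bj).
have hb : node j <= b <= node j + dx by rewrite bj (le_trans ja ab).
by rewrite (W1 ha) (W1 hb); ring.
Qed.

Let Q_right j a b : node j + dx <= a -> b <= node j + 2 * dx -> Q a b.
Proof.
move=> ja bj; apply: (@Q_cst (c2 j)) => [x /andP[ax xb]|ab].
  by apply: pw_right; rewrite (le_lt_trans ja ax) (le_trans xb bj).
have ha : node j + dx <= a <= node j + 2 * dx by rewrite ja (le_trans ab bj).
have hb : node j + dx <= b <= node j + 2 * dx by rewrite bj (le_trans ja ab).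
by rewrite (W2 ha) (W2 hb); ring.
Qed.

Let Q_cell j a b : node j <= a -> b <= node j + 2 * dx -> Q a b.
Proof.
move=> ja bj ab; have [bm|mb] := leP b (node j + dx); first exact: (@Q_left j).
have [ma|am] := leP (node j + dx) a; first exact: (@Q_right j).
exact: (Q_trans (ltW am) (ltW mb) (Q_left ja (lexx _)) (Q_right (lexx _) bj) ab).
Qed.

Let Q_nodes j (n : nat) : Q (node j) (node (j + n%:Z)).
Proof.
elim: n => [|n IH]; first by rewrite addr0; apply: (@Q_cell j) => //; rewrite lerDl mulr_ge0// ltW.
have E : (j + n.+1%:Z = (j + n%:Z) + 1)%R by rewrite -addn1 PoszD addrA.
rewrite E; have h1 : node j <= node (j + n%:Z) by rewrite node_le lerDl.
have h2 : node (j + n%:Z) <= node (j + n%:Z + 1) by rewrite node_le lerDl.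
have h3 : node (j + n%:Z + 1) <= node (j + n%:Z) + 2 * dx by rewrite nodeS.
exact: (Q_trans h1 h2 IH (Q_cell (lexx _) h3)).
Qed.

Lemma pw_primitive a b : a <= b -> leb.-integrable `]a, b] (EFin \o q) /\
  W b - W a = \int[leb]_(x in `]a, b]) q x.
Proof.
move=> ab; have /andP[a1 a2] := cell_itv a; have /andP[b1 b2] := cell_itv b.
set j := cell dx a in a1 a2; set k := cell dx b in b1 b2.
have [kj|jk] := leP k j.
  apply: (@Q_cell j) => //; first exact: ltW.
  by apply: le_trans b2 _; rewrite lerD2r node_le.
have jk1 : j + 1 <= k by rewrite lezD1.
have [n kE] : exists n : nat, k = j + 1 + n%:Z.
  by exists (absz (k - (j + 1))%R); rewrite gez0_abs ?subr_ge0// addrC subrK.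
have h1 : node (j + 1) <= node k by rewrite node_le.
rewrite -nodeS in a2.
have Q1 : Q a (node (j + 1)) by apply: (@Q_cell j); rewrite ?nodeS// ltW.
have Q2 : Q (node (j + 1)) (node k) by rewrite kE; exact: Q_nodes.
have Q3 : Q (node k) b by apply: (@Q_cell k).
have h2 : node (j + 1) <= b by apply: le_trans h1 _; exact: ltW.
exact: (Q_trans a2 h2 Q1 (Q_trans h1 (ltW b1) Q2 Q3) ab).
Qed.

Lemma measurable_pw : measurable_fun setT q.
Proof.
have -> : setT = \bigcup_n (`]- n%:R, n%:R]%classic : set (measurableTypeR R)).
  apply/seteqP; split => // z _; exists (Num.truncn `|z|).+1 => //=.
  have /andP[_ h] := truncn_itv (normr_ge0 z).
  by rewrite in_itv/=; rewrite ltr_norml in h; case/andP: h => -> /ltW ->.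
apply/measurable_fun_bigcup => [n|n]; first exact: measurable_itv.
apply/measurable_EFinP; apply: (measurable_int leb).
by apply: (pw_primitive _).1; rewrite ge0_cp// ?oppr_le0.
Qed.

End Primitive.

End PiecewiseConstant.

Section ProjectedProfile.
Variable R : realType.
Notation leb := (@lebesgue_measure R).
Variables (u p F Fac : R -> R) (ms : {measure set (measurableTypeR R) -> \bar R}).
Variables (N : set (measurableTypeR R)) (G dx : R) (s : int -> bool).
Hypothesis P : profile u p F ms N G.
Hypothesis dx0 : 0 < dx.
Hypothesis FacE : forall x, Fac x = \int[leb]_(z in `]-oo, x[) (p z ^+ 2).
Notation L := (node dx).
Let mp := profile_p P.
Let cF := profile_cumulative P.
Let d2 : 0 < 2 * dx. Proof. by rewrite mulr_gt0. Qed.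
Let dx2 : dx < 2 * dx. Proof. by have := dx0; lra. Qed.
Let ip2 := profile_integrable_sqr P.

Definition slope j : R := Dgrid dx u j.
Definition jump j : R := (-1) ^+ s j * qgrid dx u Fac j.
Definition proj_p : R -> R :=
  pw dx (fun j => slope j - jump j) (fun j => slope j + jump j).

Lemma Fac_itv x : Fac x = \int[leb]_(z in `]-oo, x]) (p z ^+ 2).
Proof.
by rewrite FacE Rintegral_itv_bndo_bndc//; exact: integrableS ip2.
Qed.

Lemma Fac_increment a b : a <= b -> Fac b - Fac a = \int[leb]_(z in `]a, b]) (p z ^+ 2).
Proof. by move=> ab; rewrite !Fac_itv; exact: Rintegral_itv_split. Qed.

Lemma Fac_ge0 x : 0 <= Fac x.
Proof. by rewrite FacE; apply: Rintegral_ge0 => z _; exact: sqr_ge0. Qed.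

Lemma Fac_le_F x : Fac x <= F x.
Proof.
rewrite -lee_fin (profile_F P) FacE /Rintegral fineK ?leeDl//.
by apply: integrable_fin_num => //; exact: integrableS ip2.
Qed.

Lemma Fac_le x : Fac x <= \int[leb]_z (p z ^+ 2).
Proof.
rewrite FacE; apply: (@ge0_Rintegral_subset R) => // z; exact: sqr_ge0.
Qed.

Lemma slopeE j : slope j * (2 * dx) = \int[leb]_(x in `]L j, L j + 2 * dx]) p x.
Proof.
rewrite /slope /Dgrid gridSS -(profile_u P) ?lerDl ?(ltW d2)//.
by rewrite divfK// gt_eqF.
Qed.

Lemma Dgrid_FacE j : Dgrid dx Fac j * (2 * dx) =
  \int[leb]_(x in `]L j, L j + 2 * dx]) (p x ^+ 2).
Proof.
rewrite /Dgrid gridSS -Fac_increment ?lerDl ?(ltW d2)//.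
by rewrite divfK// gt_eqF.
Qed.

Lemma cell_deviation j c : \int[leb]_(x in `]L j, L j + 2 * dx]) (p x - c) ^+ 2 =
  2 * dx * (Dgrid dx Fac j - 2 * c * slope j + c ^+ 2).
Proof.
pose J : set (measurableTypeR R) := `]L j, L j + 2 * dx]%classic.
have mJ : measurable J by exact: measurable_itv.
have i1 : leb.-integrable J (EFin \o p) := integrable_itv_profile P _ _.
have i2 : leb.-integrable J (EFin \o (fun x => p x ^+ 2)) by exact: integrableS ip2.
have ic : leb.-integrable J (EFin \o (fun=> c ^+ 2)) := integrable_itvoc_cst _ _ _.
transitivity (\int[leb]_(x in J) (p x ^+ 2 + ((- (2 * c)) * p x + c ^+ 2))).
  by apply: eq_Rintegral => x _; ring.
have j1 := integrableZl mJ (- (2 * c)) i1.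
rewrite (RintegralD mJ i2 (integrableD mJ j1 ic)) (RintegralD mJ j1 ic).
rewrite (RintegralZl (- (2 * c)) mJ i1) -slopeE -Dgrid_FacE.
have -> : \int[leb]_(x in J) (c ^+ 2) = c ^+ 2 * (2 * dx).
  by rewrite Rintegral_cst_itvoc ?lerDl ?(ltW d2)//; congr (_ * _); ring.
by ring.
Qed.

(** The radicand of [qgrid] is the variance of [p] on the cell, namely [cell_deviation] at the mean,
    so the square root does not truncate; the sign disappears in the square. *)
Lemma jump_sqr j : jump j ^+ 2 = Dgrid dx Fac j - slope j ^+ 2.
Proof.
rewrite /jump exprMn sqrr_sign mul1r sqr_sqrtr//.
have := cell_deviation j (slope j).
have h : 0 <= \int[leb]_(x in `]L j, L j + 2 * dx]) (p x - slope j) ^+ 2.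
  by apply: Rintegral_ge0 => x _; exact: sqr_ge0.
move=> E; rewrite E pmulr_rge0// in h.
by move: h; rewrite /slope => h; lra.
Qed.

Lemma cell_node j : cell dx (L (j + 1)) = j.
Proof. by apply: cell_unique => //; rewrite nodeS lexx andbT ltrDl. Qed.

Lemma proj_u_node j : proj_u dx s u Fac (L j) = u (L j).
Proof.
(* Cells are open on the left, so the node of index [j] is the right end of cell [j - 1]. *)
rewrite -(subrK 1 j) /proj_u cell_node gridS gridSS -nodeS ifF; last first.
  by rewrite nodeS; apply/negbTE; rewrite -ltNge ltrD2l.
by rewrite subrr mulr0 addr0.
Qed.

(** With slope [c] and jump [q], the two halves of a cell carry [dx ((c - q)^2 + (c + q)^2) = 2 dx
    (c^2 + q^2)], which by [jump_sqr] is the energy of [p] on the cell. *)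
Lemma proj_Fac_node j : proj_Fac dx s u Fac (L j) = Fac (L j).
Proof.
rewrite -(subrK 1 j) /proj_Fac cell_node gridS gridSS -nodeS ifF; last first.
  by rewrite nodeS; apply/negbTE; rewrite -ltNge ltrD2l.
have h := jump_sqr (j - 1); rewrite /jump -/(slope _) in h *.
move: h; set q := _ * qgrid _ _ _ _; rewrite [in RHS]/Dgrid gridSS -nodeS => h.
have h' : 2 * dx * (q ^+ 2 + slope (j - 1) ^+ 2) = Fac (L (j - 1 + 1)) - Fac (L (j - 1)).
  by rewrite h /node; field; rewrite gt_eqF.
rewrite nodeS -/(L (j - 1)); rewrite nodeS in h'.
move: h'; set A := Fac (_ + _); set B := Fac _; set c := slope _ => h'.
have -> : A = (2 * dx * (q ^+ 2 + c ^+ 2) + B) by rewrite h' subrK.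
by field.
Qed.

Lemma proj_u_left j x : L j <= x <= L j + dx ->
  proj_u dx s u Fac x = proj_u dx s u Fac (L j) + (slope j - jump j) * (x - L j).
Proof.
move=> /andP[]; rewrite le_eqVlt => /predU1P[<-|jx] xj.
  by rewrite subrr mulr0 addr0.
have h : cell dx x = j by apply: cell_unique => //; rewrite jx; lra.
by rewrite proj_u_node {1}/proj_u h gridS xj.
Qed.

Lemma proj_u_right j x : L j + dx <= x <= L j + 2 * dx ->
  proj_u dx s u Fac x =
  proj_u dx s u Fac (L j + dx) + (slope j + jump j) * (x - (L j + dx)).
Proof.
move=> /andP[]; rewrite le_eqVlt => /predU1P[<-|jx] xj.
  by rewrite subrr mulr0 addr0.
have h : cell dx x = j by apply: cell_unique => //; rewrite xj; lra.
rewrite (@proj_u_left j (L j + dx)); last by rewrite lexx; lra.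
rewrite proj_u_node {1}/proj_u h gridS leNgt jx /= gridSS.
have := profile_u P (ltW (ltac:(rewrite ltrDl//) : L j < L j + 2 * dx)).
rewrite -slopeE => /(canRL (subrK _)) ->.
rewrite -/(slope j) -/(jump j); set c := slope j; set q := jump j; by ring.
Qed.

Lemma proj_Fac_left j x : L j <= x <= L j + dx ->
  proj_Fac dx s u Fac x =
  proj_Fac dx s u Fac (L j) + (slope j - jump j) ^+ 2 * (x - L j).
Proof.
move=> /andP[]; rewrite le_eqVlt => /predU1P[<-|jx] xj.
  by rewrite subrr mulr0 addr0.
have h : cell dx x = j by apply: cell_unique => //; rewrite jx; lra.
by rewrite proj_Fac_node {1}/proj_Fac h gridS xj.
Qed.

Lemma proj_Fac_right j x : L j + dx <= x <= L j + 2 * dx ->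
  proj_Fac dx s u Fac x =
  proj_Fac dx s u Fac (L j + dx) + (slope j + jump j) ^+ 2 * (x - (L j + dx)).
Proof.
move=> /andP[]; rewrite le_eqVlt => /predU1P[<-|jx] xj.
  by rewrite subrr mulr0 addr0.
have h : cell dx x = j by apply: cell_unique => //; rewrite xj; lra.
rewrite (@proj_Fac_left j (L j + dx)); last by rewrite lexx; lra.
rewrite proj_Fac_node {1}/proj_Fac h gridS leNgt jx /= gridSS -/(L j).
rewrite -/(slope j) -/(jump j).
have : Fac (L j + 2 * dx) = Fac (L j) + 2 * dx * (jump j ^+ 2 + slope j ^+ 2).
  rewrite jump_sqr subrK [_ * Dgrid _ _ _]mulrC Dgrid_FacE -Fac_increment.
    by rewrite addrCA subrr addr0.
  by rewrite lerDl ltW.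
by move=> ->; set c := slope j; set q := jump j; field.
Qed.

Lemma proj_p_sqr x : proj_p x ^+ 2 =
  pw dx (fun j => (slope j - jump j) ^+ 2) (fun j => (slope j + jump j) ^+ 2) x.
Proof. by rewrite /proj_p /pw; case: ifP. Qed.

Lemma measurable_proj_p : measurable_fun setT proj_p.
Proof. exact: (measurable_pw dx0 proj_u_left proj_u_right). Qed.

Lemma proj_u_increment a b : a <= b ->
  proj_u dx s u Fac b - proj_u dx s u Fac a = \int[leb]_(x in `]a, b]) proj_p x.
Proof. by move=> ab; have [] := pw_primitive dx0 proj_u_left proj_u_right ab. Qed.

Lemma proj_Fac_increment a b : a <= b ->
  (\int[leb]_(x in `]a, b]) (proj_p x ^+ 2)%:E)%E =
  (proj_Fac dx s u Fac b - proj_Fac dx s u Fac a)%:E.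
Proof.
move=> ab; have [i ->] := pw_primitive dx0 proj_Fac_left proj_Fac_right ab.
rewrite /Rintegral fineK; last by apply: integrable_fin_num.
by apply: eq_integral => x _; rewrite proj_p_sqr.
Qed.

Lemma proj_Fac_homo : {homo proj_Fac dx s u Fac : a b / a <= b}.
Proof.
move=> a b ab; rewrite -subr_ge0 -lee_fin -proj_Fac_increment//.
by apply: integral_ge0 => x _; rewrite lee_fin sqr_ge0.
Qed.

Lemma proj_Fac_ge0 x : 0 <= proj_Fac dx s u Fac x.
Proof.
apply: le_trans (Fac_ge0 (L (cell dx x))) _; rewrite -proj_Fac_node.
by apply: proj_Fac_homo; apply: ltW; have /andP[] := cell_itv dx0 x.
Qed.

Lemma proj_Fac_cell x :
  Fac (L (cell dx x)) <= proj_Fac dx s u Fac x <= Fac (L (cell dx x + 1)).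
Proof.
have /andP[h1 h2] := cell_itv dx0 x; rewrite -nodeS in h2.
by rewrite -!proj_Fac_node !proj_Fac_homo// ltW.
Qed.

Lemma integral_proj_p_sqr x :
  (\int[leb]_(z in `]-oo, x]) (proj_p z ^+ 2)%:E)%E = (proj_Fac dx s u Fac x)%:E.
Proof.
apply: (@ge0_integral_itvNy _ (fun z => proj_p z ^+ 2) (proj_Fac dx s u Fac)).
- by apply: measurable_funX; exact: measurable_proj_p.
- by move=> z; exact: sqr_ge0.
- exact: proj_Fac_increment.
- exact: proj_Fac_ge0.
- move=> e e0; have [x0 hx0] := profile_F_Ny P e0.
  exists (x0 - 2 * dx) => z zx0; have /andP[_ h] := proj_Fac_cell z.
  apply: le_lt_trans h _; apply: le_lt_trans (Fac_le_F _) _; apply: hx0.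
  have /andP[h1 _] := cell_itv dx0 z; rewrite nodeS.
  by rewrite -lerBrDr; apply: le_trans zx0; exact: ltW.
Qed.

Lemma integral_proj_p_sqrT :
  (\int[leb]_z (proj_p z ^+ 2)%:E = \int[leb]_z (p z ^+ 2)%:E)%E.
Proof.
have <- : ((\int[leb]_z (p z ^+ 2))%:E = \int[leb]_z (p z ^+ 2)%:E)%E.
  by rewrite /Rintegral fineK//; exact: integrable_fin_num ip2.
apply: (@ge0_integral_itvT _ (fun z => proj_p z ^+ 2) (proj_Fac dx s u Fac)).
- by apply: measurable_funX; exact: measurable_proj_p.
- by move=> z; exact: sqr_ge0.
- exact: integral_proj_p_sqr.
- by move=> x; have /andP[_ h] := proj_Fac_cell x; apply: le_trans h (Fac_le _).
- move=> e e0; have [x0 hx0] := ge0_Rintegral_tail ip2 (fun x => sqr_ge0 (p x)) e0.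
  exists (x0 + 2 * dx) => z zx0; have /andP[h _] := proj_Fac_cell z.
  apply: lt_le_trans h; rewrite Fac_itv; apply: hx0.
  have /andP[_ h2] := cell_itv dx0 z.
  by rewrite -(lerD2r (2 * dx)); exact: le_trans h2.
Qed.

End ProjectedProfile.

(** * The projected data as a profile *)

Section ProjectedMeasure.
Variable R : realType.
Notation leb := (@lebesgue_measure R).
Variables (u p F Fac : R -> R) (ms : {measure set (measurableTypeR R) -> \bar R}).
Variables (N : set (measurableTypeR R)) (G dx : R) (s : int -> bool).
Hypothesis P : profile u p F ms N G.
Hypothesis dx0 : 0 < dx.
Hypothesis FacE : forall x, Fac x = \int[leb]_(z in `]-oo, x[) (p z ^+ 2).
Notation L := (node dx).
Let mp := profile_p P.
Let cF := profile_cumulative P.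
Let ip2 := profile_integrable_sqr P.
Let d2 : 0 < 2 * dx. Proof. by rewrite mulr_gt0. Qed.
Notation p1 := (proj_p u Fac dx s).

(** The singular part of the projection is the image of [ms] under this map. Distribution functions
    count the open half-line []-oo, x[], so the step function that equals [Fsing] at [x_2j+2] on
    []x_2j, x_2j+2]] moves the mass of [[x_2j, x_2j+2[] to [x_2j]: hence the floor here, whereas
    [cell] uses the ceiling. *)
Definition snap (z : R) : R := L (Num.floor (z / (2 * dx))).

Lemma snap_itv z : snap z <= z < snap z + 2 * dx.
Proof.
rewrite /snap -nodeS !nodeE -ler_pdivlMr// -ltr_pdivrMr//.
exact: floor_itv.
Qed.

Lemma node_lt_succ j k : (L j < L (k + 1)) = (L j <= L k).
Proof. by rewrite node_le// ltNge node_le// -ltNge ltzD1. Qed.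

Lemma snap_lt z x : (snap z < x) = (z < L (cell dx x + 1)).
Proof.
have /andP[s1 s2] := snap_itv z; have /andP[c1 c2] := cell_itv dx0 x.
rewrite -nodeS in c2; rewrite /snap -nodeS in s1 s2 *.
apply/idP/idP => h.
  have : L (Num.floor (z / (2 * dx))) < L (cell dx x + 1) by exact: lt_le_trans c2.
  rewrite node_lt_succ node_le// => h'.
  by apply: lt_le_trans s2 _; rewrite node_le// lerD2r.
apply: le_lt_trans c1; rewrite -node_lt_succ; exact: le_lt_trans h.
Qed.

Lemma measurable_snap : measurable_fun setT (snap : measurableTypeR R -> measurableTypeR R).
Proof.
apply: nondecreasing_measurable => // a b ab.
rewrite /snap node_le//; apply: le_floor.
by rewrite ler_pdivrMr// divfK// gt_eqF.
Qed.

Lemma snap_measure_exists : exists ms1 : {measure set (measurableTypeR R) -> \bar R},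
  forall A, ms1 A = ms (snap @^-1` A).
Proof.
unshelve eexists (pushforward ms (snap : measurableTypeR R -> measurableTypeR R)).
  exact: measurable_snap.
by [].
Qed.

Definition proj_F x : R := proj_Fac dx s u Fac x + proj_Fsing dx F Fac x.

Lemma singular_part x : (F x - Fac x)%:E = ms `]-oo, x[%classic.
Proof.
rewrite EFinB (profile_F P) FacE /Rintegral fineK.
  rewrite addeAC subee ?add0e//.
  by apply: integrable_fin_num => //; exact: integrableS ip2.
by apply: integrable_fin_num => //; exact: integrableS ip2.
Qed.

(** The new singular measure is carried by the nodes, a countable and hence null set. The total
    energy [G] is unchanged, and all results on profiles become available for the projection. *)
Lemma profile_projection : exists ms1 N1, profile (proj_u dx s u Fac) p1 proj_F ms1 N1 G.
Proof.
have [ms1 ms1E] := snap_measure_exists.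
pose N1 : set (measurableTypeR R) := range L.
have cN1 : countable N1 by exact: (card_le_trans (card_image_le _ _) (countableP _)).
have mN1 : measurable N1 by exact: countable_measurable.
exists ms1, N1; split.
- exact (measurable_proj_p Fac s P dx0).
- by move=> a b ab; rewrite (proj_u_increment Fac s P dx0 ab).
- move=> x; rewrite (_ : (\int[leb]_(z in `]-oo, x[) _)%E = (proj_Fac dx s u Fac x)%:E).
    rewrite ms1E (_ : _ @^-1` _ = `]-oo, L (cell dx x + 1)[%classic).
      rewrite -singular_part -EFinD /proj_F /proj_Fsing; congr (_ + (F _ - Fac _))%:E.
      + by rewrite gridSS nodeS.
      + by rewrite gridSS nodeS.
    by apply/seteqP; split => z /=; rewrite !in_itv/= snap_lt.
  rewrite -(integral_proj_p_sqr s P dx0 FacE) integral_itv_bndo_bndc//.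
  apply/measurable_EFinP; apply: measurable_funTS; apply: measurable_funX.
  exact (measurable_proj_p Fac s P dx0).
- by rewrite (integral_proj_p_sqrT s P dx0 FacE) ms1E preimage_setT (profile_G P).
- exact: mN1.
- exact: countable_lebesgue_measure0.
- rewrite ms1E (_ : _ @^-1` _ = set0) ?measure0//.
  apply/seteqP; split => // z /=; apply.
  by exists (Num.floor (z / (2 * dx))).
Qed.

Lemma proj_F_node j : proj_F (L j) = F (L j).
Proof.
rewrite /proj_F (proj_Fac_node s P dx0 FacE) -(subrK 1 j) /proj_Fsing cell_node//.
by rewrite gridSS -nodeS addrCA subrr addr0.
Qed.

(* F and its projection agree at the nodes. *)
Lemma ginv_same_cell xi : exists j,
  L j <= ginv F xi < L (j + 1) /\ L j <= ginv proj_F xi < L (j + 1).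
Proof.
have [ms1 [N1 P1]] := profile_projection; have cF1 := profile_cumulative P1.
exists (Num.floor (ginv F xi / (2 * dx))).
set j := Num.floor _.
have : L j <= ginv F xi < L (j + 1) by rewrite nodeS; exact: snap_itv.
by rewrite !(ginv_ge cF) !(ginv_lt cF) !(ginv_ge cF1) !(ginv_lt cF1) !proj_F_node.
Qed.

Lemma proj_p_cell_energy j : \int[leb]_(x in `]L j, L (j + 1)]) (p1 x ^+ 2) =
  \int[leb]_(x in `]L j, L (j + 1)]) (p x ^+ 2).
Proof.
have h : L j <= L (j + 1) by rewrite node_le// lerDl.
rewrite -(Fac_increment P FacE h) {1}/Rintegral (proj_Fac_increment s P dx0 FacE h) /=.
by rewrite !(proj_Fac_node s P dx0 FacE).
Qed.

(** On the cell [p1] takes the values [a - b] and [a + b], with mean [a] and jump [b]. Either way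
    the left-hand side is at most [2 ((a - c)^2 + b^2)], and since [b^2] is the variance of [p],
    this is the integral on the right divided by [dx], whatever the sign. *)
Lemma proj_p_deviation x c : (c - p1 x) ^+ 2 <=
  dx^-1 * \int[leb]_(z in `]L (cell dx x), L (cell dx x) + 2 * dx]) (p z - c) ^+ 2.
Proof.
rewrite (cell_deviation P dx0 FacE); set j := cell dx x.
have J := jump_sqr s P dx0 FacE j.
have -> : dx^-1 * (2 * dx * (Dgrid dx Fac j - 2 * c * slope u dx j + c ^+ 2)) =
    2 * ((slope u dx j - c) ^+ 2 + jump u Fac dx s j ^+ 2).
  by rewrite J; field; rewrite gt_eqF.
rewrite /proj_p /pw -/j; move: (slope u dx j) (jump u Fac dx s j) => a b.
case: ifP => _.
  have -> : (c - (a - b)) ^+ 2 = 2 * ((a - c) ^+ 2 + b ^+ 2) - (a - c + b) ^+ 2 by ring.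
  by rewrite gerBl sqr_ge0.
have -> : (c - (a + b)) ^+ 2 = 2 * ((a - c) ^+ 2 + b ^+ 2) - (a - c - b) ^+ 2 by ring.
by rewrite gerBl sqr_ge0.
Qed.

End ProjectedMeasure.

(** * Error of the projection *)

Section TranslationModulus.
Variable R : realType.
Notation leb := (@lebesgue_measure R).
Variables (p : R -> R).
Hypothesis mp : measurable_fun setT p.

Definition shift_sqr (h x : R) : R := (p (x + h) - p x) ^+ 2.

Lemma measurable_shift_sqr2 : measurable_fun setT
  (fun z : measurableTypeR R * measurableTypeR R => shift_sqr z.2 z.1).
Proof.
apply: measurable_funX; apply: measurable_funB; last exact: measurableT_comp.
by apply: measurableT_comp mp _; apply: measurable_funD.
Qed.

Lemma measurable_shift_sqr h : measurable_fun setT (shift_sqr h).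
Proof.
apply: measurable_funX; apply: measurable_funB => //.
by apply: measurableT_comp mp _; apply: measurable_funD.
Qed.

Lemma measurable_shift_sqr' x : measurable_fun setT (fun h => shift_sqr h x).
Proof.
apply: measurable_funX; apply: measurable_funB => //.
by apply: measurableT_comp mp _; apply: measurable_funD.
Qed.

Lemma shift_sqr_ge0 h x : 0 <= shift_sqr h x.
Proof. exact: sqr_ge0. Qed.

Lemma tonelli_shift (I : set (measurableTypeR R)) : measurable I ->
  measurable_fun setT (fun x => \int[leb]_(h in I) (shift_sqr h x)%:E)%E /\
  (\int[leb]_x \int[leb]_(h in I) (shift_sqr h x)%:E =
   \int[leb]_(h in I) \int[leb]_x (shift_sqr h x)%:E)%E.
Proof.
move=> mI.
pose phi := (fun z : measurableTypeR R * measurableTypeR R =>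
  (shift_sqr z.2 z.1)%:E) \_ (setT `*` I).
have phi0 z : (0 <= phi z)%E.
  by apply: erestrict_ge0 => ? _; rewrite lee_fin shift_sqr_ge0.
have mphi : measurable_fun setT phi.
  apply/(measurable_restrictT _ _).1; first exact: measurableX.
  by apply: measurable_funTS; apply/measurable_EFinP; exact: measurable_shift_sqr2.
have phiE x h : phi (x, h) = if h \in I then (shift_sqr h x)%:E else 0%E.
  by rewrite /phi patchE in_setX/= in_setT.
have F1 x : (\int[leb]_h phi (x, h) = \int[leb]_(h in I) (shift_sqr h x)%:E)%E.
  rewrite [RHS]integral_mkcond; apply: eq_integral => h _.
  by rewrite phiE patchE.
have F2 : (\int[leb]_h (\int[leb]_x phi (x, h)) =
    \int[leb]_(h in I) (\int[leb]_x (shift_sqr h x)%:E))%E.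
  rewrite [RHS]integral_mkcond; apply: eq_integral => h _; rewrite patchE.
  case: ifPn => hI; last by apply: integral0_eq => x _; rewrite phiE (negbTE hI).
  by apply: eq_integral => x _; rewrite phiE hI.
have mF := measurable_fun_fubini_tonelli_F (m2 := leb) phi mphi phi0.
split.
  rewrite (_ : (fun x => _) = fubini_F leb phi) //.
  by apply/funext => x; rewrite /fubini_F -F1.
rewrite -F2 -(fubini_tonelli phi mphi phi0).
by apply: eq_integral => x _; rewrite F1.
Qed.

Variables (l b : R).
Hypothesis l0 : 0 < l.
Hypothesis modulus : forall h, 0 < h <= l ->
  (\int[leb]_x (shift_sqr h x)%:E <= b%:E)%E.

Let b0 : 0 <= b.
Proof.
have := modulus (ltac:(by rewrite l0 lexx) : 0 < l <= l).
rewrite -lee_fin; apply: le_trans.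
by apply: integral_ge0 => x _; rewrite lee_fin shift_sqr_ge0.
Qed.

Lemma modulus_sym h : - l <= h <= l -> (\int[leb]_x (shift_sqr h x)%:E <= b%:E)%E.
Proof.
move=> /andP[lh hl]; have [h0|h0|->] := ltgtP h 0; last first.
- under eq_integral do rewrite /shift_sqr addr0 subrr expr0n.
  by rewrite integral0 lee_fin.
- by apply: modulus; rewrite h0.
rewrite -(ge0_integral_translate (- h)).
- under eq_integral do rewrite /shift_sqr subrK -sqrrN opprB.
  by apply: modulus; rewrite oppr_gt0 h0 lerNl.
- by apply/measurable_EFinP; exact: measurable_shift_sqr.
- by move=> x; rewrite lee_fin shift_sqr_ge0.
Qed.

Lemma double_modulus (I : set (measurableTypeR R)) : measurable I ->
  I `<=` `[- l, l] ->
  (\int[leb]_x \int[leb]_(h in I) (shift_sqr h x)%:E <= b%:E * leb I)%E.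
Proof.
move=> mI Il; have [_ ->] := tonelli_shift mI.
rewrite -integral_cst//; apply: ge0_le_integral => //.
- by move=> h _; apply: integral_ge0 => x _; rewrite lee_fin shift_sqr_ge0.
- have mG := @measurable_fun_fubini_tonelli_G _ _ _ _ R leb (fun z : measurableTypeR R * measurableTypeR R => (shift_sqr z.2 z.1)%:E).
  apply: measurable_funTS; apply: mG.
    by apply/measurable_EFinP; exact: measurable_shift_sqr2.
  by move=> z; rewrite lee_fin shift_sqr_ge0.
- by move=> h /Il; rewrite /= in_itv/= => hl; exact: modulus_sym.
Qed.

Lemma short_interval_energy c d A : c <= d -> leb.-integrable setT (EFin \o (fun x => p x ^+ 2)) ->
  \int[leb]_x (p x ^+ 2) <= A ->
  \int[leb]_(x in `]c, d]) (p x ^+ 2) <= 2 * b + 2 / l * (d - c) * A.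
Proof.
move=> cd ip2 pA.
pose I : set (measurableTypeR R) := `]0, l]%classic.
have mI : measurable I by exact: measurable_itv.
have lI : leb I = l%:E by rewrite /I (lebesgue_measure_itvoc (ltW l0)) subr0.
pose J : set (measurableTypeR R) := `]c, d]%classic.
have mJ : measurable J by exact: measurable_itv.
have lJ : leb J = (d - c)%:E by exact: lebesgue_measure_itvoc.
have mp2 : measurable_fun setT (fun x => p x ^+ 2) by exact: measurable_funX.
have A0 : (\int[leb]_x (p x ^+ 2)%:E <= A%:E)%E.
  by rewrite -lee_fin in pA; rewrite /Rintegral fineK in pA; last exact: integrable_fin_num ip2.
(* Integration of [p(x)^2 <= 2 (p(x + h) - p(x))^2 + 2 p(x + h)^2] over [h] in []0, l]]. The last
   integral is at most the total energy, uniformly in [x], so that integrating over a short interval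
   gains its length. *)
have pt x : ((l * p x ^+ 2)%:E <=
    2%:E * \int[leb]_(h in I) (shift_sqr h x)%:E + (2 * A)%:E)%E.
  apply: (@le_trans _ _ (2%:E * \int[leb]_(h in I) (shift_sqr h x)%:E +
     2%:E * \int[leb]_(h in I) (p (x + h) ^+ 2)%:E)%E).
    have m1 : measurable_fun I (fun h => (shift_sqr h x)%:E).
      by apply: measurable_funTS; apply/measurable_EFinP; exact: measurable_shift_sqr'.
    have m2 : measurable_fun I (fun h => (p (x + h) ^+ 2)%:E).
      apply: measurable_funTS; apply/measurable_EFinP; apply: measurable_funX.
      by apply: measurableT_comp mp _; apply: measurable_funD.
    have n1 h : I h -> (0 <= (shift_sqr h x)%:E)%E by rewrite lee_fin shift_sqr_ge0.
    have n2 h : I h -> (0 <= (p (x + h) ^+ 2)%:E)%E by rewrite lee_fin sqr_ge0.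
    rewrite -ge0_integralZl// -ge0_integralZl//.
    rewrite -ge0_integralD//; last 4 first.
    - by move=> h Ih; rewrite mule_ge0//; exact: n1.
    - exact: measurable_funeM.
    - by move=> h Ih; rewrite mule_ge0//; exact: n2.
    - exact: measurable_funeM.
    have -> : (l * p x ^+ 2)%:E = (\int[leb]_(h in I) (p x ^+ 2)%:E)%E.
      by rewrite integral_cst// -[RHS]/((p x ^+ 2)%:E * leb I)%E lI -EFinM mulrC.
    apply: ge0_le_integral => //.
    - by move=> h _; rewrite lee_fin sqr_ge0.
    - by apply: emeasurable_funD; exact: measurable_funeM.
    - move=> h _; rewrite -!EFinM -EFinD lee_fin /shift_sqr -subr_ge0.
      have -> : 2 * (p (x + h) - p x) ^+ 2 + 2 * p (x + h) ^+ 2 - p x ^+ 2 =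
        (2 * p (x + h) - p x) ^+ 2 by ring.
      exact: sqr_ge0.
  rewrite leeD2l// EFinM lee_pmul2l//.
  apply: le_trans A0; rewrite -[in leRHS](ge0_integral_translate x).
  - rewrite integral_mkcond; apply: ge0_le_integral => //.
    + by move=> h _; apply: erestrict_ge0 => ? _; rewrite lee_fin sqr_ge0.
    + apply/(measurable_restrictT _ _).1 => //; apply: measurable_funTS.
      apply/measurable_EFinP; apply: measurable_funX.
      by apply: measurableT_comp mp _; apply: measurable_funD.
    + by apply/measurable_EFinP; apply: measurable_funX; apply: measurableT_comp mp _;
        apply: measurable_funD.
    + move=> h _; rewrite patchE; case: ifP => _; first by rewrite addrC.
      by rewrite lee_fin sqr_ge0.
  - exact/measurable_EFinP.
  - by move=> z; rewrite lee_fin sqr_ge0.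
have [mS _] := tonelli_shift mI.
have S0 x : (0 <= \int[leb]_(h in I) (shift_sqr h x)%:E)%E.
  by apply: integral_ge0 => h _; rewrite lee_fin shift_sqr_ge0.
have Ag0 : 0 <= A by apply: le_trans pA; apply: Rintegral_ge0 => x _; exact: sqr_ge0.
have key : ((l * \int[leb]_(x in J) (p x ^+ 2))%:E <= (2 * (b * l) + 2 * A * (d - c))%:E)%E.
  have -> : (l * \int[leb]_(x in J) (p x ^+ 2))%:E = (\int[leb]_(x in J) (l * p x ^+ 2)%:E)%E.
    have iJ : leb.-integrable J (EFin \o (fun x => p x ^+ 2)) by exact: integrableS ip2.
    rewrite -(RintegralZl l mJ iJ) /Rintegral fineK//.
    by apply: integrable_fin_num => //; exact: (integrableZl mJ l iJ).
  apply: (@le_trans _ _ (\int[leb]_(x in J)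
      (2%:E * \int[leb]_(h in I) (shift_sqr h x)%:E + (2 * A)%:E))%E).
    apply: ge0_le_integral => //.
    - by move=> x _; rewrite lee_fin mulr_ge0 ?sqr_ge0// ltW.
    - by apply/measurable_EFinP; apply: measurable_funTS; exact: measurable_funM.
    - apply: emeasurable_funD => //; apply: measurable_funeM.
      exact: measurable_funTS.
  rewrite ge0_integralD//; last 3 first.
  - by move=> x _; rewrite mule_ge0.
  - by apply: measurable_funeM; exact: measurable_funTS.
  - by move=> x _; rewrite lee_fin mulr_ge0.
  rewrite ge0_integralZl//; last exact: measurable_funTS.
  have -> : (\int[leb]_(x in J) (2 * A)%:E = (2 * A)%:E * (d - c)%:E)%E.
    by rewrite integral_cst// -[LHS]/((2 * A)%:E * leb J)%E lJ.
  rewrite [leRHS]EFinD; apply: leeD.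
    rewrite EFinM lee_pmul2l//; apply: (@le_trans _ _ (b%:E * leb I)%E).
      apply: le_trans (double_modulus mI _).
        exact: ge0_subset_integral.
      move=> h; rewrite /I /= !in_itv/= => /andP[h1 ->]; rewrite andbT.
      by rewrite (le_trans _ (ltW h1))// oppr_le0 ltW.
    by rewrite lI EFinM.
  by rewrite -EFinM.
rewrite -(ler_pM2l l0); rewrite lee_fin in key; apply: le_trans key _.
by rewrite le_eqVlt; apply/orP; left; apply/eqP; field; rewrite gt_eqF.
Qed.

End TranslationModulus.

Section ProjectionError.
Variable R : realType.
Notation leb := (@lebesgue_measure R).
Variables (u p F Fac : R -> R) (ms : {measure set (measurableTypeR R) -> \bar R}).
Variables (N : set (measurableTypeR R)) (G dx : R) (s : int -> bool).
Hypothesis P : profile u p F ms N G.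
Hypothesis dx0 : 0 < dx.
Hypothesis FacE : forall x, Fac x = \int[leb]_(z in `]-oo, x[) (p z ^+ 2).
Notation L := (node dx).
Let mp := profile_p P.
Let ip2 := profile_integrable_sqr P.
Let d2 : 0 < 2 * dx. Proof. by rewrite mulr_gt0. Qed.
Notation p1 := (proj_p u Fac dx s).
Let mp1 := measurable_proj_p Fac s P dx0.
Variable b : R.
Hypothesis modulus : forall h, 0 < h <= 2 * dx ->
  (\int[leb]_x (shift_sqr p h x)%:E <= b%:E)%E.

(** [proj_p_deviation] with [c = p x]. Points of the cell of [x] have the form [x + h] with
    [|h| <= 2 dx], which replaces the cell by a window independent of [x] and makes the bound
    integrable over translations. *)
Lemma proj_p_local x : (((p x - p1 x) ^+ 2)%:E <=
  (dx^-1)%:E * \int[leb]_(h in `[(- (2 * dx))%R, (2 * dx)%R]) (shift_sqr p h x)%:E)%E.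
Proof.
set j := cell dx x; have /andP[c1 c2] := cell_itv dx0 x; rewrite -/j in c1 c2.
pose J : set (measurableTypeR R) := `]L j, L j + 2 * dx]%classic.
have mJ : measurable J by exact: measurable_itv.
have mc : measurable_fun setT (fun z => (p z - p x) ^+ 2).
  by apply: measurable_funX; apply: measurable_funB.
have iJ : leb.-integrable J (EFin \o (fun z => (p z - p x) ^+ 2)).
  have i2 : leb.-integrable J (EFin \o (fun z => p z ^+ 2)) by exact: integrableS ip2.
  have ic : leb.-integrable J (EFin \o (fun=> 2 * p x ^+ 2)) := integrable_itvoc_cst _ _ _.
  apply: (@integrable_dom _ _ _ leb J _ (fun z => 2 * p z ^+ 2 + 2 * p x ^+ 2)) => //.
  - exact: measurable_funTS.
  - move=> z _; rewrite ger0_norm ?sqr_ge0//.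
    by have := sqr_ge0 (p z + p x); rewrite sqrrB sqrrD; lra.
  - exact: (integrableD mJ (integrableZl mJ 2 i2) ic).
apply: (@le_trans _ _ ((dx^-1)%:E * \int[leb]_(z in J) ((p z - p x) ^+ 2)%:E)%E).
  have := proj_p_deviation s P dx0 FacE x (p x); rewrite -/j -/J -lee_fin.
  have -> : (dx^-1 * \int[leb]_(z in J) (p z - p x) ^+ 2)%:E =
      ((dx^-1)%:E * \int[leb]_(z in J) ((p z - p x) ^+ 2)%:E)%E.
    rewrite EFinM; congr (_ * _)%E; rewrite /Rintegral fineK//.
    exact: integrable_fin_num iJ.
  by [].
rewrite lee_pmul2l ?lte_fin ?invr_gt0//.
rewrite integral_mkcond -(ge0_integral_translate x); last 2 first.
- apply/(measurable_restrictT _ _).1 => //; apply: measurable_funTS.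
  exact/measurable_EFinP.
- by move=> z; apply: erestrict_ge0 => ? _; rewrite lee_fin sqr_ge0.
rewrite [leRHS]integral_mkcond; apply: ge0_le_integral => //.
- by move=> h _; rewrite patchE; case: ifP => // _; rewrite lee_fin sqr_ge0.
- have m1 : measurable_fun setT ((fun z => ((p z - p x) ^+ 2)%:E) \_ J).
    apply/(measurable_restrictT _ _).1 => //; apply: measurable_funTS.
    exact/measurable_EFinP.
  have mt : measurable_fun setT ((fun h => h + x) : R -> R) by apply: measurable_funD.
  exact: measurableT_comp m1 mt.
- apply/(measurable_restrictT _ _).1 => //; apply: measurable_funTS.
  by apply/measurable_EFinP; exact: measurable_shift_sqr'.
- move=> h _; rewrite !patchE /shift_sqr [x + h]addrC.
  case: ifPn => [|_]; last by case: ifP => // _; rewrite lee_fin sqr_ge0.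
  rewrite inE /J /= in_itv/= => /andP[h1 h2].
  by rewrite ifT// inE /= in_itv/=; apply/andP; split; lra.
Qed.

(** The window has length [4 dx], which the factor [dx^-1] of [proj_p_local] turns into 4. *)
Lemma proj_p_L2_close : \int[leb]_x (p x - p1 x) ^+ 2 <= 4 * b.
Proof.
pose I : set (measurableTypeR R) := `[- (2 * dx), 2 * dx]%classic.
have mI : measurable I by exact: measurable_itv.
have lI : leb I = (4 * dx)%:E.
  rewrite /I lebesgue_measure_itv/= lte_fin ifT; last by rewrite (lt_trans _ d2)// oppr_lt0.
  by rewrite -EFinB; congr _%:E; ring.
have m1 : measurable_fun setT (fun x => (p x - p1 x) ^+ 2).
  by apply: measurable_funX; exact: measurable_funB.
have [mS _] := tonelli_shift mp mI.
have S0 x : (0 <= \int[leb]_(h in I) (shift_sqr p h x)%:E)%E.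
  by apply: integral_ge0 => h _; rewrite lee_fin shift_sqr_ge0.
have key : (\int[leb]_x ((p x - p1 x) ^+ 2)%:E <= (4 * b)%:E)%E.
  apply: (@le_trans _ _ (\int[leb]_x ((dx^-1)%:E * \int[leb]_(h in I) (shift_sqr p h x)%:E))%E).
    apply: ge0_le_integral => //.
    - by move=> x _; rewrite lee_fin sqr_ge0.
    - exact/measurable_EFinP.
    - exact: measurable_funeM.
    - by move=> x _; exact: proj_p_local.
  rewrite ge0_integralZl ?lee_fin ?invr_ge0 ?(ltW dx0)//.
  apply: (@le_trans _ _ ((dx^-1)%:E * (b%:E * leb I))%E).
    rewrite lee_pmul2l ?lte_fin ?invr_gt0//.
    exact: (double_modulus mp d2 modulus).
  by rewrite lI -!EFinM lee_fin le_eqVlt; apply/orP; left; apply/eqP; field; rewrite gt_eqF.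
have f : (\int[leb]_x ((p x - p1 x) ^+ 2)%:E \is a fin_num)%E.
  rewrite ge0_fin_numE; first exact: le_lt_trans key (ltry _).
  by apply: integral_ge0 => x _; rewrite lee_fin sqr_ge0.
by rewrite -lee_fin /Rintegral fineK.
Qed.

End ProjectionError.

(** * Weak derivatives and increments *)

Section Cutoff.
Variable R : realType.
Notation leb := (@lebesgue_measure R).
Variable th : R -> R.
Hypothesis th_smooth : smooth th.
Hypothesis th0 : forall x, x <= -1 -> th x = 0.
Hypothesis th1 : forall x, 1 <= x -> th x = 1.
Hypothesis th01 : forall x, 0 <= th x <= 1.

Definition cutoff (n c x : R) : R := th (n * (x - c)).

Lemma derive1n_cutoff (n c c' : R) (m : nat) (x : R) :
  is_derive x 1 (fun x => n ^+ m * (derive1n m th (n * (x - c)) - derive1n m th (n * (x - c'))))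
    (n ^+ m.+1 * (derive1n m.+1 th (n * (x - c)) - derive1n m.+1 th (n * (x - c')))).
Proof.
have aff (e : R) : is_derive x 1 (fun x => n * (x - e)) n.
  by apply: is_derive_eq; rewrite /GRing.scale/=; ring.
have dm (z : R) : is_derive z 1 (derive1n m th) (derive1n m.+1 th z).
  by apply: DeriveDef; [exact: th_smooth|rewrite derive1nS derive1E].
have d1 := @is_derive1_comp R (derive1n m th) (fun x => n * (x - c)) x _ _ (dm _) (aff c).
have d2 := @is_derive1_comp R (derive1n m th) (fun x => n * (x - c')) x _ _ (dm _) (aff c').
have d3 := is_deriveB d1 d2.
have d4 := @is_deriveZ R R^o R^o _ (n ^+ m) x 1 _ d3.
by apply: is_derive_eq d4 _; rewrite /GRing.scale/= exprS; ring.
Qed.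

Lemma derive1n_bump (n c c' : R) (m : nat) :
  derive1n m (fun x => cutoff n c x - cutoff n c' x) =
  fun x => n ^+ m * (derive1n m th (n * (x - c)) - derive1n m th (n * (x - c'))).
Proof.
elim: m => [|m IH]; first by apply/funext => x; rewrite expr0 mul1r.
rewrite derive1nS IH; apply/funext => x; rewrite derive1E.
by have [_ ->] := derive1n_cutoff n c c' m x.
Qed.

Lemma cutoff0 (n c x : R) : 0 < n -> x <= c - n^-1 -> cutoff n c x = 0.
Proof.
move=> n0 h; apply: th0; rewrite -(@ler_pM2l _ n^-1) ?invr_gt0//.
by rewrite mulKf ?gt_eqF//; lra.
Qed.

Lemma cutoff1 (n c x : R) : 0 < n -> c + n^-1 <= x -> cutoff n c x = 1.
Proof.
move=> n0 h; apply: th1; rewrite -(@ler_pM2l _ n^-1) ?invr_gt0//.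
by rewrite mulKf ?gt_eqF//; lra.
Qed.

(** A single step has no compact support; in the difference the two constants 1 cancel on the
    right. *)
Lemma test_function_bump (n a b : R) : 0 < n -> a <= b ->
  test_function (fun x => cutoff n a x - cutoff n b x).
Proof.
move=> n0 ab; split.
  by move=> m x; rewrite derive1n_bump; have [] := derive1n_cutoff n a b m x.
have ni : 0 < n^-1 by rewrite invr_gt0.
apply: (@subclosed_compact _ _ `[a - n^-1, b + n^-1]%classic).
- exact: closed_closure.
- exact: segment_compact.
- rewrite /supp [X in _ `<=` X](_ : _ = closure `[a - n^-1, b + n^-1]%classic).
    apply: closureS => x /= /eqP h; rewrite in_itv/=; apply/andP; split.
      rewrite leNgt; apply/negP => xa; apply: h.
      by rewrite !cutoff0 ?subrr//; lra.
    rewrite leNgt; apply/negP => xb; apply: h.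
    by rewrite !cutoff1 ?subrr//; lra.
  by apply/closure_id; exact: interval_closed.
Qed.

Lemma derive_th_continuous : continuous (derive1 th).
Proof.
move=> x; apply: differentiable_continuous; apply/derivable1_diffP.
exact: (@th_smooth 1%N _).
Qed.

Lemma derive_th_out (x : R) : ~~ (-1 <= x <= 1) -> derive1 th x = 0.
Proof.
rewrite negb_and -!ltNge => /orP[x1|x1].
  rewrite derive1E (@near_eq_derive _ _ _ th (cst 0)) ?derive_cst//.
  near=> z; apply: th0; apply: ltW; near: z; exact: lt_nbhsl.
rewrite derive1E (@near_eq_derive _ _ _ th (cst 1)) ?derive_cst//.
near=> z; apply: th1; apply: ltW; near: z; exact: lt_nbhsr.
Unshelve. all: end_near. Qed.

Lemma derive_th_bound : exists2 C, 0 <= C & forall x, `|derive1 th x| <= C.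
Proof.
have cn : {within `[-1, 1], continuous (fun x => `|derive1 th x|)}.
  by apply: continuous_subspaceT => x; apply: cvg_norm; exact: derive_th_continuous.
have le11 : (-1 : R) <= 1 by lra.
have [c _ hc] := EVT_max le11 cn.
exists `|derive1 th c| => // x; have [x1|x1] := boolP (-1 <= x <= 1).
  by apply: hc; rewrite in_itv/= x1.
by rewrite derive_th_out// normr0.
Qed.

Definition dcutoff (n c x : R) : R := n * derive1 th (n * (x - c)).

Lemma is_derive_cutoff (n c x : R) : is_derive x 1 (cutoff n c) (dcutoff n c x).
Proof.
have aff : is_derive x 1 (fun x => n * (x - c)) n.
  by apply: is_derive_eq; rewrite /GRing.scale/=; ring.
have dm (z : R) : is_derive z 1 th (derive1 th z).
  by apply: DeriveDef; [exact: (@th_smooth 0%N _)|rewrite derive1E].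
have := @is_derive1_comp R th (fun x => n * (x - c)) x _ _ (dm _) aff.
by rewrite /dcutoff mulrC.
Qed.

Lemma cutoff_continuous (n c : R) : continuous (cutoff n c).
Proof.
move=> x; apply: differentiable_continuous; apply/derivable1_diffP.
by have [] := is_derive_cutoff n c x.
Qed.

Lemma dcutoff_continuous (n c : R) : continuous (dcutoff n c).
Proof.
move=> x; apply: cvgM; first exact: cvg_cst.
apply: (@continuous_comp _ _ _ (fun x => n * (x - c)) (derive1 th)).
  apply: cvgM; first exact: cvg_cst.
  by apply: cvgB; [exact: cvg_id|exact: cvg_cst].
exact: derive_th_continuous.
Qed.

Lemma dcutoff_out (n c x : R) : 0 < n -> ~~ (c - n^-1 <= x <= c + n^-1) -> dcutoff n c x = 0.
Proof.
move=> n0 h; rewrite /dcutoff derive_th_out ?mulr0//; apply: contra h => /andP[h1 h2].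
have k : n * n^-1 = 1 by rewrite divff// gt_eqF.
by apply/andP; split; rewrite -(ler_pM2l n0); lra.
Qed.

Lemma Rintegral_dcutoff (n c : R) : 0 < n ->
  \int[leb]_(x in `[c - n^-1, c + n^-1]) dcutoff n c x = 1.
Proof.
move=> n0; have ni : 0 < n^-1 by rewrite invr_gt0.
rewrite /Rintegral (@continuous_FTC2 _ _ (cutoff n c)).
- by rewrite (@cutoff0 n c (c - n^-1))// (@cutoff1 n c (c + n^-1))//= subr0.
- by lra.
- by apply: continuous_subspaceT; exact: dcutoff_continuous.
- split.
  + by move=> x _; have [] := is_derive_cutoff n c x.
  + by apply: cvg_at_right_filter; exact: cutoff_continuous.
  + by apply: cvg_at_left_filter; exact: cutoff_continuous.
- by move=> x _; rewrite derive1E; have [_ ->] := is_derive_cutoff n c x.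
Qed.

Variable u : R -> R.
Hypothesis cu : continuous u.

Lemma integrable_segment (f : R -> R) (a b : R) : continuous f ->
  leb.-integrable `[a, b] (EFin \o f).
Proof.
move=> cf; apply: continuous_compact_integrable; first exact: segment_compact.
exact: continuous_subspaceT.
Qed.

Lemma integrable_u_dcutoff (n c : R) : 0 < n ->
  leb.-integrable setT (EFin \o (fun x => u x * dcutoff n c x)).
Proof.
move=> n0; set K := `[c - n^-1, c + n^-1]%classic : set (measurableTypeR R).
have mK : measurable K by exact: measurable_itv.
have -> : EFin \o (fun x => u x * dcutoff n c x) = (EFin \o (fun x => u x * dcutoff n c x)) \_ K.
  apply/funext => x; rewrite patchE; case: ifPn => // xK /=.
  rewrite dcutoff_out ?mulr0//; apply: contra xK; rewrite inE /K /= in_itv/=.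
  by [].
apply/integrable_restrict => //; rewrite setTI; apply: integrable_segment.
by move=> x; apply: cvgM; [exact: cu|exact: dcutoff_continuous].
Qed.

(* n th' (n (x - c)) is an approximation of the Dirac mass at c. *)
Lemma dirac_cutoff (c e : R) : 0 < e -> exists n0 : nat, forall n : nat, (n0 <= n)%N ->
  `|\int[leb]_x (u x * dcutoff n.+1%:R c x) - u c| <= e.
Proof.
move=> e0; have [C C0 hC] := derive_th_bound.
have e1 : 0 < e / (2 * (C + 1)) by rewrite divr_gt0// mulr_gt0//; lra.
have /cvgrPdist_le /(_ _ e1) /nbhs_ballP [d /= d0 hd] := @cu c.
exists (Num.truncn d^-1) => n n0n; set N : R := n.+1%:R.
have N0 : 0 < N by rewrite ltr0n.
have Ni : 0 < N^-1 by rewrite invr_gt0.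
have Nd : N^-1 < d.
  rewrite invf_plt ?posrE//; have /andP[_ h] : (Num.truncn d^-1)%:R <= d^-1 < (Num.truncn d^-1).+1%:R.
    by apply: truncn_itv; rewrite invr_ge0 ltW.
  by apply: lt_le_trans h _; rewrite ler_nat.
clearbody N; set K := `[c - N^-1, c + N^-1]%classic : set (measurableTypeR R).
have mK : measurable K by exact: measurable_itv.
have -> : \int[leb]_x (u x * dcutoff N c x) = \int[leb]_(x in K) (u x * dcutoff N c x).
  rewrite [RHS]Rintegral_mkcond; apply: eq_Rintegral => x _; rewrite patchE.
  case: ifPn => // xK.
  rewrite dcutoff_out ?mulr0//; apply: contra xK; rewrite inE /K /= in_itv/=.
  by [].
have iu : leb.-integrable K (EFin \o (fun x => u x * dcutoff N c x)).
  by apply: integrable_segment => x; apply: cvgM; [exact: cu|exact: dcutoff_continuous].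
have id : leb.-integrable K (EFin \o dcutoff N c).
  by apply: integrable_segment; exact: dcutoff_continuous.
have jd := integrableZl mK (u c) id.
have -> : u c = \int[leb]_(x in K) (u c * dcutoff N c x).
  by rewrite RintegralZl// /K Rintegral_dcutoff// mulr1.
rewrite -(RintegralB mK iu jd).
have ii := integrableB mK iu jd.
apply: le_trans (le_normr_Rintegral mK ii) _.
have lK : leb K = (2 * N^-1)%:E.
  have cc : c - N^-1 < c + N^-1 by rewrite ltrD2l (lt_trans _ Ni)// oppr_lt0.
  rewrite /K lebesgue_measure_itv/= lte_fin cc.
  by rewrite -EFinB; congr _%:E; ring.
pose M := e / (2 * (C + 1)) * (N * C).
have ic : leb.-integrable K (EFin \o (fun=> M)).
  by apply: integrable_segment => x; exact: cvg_cst.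
apply: (@le_trans _ _ (\int[leb]_(x in K) M)).
  apply: le_Rintegral => //; first exact: (integrable_norm ii).
  move=> x; rewrite /K /= in_itv/= => /andP[x1 x2].
  rewrite -mulrBl normrM; apply: ler_pM => //.
    rewrite distrC; apply: hd; rewrite /ball /= ltr_norml; apply/andP; split; lra.
  by rewrite /dcutoff normrM (ger0_norm (ltW N0)) ler_wpM2l// ltW.
rewrite Rintegral_cst// -[leLHS]/(M * fine (leb K)) lK /=.
have -> : M * (2 * N^-1) = e * (C / (C + 1)).
  by rewrite /M; field; rewrite !gt_eqF//; lra.
rewrite ler_piMr ?(ltW e0)// ler_pdivrMr ?mul1r; lra.
Qed.

Lemma dominated_bump (w : R -> R) (a b : R) : a < b ->
  measurable_fun setT w -> leb.-integrable `[a - 1, b + 1] (EFin \o w) ->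
  forall e : R, 0 < e -> exists n0 : nat, forall n : nat, (n0 <= n)%N ->
  `|\int[leb]_x (w x * (cutoff n.+1%:R a x - cutoff n.+1%:R b x)) - \int[leb]_(x in `]a, b]) w x| <= e.
Proof.
move=> ab mw iw e e0.
set J := `[a - 1, b + 1]%classic : set (measurableTypeR R).
have mJ : measurable J by exact: measurable_itv.
pose phi (n : nat) (x : R) := cutoff n.+1%:R a x - cutoff n.+1%:R b x.
pose lim0 (x : R) : R := \1_(`]a, b]%classic : set (measurableTypeR R)) x.
have phi1 n x : `|phi n x| <= 1.
  have /andP[h1 h2] := th01 (n.+1%:R * (x - a)).
  have /andP[h3 h4] := th01 (n.+1%:R * (x - b)).
  by rewrite ler_norml /phi /cutoff; apply/andP; split; lra.
have mphi n : measurable_fun setT (phi n).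
  by apply: continuous_measurable_fun => x; apply: cvgB; exact: cutoff_continuous.
have n1 (n : nat) : (n.+1%:R : R)^-1 <= 1 by rewrite invf_le1 ?ltr0n// ler1n.
have phi_out n x : ~~ (a - 1 <= x <= b + 1) -> phi n x = 0.
  have N0 : (0 : R) < n.+1%:R by rewrite ltr0n.
  have k := n1 n.
  rewrite /phi; move: N0 k; move: (n.+1%:R : R) => N N0 k.
  rewrite negb_and -!ltNge => /orP[xa|xb].
    by rewrite !cutoff0 ?subrr//; lra.
  by rewrite !cutoff1 ?subrr//; lra.
(* Away from the two endpoints the bump equals its limit as soon as its transition zones, of
   half-width [1 / (n + 1)], miss [x]. All bumps vanish off [[a - 1, b + 1]], where [|w|]
   dominates. *)
have phi_lim x : x != a -> x != b -> \forall n \near \oo, phi n x = lim0 x.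
  move=> xa xb; pose d := Num.min `|x - a| `|x - b|.
  have d0 : 0 < d by rewrite lt_min !normr_gt0 !subr_eq0 xa xb.
  exists (Num.truncn d^-1) => // n /= n0n.
  have N0 : (0 : R) < n.+1%:R by rewrite ltr0n.
  have Nd : (n.+1%:R : R)^-1 < d.
    rewrite invf_plt ?posrE//.
    have /andP[_ h] : (Num.truncn d^-1)%:R <= d^-1 < (Num.truncn d^-1).+1%:R.
      by apply: truncn_itv; rewrite invr_ge0 ltW.
    by apply: lt_le_trans h _; rewrite ler_nat.
  move: Nd; rewrite /d lt_min => /andP[da db].
  rewrite /phi /lim0 indicE mem_setE in_itv/=.
  move: N0 da db; move: (n.+1%:R : R) => N N0 da db.
  have [xa'|xa'|xa'] := ltgtP x a; last by rewrite xa' eqxx in xa.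
    rewrite ler0_norm in da; last by lra.
    rewrite ler0_norm in db; last by lra.
    by rewrite !cutoff0 ?subrr//; lra.
  rewrite gtr0_norm in da; last by lra.
  rewrite (@cutoff1 N a x) //; last by lra.
  have [xb'|xb'|xb'] := ltgtP x b; last by rewrite xb' eqxx in xb.
    rewrite ltr0_norm in db; last by lra.
    by rewrite cutoff0 ?subr0//; lra.
  rewrite gtr0_norm in db; last by lra.
  by rewrite cutoff1 ?subrr//; lra.
have dc := @dominated_convergence _ _ R leb J mJ
  (fun n x => (w x * phi n x)%:E) (fun x => (w x * lim0 x)%:E) (fun x => `|w x|%:E).
have [] := dc.
- move=> n; apply/measurable_EFinP; apply: measurable_funTS; exact (measurable_funM mw (mphi n)).
- apply/measurable_EFinP; apply: measurable_funTS; apply (measurable_funM mw); exact: measurable_indic.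
- exists [set a; b]; split.
  + by apply: measurableU; exact: measurable_set1.
  + by apply: countable_lebesgue_measure0; exact: finite_set_countable.
  + move=> x /= h; apply: contrapT => /not_orP[/eqP xa /eqP xb]; apply: h => _.
    by apply: cvg_near_cst; apply: filterS (phi_lim x xa xb) => n /= ->.
- exact: (integrable_norm iw).
- apply: aeW => x n _; rewrite abse_EFin lee_fin normrM -[leRHS]mulr1 ler_wpM2l//.
move=> il _ /= cvg_int.
have fl : (\int[leb]_(x in J) (w x * lim0 x)%:E)%E \is a fin_num by exact: integrable_fin_num.
move: cvg_int; rewrite -(fineK fl) => /fine_cvg /cvgrPdist_le /(_ e e0) [n0 _ h].
exists n0 => n n0n; have := h n n0n; rewrite distrC /=.
have -> : \int[leb]_(x in `]a, b]) w x = fine (\int[leb]_(x in J) (w x * lim0 x)%:E)%E.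
  rewrite -[RHS]/(\int[leb]_(x in J) (w x * lim0 x)) Rintegral_mkcond [RHS]Rintegral_mkcond.
  apply: eq_Rintegral => x _; rewrite !patchE /lim0 indicE.
  have [xab|xab] := boolP (x \in `]a, b]%classic); last by rewrite mulr0; case: ifP.
  by rewrite mulr1 ifT//; move: xab; rewrite !inE /J /= !in_itv/= => /andP[h1 h2]; apply/andP; split; lra.
have -> // : \int[leb]_x (w x * (cutoff n.+1%:R a x - cutoff n.+1%:R b x)) =
  fine (\int[leb]_(x in J) (w x * phi n x)%:E)%E.
rewrite -[RHS]/(\int[leb]_(x in J) (w x * phi n x)) [RHS]Rintegral_mkcond.
apply: eq_Rintegral => x _; rewrite patchE; case: ifPn => // xJ.
rewrite -[_ - _]/(phi n x) phi_out ?mulr0//; apply: contra xJ; rewrite inE /J /= in_itv/=.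
by [].
Qed.

(** The test function rises at [a] and falls at [b]: in the limit it is the indicator of []a, b]],
    and its derivative is the Dirac mass at [a] minus the one at [b]. Continuity of [u] gives these
    masses their pointwise meaning. *)
Lemma weak_derivative_increment_cutoff (ux : R -> R) (a b : R) : weak_derivative u ux -> a <= b ->
  u b - u a = \int[leb]_(x in `]a, b]) ux x.
Proof.
move=> [_ [mux _ lux] wd]; rewrite le_eqVlt => /predU1P[<-|ab].
  by rewrite subrr set_itvoc0 Rintegral_set0.
have iux : leb.-integrable `[a - 1, b + 1] (EFin \o ux).
  apply/integrableP; split; first by apply/measurable_EFinP; exact: measurable_funTS.
  by apply: lux => //; exact: segment_compact.
apply/eqP; rewrite -subr_eq0 -normr_le0; apply/ler_addgt0Pr => e e0; rewrite add0r.
have e3 : 0 < e / 3 by rewrite divr_gt0.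
have [na ha] := dirac_cutoff a e3.
have [nb hb] := dirac_cutoff b e3.
have [n0 h0] := dominated_bump ab mux iux e3.
pose n := maxn n0 (maxn na nb).
have {}ha := ha n (leq_trans (leq_maxl _ _) (leq_maxr _ _)).
have {}hb := hb n (leq_trans (leq_maxr _ _) (leq_maxr _ _)).
have {}h0 := h0 n (leq_maxl _ _).
have N0 : (0 : R) < n.+1%:R by rewrite ltr0n.
have := wd _ (test_function_bump N0 (ltW ab)).
have -> : derive1 (fun x => cutoff n.+1%:R a x - cutoff n.+1%:R b x) =
    fun x => dcutoff n.+1%:R a x - dcutoff n.+1%:R b x.
  apply/funext => x; rewrite derive1E.
  by have [_ ->] := is_deriveB (is_derive_cutoff n.+1%:R a x) (is_derive_cutoff n.+1%:R b x).
have -> : \int[leb]_x (u x * (dcutoff n.+1%:R a x - dcutoff n.+1%:R b x)) =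
    \int[leb]_x (u x * dcutoff n.+1%:R a x) - \int[leb]_x (u x * dcutoff n.+1%:R b x).
  rewrite -RintegralB//; [|exact: integrable_u_dcutoff|exact: integrable_u_dcutoff].
  by apply: eq_Rintegral => x _; rewrite mulrBr.
move: ha hb h0; set A := \int[leb]_x (u x * dcutoff _ a x).
set B := \int[leb]_x (u x * dcutoff _ b x).
set C := \int[leb]_x (ux x * _); set D := \int[leb]_(x in _) _.
move: (u a) (u b) => ua ub; rewrite !ler_norml.
move=> /andP[h1 h2] /andP[h3 h4] /andP[h5 h6] h7; apply/andP; split; lra.
Qed.

End Cutoff.

Lemma notin_supp (R : realType) (f : R -> R) (x : R) : ~ supp f x -> f x = 0.
Proof.
move=> h; apply/eqP/negPn/negP => fx; apply: h; exact: subset_closure.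
Qed.

Lemma weak_derivative_increment (R : realType) (thp thm u ux : R -> R) (a b : R) :
  partition_pair thp thm -> continuous u -> weak_derivative u ux -> a <= b ->
  u b - u a = \int[@lebesgue_measure R]_(x in `]a, b]) ux x.
Proof.
move=> [[sp _] pm th01 supp_p supp_m] cu; apply: (@weak_derivative_increment_cutoff _ thp) => //.
- move=> x x1; apply: notin_supp => /supp_p /=; rewrite in_itv/= andbT; lra.
- move=> x x1; have -> : thp x = 1 - thm x by rewrite -(pm x) addrK.
  rewrite (@notin_supp _ thm) ?subr0// => /supp_m /=; rewrite in_itv/=; lra.
- by move=> x; have [] := th01 x.
Qed.

(** * The error estimate *)

Section Seminorm.
Variable R : realType.
Notation leb := (@lebesgue_measure R).

Lemma B2_modulus (beta h : R) (f : R -> R) : B2 beta f -> 0 < h <= 2 ->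
  (\int[leb]_x (shift_sqr f h x)%:E <= ((fine (B2_seminorm beta f) * h `^ beta) ^+ 2)%:E)%E.
Proof.
move=> [_ [C C0 hC]] h02; have /andP[h0 _] := h02.
set S := [set ((h `^ (- beta))%:E * normL 2 (delta h f))%E | h in `]0, 2]%classic].
(* The seminorm enters through [fine], which sends [+oo] to 0, so its finiteness has to come first;
   it is where the constant of [B2] is used. *)
have SC : (ereal_sup S <= C%:E)%E.
  apply: ge_ereal_sup => _ [k + <-]; rewrite /= in_itv/= => k02.
  have /andP[k0 _] := k02.
  apply: (@le_trans _ _ ((k `^ (- beta))%:E * (C * k `^ beta)%:E)%E).
    by rewrite lee_pmul2l ?lte_fin ?powR_gt0//; exact: hC.
  by rewrite -EFinM lee_fin mulrCA -powRD ?addNr ?powRr0 ?mulr1 ?(gt_eqF k0) ?implybT.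
have hS : ((h `^ (- beta))%:E * normL 2 (delta h f) <= ereal_sup S)%E.
  by apply: ereal_sup_ubound; exists h => //=; rewrite ?in_itv.
have N0 : (0 <= normL 2 (delta h f))%E by exact: Lnorm_ge0.
have S0 : (0 <= ereal_sup S)%E.
  by apply: le_trans hS; rewrite mule_ge0// lee_fin powR_ge0.
have Sf : ereal_sup S \is a fin_num.
  by rewrite ge0_fin_numE//; apply: le_lt_trans SC _; rewrite ltry.
have hN : (normL 2 (delta h f) <= (fine (ereal_sup S) * h `^ beta)%:E)%E.
  have : ((h `^ beta)%:E * ((h `^ (- beta))%:E * normL 2 (delta h f)) <=
      (h `^ beta)%:E * ereal_sup S)%E.
    by rewrite lee_pmul2l ?lte_fin ?powR_gt0.
  rewrite muleA -EFinM -powRD ?(gt_eqF h0) ?implybT// addrN powRr0 mul1e.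
  by rewrite EFinM fineK// muleC.
have -> : (\int[leb]_x (shift_sqr f h x)%:E = normL 2 (delta h f) `^ 2)%E.
  rewrite poweR_Lnorm//; apply: eq_integral => x _.
  by rewrite /= powR_mulrn// real_normK ?num_real.
apply: (@le_trans _ _ ((fine (ereal_sup S) * h `^ beta)%:E `^ 2)%E).
  apply: gt0_ler_poweR => //; rewrite !in_itv/= leey ?andbT// lee_fin.
  by rewrite mulr_ge0 ?powR_ge0// fine_ge0.
by rewrite poweR_EFin lee_fin powR_mulrn// mulr_ge0// ?powR_ge0// fine_ge0.
Qed.

End Seminorm.

Section ProjectedSolution.
Variable R : realType.
Notation leb := (@lebesgue_measure R).

(** The term [16 B^2] is the [L^2] error of the projection: 4 from [proj_p_L2_close] times the
    modulus [4 B^2]. The term [2 G] comes from the energy of a cell, whose remaining [8 B^2] the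
    first term covers. *)
Definition energy_constant (G B : R) : R := 16 * B ^+ 2 + 2 * G.

Lemma projection_sol_u_close (u p F Fac E E1 : R -> R)
    (ms : {measure set (measurableTypeR R) -> \bar R}) (N : set (measurableTypeR R))
    (G B dx beta alpha T t x : R) (s : int -> bool) :
  profile u p F ms N G ->
  (forall x, Fac x = \int[leb]_(z in `]-oo, x[) (p z ^+ 2)) ->
  0 < dx <= 1 -> 0 < beta <= 1 -> 0 <= B ->
  (forall h, 0 < h <= 2 ->
    (\int[leb]_x (shift_sqr p h x)%:E <= ((B * h `^ beta) ^+ 2)%:E)%E) ->
  0 <= alpha <= 1 -> 0 <= t <= T ->
  `|sol_u (mapT alpha t (Eulerian u E F)) x
    - sol_u (mapT alpha t (Eulerian (proj_u dx s u Fac) E1 (proj_F u F Fac dx s))) x|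
  <= (2 * comparison_constant G (energy_constant G B) T + G) * dx `^ (beta / 4).
Proof.
move=> P FacE dx01 beta01 B0 modulus alpha01 t0T.
have /andP[dx0 dx1] := dx01; have /andP[beta0 beta1] := beta01.
have G0 : 0 <= G.
  by apply: le_trans (profile_sqr_le P); apply: Rintegral_ge0 => z _; exact: sqr_ge0.
pose K := energy_constant G B.
have B2 : 0 <= B ^+ 2 by exact: sqr_ge0.
have K0 : 0 <= K by rewrite /K /energy_constant addr_ge0// mulr_ge0.
(* The averaging scale is [2 q]. Its modulus is governed by [q^beta = e], and the other contribution
   [dx / q = q] is at most [e] because [beta <= 1]. *)
set r := dx `^ (beta / 4); pose e := dx `^ (beta / 2); pose q := dx `^ 2^-1.
have r0 : 0 < r by exact: powR_gt0.
have e0 : 0 < e by exact: powR_gt0.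
have q0 : 0 < q by exact: powR_gt0.
have le1 (a : R) : 0 <= a -> dx `^ a <= 1.
  by move=> a0; rewrite -[leRHS](powRr0 dx); exact: ger_powR.
have r1 : r <= 1 by apply: le1; rewrite divr_ge0// ltW.
have e1 : e <= 1 by apply: le1; rewrite divr_ge0// ltW.
have q1 : q <= 1 by apply: le1; rewrite invr_ge0.
have er : e = r ^+ 2.
  by rewrite -powR_mulrn ?ltW// -powRrM; congr (_ `^ _); field.
have eb : e ^+ 2 = dx `^ beta.
  by rewrite -powR_mulrn ?ltW// -powRrM; congr (_ `^ _); field.
have qd : q ^+ 2 = dx.
  by rewrite -powR_mulrn ?ltW// -powRrM mulVf// powRr1// ltW.
have qe : q `^ beta = e by rewrite -powRrM; congr (_ `^ _); ring.
have q_le : q <= e by apply: ger_powR => //; lra.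
have dxe : dx <= e ^+ 2.
  by rewrite eb -{1}[dx]powRr1 ?(ltW dx0)//; exact: ger_powR.
have two : 2 `^ beta <= 2 :> R.
  by rewrite -[leRHS]powRr1//; apply: ler_powR => //; lra.
(* The modulus at scale [2 a], used below with [a = dx] and [a = q]. The factor [2^beta] is bounded
   by 2, which gives the 4 after squaring. *)
have grow (a h b : R) : 0 <= a -> 0 < h <= 2 * a -> 2 * a <= 2 -> a `^ beta <= b ->
    (\int[leb]_x (shift_sqr p h x)%:E <= (4 * B ^+ 2 * b ^+ 2)%:E)%E.
  move=> a0 /andP[h0 ha] a2 ab.
  apply: le_trans (modulus _ _) _; first by rewrite h0 (le_trans ha).
  rewrite lee_fin; have -> : 4 * B ^+ 2 * b ^+ 2 = (B * (2 * b)) ^+ 2 by ring.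
  have hb : h `^ beta <= 2 * b.
    apply: (@le_trans _ _ ((2 * a) `^ beta)).
      by apply: ge0_ler_powR; rewrite ?nnegrE ?mulr_ge0 ?(ltW h0) ?(ltW beta0).
    by rewrite powRM//; apply: ler_pM => //; exact: powR_ge0.
  have b0 : 0 <= b by apply: le_trans ab; exact: powR_ge0.
  by apply: lerXn2r; rewrite ?nnegrE ?mulr_ge0 ?powR_ge0// ler_wpM2l.
have ee : e ^+ 2 <= e by rewrite expr2 ler_piMr// ltW.
have [ms1 [N1 P1]] := profile_projection s P dx0 FacE.
have close_L2 : \int[leb]_x (p x - proj_p u Fac dx s x) ^+ 2 <= K * e ^+ 2.
  have m2 h : 0 < h <= 2 * dx ->
      (\int[leb]_x (shift_sqr p h x)%:E <= (4 * B ^+ 2 * (e ^+ 2) ^+ 2)%:E)%E.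
    by move=> h2; apply: (grow dx) => //; [exact: ltW|lra|rewrite eb].
  (* At scale [dx] the modulus is [4 B^2 e^4]; the comparison only asks for [e^2], and [e <= 1]
     allows the weakening. *)
  apply: le_trans (proj_p_L2_close s P dx0 FacE m2) _.
  have e4 : (e ^+ 2) ^+ 2 <= e ^+ 2.
    by rewrite [leLHS]expr2 ler_piMr ?sqr_ge0// (le_trans ee).
  have : 16 * B ^+ 2 * (e ^+ 2) ^+ 2 <= 16 * B ^+ 2 * e ^+ 2.
    by rewrite ler_wpM2l// mulr_ge0.
  have : 0 <= 2 * G * e ^+ 2 by rewrite !mulr_ge0// ltW.
  rewrite /K /energy_constant; lra.
have cell (j : int) : \int[leb]_(x in `]node dx j, node dx (j + 1)]) p x ^+ 2 <= K * e.
  have l0 : 0 < 2 * q by rewrite mulr_gt0.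
  have m2 h : 0 < h <= 2 * q ->
      (\int[leb]_x (shift_sqr p h x)%:E <= (4 * B ^+ 2 * e ^+ 2)%:E)%E.
    by move=> h2; apply: (grow q) => //; [exact: ltW|lra|rewrite qe].
  have nj : node dx j <= node dx (j + 1) by rewrite nodeS; lra.
  apply: le_trans (short_interval_energy (profile_p P) l0 m2 nj
    (profile_integrable_sqr P) (profile_sqr_le P)) _.
  have -> : 2 / (2 * q) * (node dx (j + 1) - node dx j) = 2 * q.
    by rewrite nodeS -qd; field; rewrite gt_eqF.
  have : 8 * B ^+ 2 * e ^+ 2 <= 8 * B ^+ 2 * e by rewrite ler_wpM2l// mulr_ge0.
  have : q * G <= e * G by rewrite ler_wpM2r.
  have : 0 <= 8 * B ^+ 2 * e by rewrite !mulr_ge0// ltW.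
  rewrite /K /energy_constant; lra.
apply: (sol_u_close E E1 P P1 e0 e1 K0 close_L2 _ alpha01 x t0T r0 r1 er) => xi.
have [j [/andP[h1 h2] /andP[h3 h4]]] := ginv_same_cell s P dx0 FacE xi.
exists (node dx j), (node dx (j + 1)); split.
- by rewrite h1 ltW.
- by rewrite h3 ltW.
- by rewrite nodeS; lra.
- by rewrite proj_u_node.
- by split; [|rewrite (proj_p_cell_energy s P dx0 FacE)]; exact: cell.
Qed.

End ProjectedSolution.

(** * Admissible initial data as profiles *)

Section InitialData.
Variable R : realType.
Notation leb := (@lebesgue_measure R).

Lemma smooth_continuous (f : R -> R) : smooth f -> continuous f.
Proof.
move=> sf x; apply: differentiable_continuous; apply/derivable1_diffP.
exact: (sf 0%N x).
Qed.

Lemma E2_continuous (thp thm u : R -> R) : smooth thp -> smooth thm ->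
  E2 thp thm u -> continuous u.
Proof.
move=> sp sm [f [a [b [[cf _ _] uE]]]] x.
have -> : u = (fun x => f x + a * thp x + b * thm x) by apply/funext.
apply: cvgD; first (apply: cvgD; first exact: cf).
  by apply: cvgM; [exact: cvg_cst|exact: smooth_continuous].
by apply: cvgM; [exact: cvg_cst|exact: smooth_continuous].
Qed.

(** The distribution function is that of [nu] because [mapL] builds the characteristics from the
    third component; equality of [mu] and [nu] transfers the Lebesgue decomposition to it. *)
Lemma D0_profile (thp thm u ux : R -> R) (mu nu mu_ac mu_sing : fin_measure R) :
  partition_pair thp thm -> weak_derivative u ux ->
  lebesgue_decomposition mu mu_ac mu_sing -> D0 thp thm u ux mu nu mu_ac ->
  exists N, profile u ux (Fdist nu) mu_sing N (fine (nu setT)).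
Proof.
move=> pp wd [muE _ [N [mN N0 sN]]] [uE2 munu acE _]; exists N.
have mNy (x : R) : measurable (`]-oo, x[%classic : set (measurableTypeR R)).
  exact: measurable_itv.
split => //.
- by case: wd => _ [].
- move=> a b; apply: (weak_derivative_increment pp _ wd).
  by case: pp => -[sp sm] _ _ _ _; exact: E2_continuous uE2.
- move=> x; rewrite /Fdist fineK; last exact: fin_num_measure.
  by rewrite -munu// muE// acE.
- rewrite fineK; last exact: fin_num_measure.
  by rewrite -munu// muE// acE.
Qed.

End InitialData.

Unset Implicit Arguments.

Theorem mainTheorem2 (R : realType) :
  exists D : R -> R -> R -> R -> R -> R,
  forall (alpha T dx beta : R) (thp thm : R -> R) (u ux : R -> R)
    (mu nu mu_ac mu_sing : fin_measure R) (s : int -> bool),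
  0 <= alpha < 1 -> 0 < T -> 0 < dx <= 1 -> 0 < beta <= 1 ->
  partition_pair thp thm ->
  weak_derivative u ux ->
  lebesgue_decomposition mu mu_ac mu_sing ->
  D0 thp thm u ux mu nu mu_ac ->
  B2 beta ux ->
  let X0 := eulerian_of u mu nu in
  let Xdx := projection dx s (Fdist mu_ac) X0 in
  let err t : \bar R :=
    normL +oo (fun x => sol_u (mapT alpha t X0) x
                        - sol_u (mapT alpha t Xdx) x) in
  let Dbar := D T (fine (nu setT)) (fine (normL +oo u)) beta
                (fine (B2_seminorm beta ux)) in
  (ereal_sup [set err t | t in `[0%R, T]] <= (Dbar * dx `^ (beta / 4))%:E)%E.
Proof.
exists (fun T G _ _ B => 2 * comparison_constant G (energy_constant G B) T + G).
move=> alpha T dx beta thp thm u ux mu nu mu_ac mu_sing s alpha01 T0 dx01 beta01.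
move=> pp wd dec D0u B2u; cbv zeta.
set X0 := eulerian_of u mu nu; set Xdx := projection _ _ _ X0.
set Dbar := 2 * _ + _.
have [N P] := D0_profile pp wd dec D0u.
have [_ munu acE _] := D0u.
have FE : Fdist mu = Fdist nu.
  by apply/funext => x; rewrite /Fdist munu//; exact: measurable_itv.
have FacE x : Fdist mu_ac x = \int[lebesgue_measure]_(z in `]-oo, x[) (ux z ^+ 2).
  by rewrite /Fdist acE//; exact: measurable_itv.
have B0 : 0 <= fine (B2_seminorm beta ux).
  rewrite fine_ge0//; apply: (@le_trans _ _ ((1 `^ (- beta))%:E * normL 2 (delta 1 ux))%E).
    by rewrite mule_ge0 ?lee_fin ?powR_ge0// Lnorm_ge0.
  by apply: ereal_sup_ubound; exists 1; rewrite //= in_itv/= ltr01 ler1n.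
have alpha1 : 0 <= alpha <= 1.
  by case/andP: alpha01 => -> /ltW.
have close t x : 0 <= t <= T ->
    `|sol_u (mapT alpha t X0) x - sol_u (mapT alpha t Xdx) x| <= Dbar * dx `^ (beta / 4).
  move=> t0T; rewrite /X0 /Xdx /eulerian_of /projection /= FE.
  exact: (projection_sol_u_close _ _ x s P FacE dx01 beta01 B0 (fun h => @B2_modulus _ _ h _ B2u)
    alpha1 t0T).
apply: ge_ereal_sup => _ [t + <-]; rewrite /= in_itv/= => t0T.
(* The norm is an essential supremum if the line has positive measure and 0 otherwise; the pointwise
   bound settles both cases. *)
rewrite /normL unlock; case: ifPn => _.
  by apply: ess_sup_ler => x; rewrite lee_fin; exact: close.
by rewrite lee_fin; apply: le_trans (close t 0 t0T).
Qed.
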